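(* Let $T$ be a totally ordered set. For any finitely presented filtration $\mathcal F\colon T\to \mathbf{Simp}$: (i) $\mathcal{NF}$ is a simplicial model of the subdivision bifiltration $\mathcal{SF}$ whose $k$-skeleton has size $O(m_k)$, where $m_k=m_k(\mathcal F)$ and $k\ge 0$; (ii) the $0$-skeleton of any simplicial model of $\mathcal{SF}$ has size at least $m_0=m_0(\mathcal F)$.
   Context: Conventions: $\mathbb N=\{1,2,\dots\}$. $\mathbf{Simp}$ is the category of finite simplicial complexes and simplicial maps, regarded as a subcategory of topological spaces $\mathbf{Top}$ via geometric realization. A poset $P$ is regarded as a category; for a functor $\mathcal G$ on $P$ write $\mathcal G_p$ for its value at $p$. Products of posets carry the product order. A filtration $\mathcal F\colon P\to\mathbf{Simp}$ is a functor all of whose structure maps $\mathcal F_p\to\mathcal F_q$ ($p\le q$) are inclusions; $\operatorname{colim}\mathcal F=\bigcup_p \mathcal F_p$. Weak equivalence and models: For functors $\mathcal G,\mathcal G'\colon P\to\mathbf{Top}$, an objectwise homotopy equivalence is a natural transformation each of whose components is a homotopy equivalence; $\mathcal G$ and $\mathcal G'$ are weakly equivalent ($\mathcal G\simeq\mathcal G'$) if they are connected by a finite zigzag of objectwise homotopy equivalences. A simplicial model of $\mathcal G\colon P\to\mathbf{Top}$ is a functor $\mathcal G'\colon P\to\mathbf{Simp}$ with $\mathcal G\simeq\mathcal G'$. Size: Fix a field $\mathbb K$. A persistence module over $P$ is a functor $M\colon P\to\mathbf{Vec}$ to $\mathbb K$-vector spaces. For $p\in P$ let $\mathbb K^{\langle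 p\rangle}$ be the module equal to $\mathbb K$ at all $x\ge p$ and $0$ elsewhere, with identity structure maps between the copies of $\mathbb K$; a module is free if it is isomorphic to a direct sum of such modules. $M$ is finitely presented if it is isomorphic to the cokernel of a morphism between finitely generated free modules. If $P$ is a finite product of totally ordered sets and $M$ is finitely presented, then $M$ has a minimal free resolution $F_\bullet$ (one isomorphic to a direct summand of every free resolution), unique up to isomorphism, with each $F_i$ finitely generated; $\beta_i(M)$ denotes the cardinality of a minimal generating set of $F_i$. For $\mathcal G\colon P\to\mathbf{Simp}$, $C_j\mathcal G$ is the persistence module $p\mapsto C_j(\mathcal G_p;\mathbb K)$ of simplicial $j$-chains. $\mathcal G$ is finitely presented if every $C_j\mathcal G$ is. The size of a finitely presented $\mathcal G$ is $\beta_1(C_0\mathcal G)+\sum_{j\ge 0}\beta_0(C_j\mathcal G)$. The $k$-skeleton of $\mathcal G$ is the functor $p\mapsto k$-skeleton of $\mathcal G_p$. The numbers $m_k$: A simplex is maximal in a complex if it is not properly contained in another simplex of it. $m_k(\mathcal F)$ is the number of nonempty sets $S$ of simplices of $\operatorname{colim}\mathcal F$ such that $|S|\le k+1$ and, for some $t\in T$, every $\sigma\in S$ is a maximal simplex of $\mathcal F_t$. In particular $m_0$ is the number of simplices of $\operatorname{colim}\mathcal F$ that are maximal in some $\mathcal F_t$. Subdivision bifiltration: A flag of a complex $W$ is a chain of nested simplices $\sigma_1\subset\cdots\subset\sigma_m$ of $W$; the flags form the barycentric subdivision of $W$. For $k\in\mathbb N$, $\mathcal S(W)_k$ is the subcomplex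 of the barycentric subdivision consisting of all flags whose minimum element has dimension at least $k-1$. For a filtration $\mathcal F\colon P\to\mathbf{Simp}$, $\mathcal{SF}\colon\mathbb N^{\mathrm{op}}\times P\to\mathbf{Simp}$ is the filtration $\mathcal{SF}_{k,p}=\mathcal S(\mathcal F_p)_k$. The construction $\mathcal{NF}\colon\mathbb N^{\mathrm{op}}\times P\to\mathbf{Simp}$ of a filtration $\mathcal F\colon P\to\mathbf{Simp}$ (here $P=T$): Choose a well-ordering of the vertices of $\operatorname{colim}\mathcal F$, and order the simplices of $\operatorname{colim}\mathcal F$ lexicographically. Let $\Sigma_t$ be the set of maximal simplices of $\mathcal F_t$. For $t\le t'$ in $P$, let $\Sigma_t\to\Sigma_{t'}$ be the map sending $\sigma\in\Sigma_t$ to the lexicographically minimum simplex in $\Sigma_{t'}$ containing $\sigma$. The sets $\Sigma_t$ together with these maps form a cover of $\mathcal F$ (each $\mathcal F_t$ being covered by its maximal simplices), which induces via barycentric subdivision the cover $\mathcal U$ of $\mathcal{SF}$ with $\mathcal U_{k,t}=\{\mathcal S(\bar\sigma)_k\mid\sigma\in\Sigma_t\}$, where $\bar\sigma$ is the complex consisting of $\sigma$ and all its faces. $\mathcal{NF}$ is the nerve of $\mathcal U$: the simplices of $\mathcal{NF}_{k,t}$ are the nonempty finite sets $S\subset\Sigma_t$ with $\bigcap_{\sigma\in S}\mathcal S(\bar\sigma)_k\neq\emptyset$, and the structure map $\mathcal{NF}_{k,t}\to\mathcal{NF}_{k',t'}$ is the simplicial map given on vertices by $\Sigma_t\to\Si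gma_{t'}$.
   Formalization: The maps Σ_t→Σ_t' by direct lexicographic minimum need not compose, so NF may fail to be a functor; here the rule is applied only for t≤t' with no other value of F in between and extended by composition, which agrees with the original whenever that is functorial. *)

(* Defs.v *)
From Stdlib Require Import Relation_Operators.
From HB Require Import structures.
From mathcomp Require Import all_boot all_order all_algebra finmap.
From mathcomp Require Import all_classical all_reals topology normedtype.

Set Implicit Arguments.
Unset Strict Implicit.
Unset Printing Implicit Defensive.
Import Order.TTheory GRing.Theory Num.Theory.
Import numFieldNormedType.Exports.

Local Open Scope classical_set_scope.
Local Open Scope fset_scope.
Local Open Scope ring_scope.

Record posnat := PosNat { posnat_val :> nat; _ : (0 < posnat_val)%N }.

HB.instance Definition _ := [isSub for posnat_val].
HB.instance Definition _ := [Choice of posnat by <:].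
HB.instance Definition _ := [SubChoice_isSubOrder of posnat by <:
  with Order.default_display].

(* Elements of [V] that belong to no simplex are not vertices of the complex. *)
Record scomplex (V : choiceType) := SComplex {
  simps : {fset {fset V}};
  simps_neq0 : forall s, s \in simps -> s != fset0;
  simps_closed : forall s t, s \in simps -> t `<=` s -> t != fset0 ->
    t \in simps }.

Section Complexes.
Variable V : choiceType.
Implicit Types (W : scomplex V) (s t : {fset V}).

Definition sdim s : nat := (#|` s|).-1.

Definition vertex W (v : V) : bool := [fset v] \in simps W.

Definition maxsimps W : {fset {fset V}} :=
  [fset s in simps W | all (fun t => (s `<=` t) ==> (t == s)) (simps W)].

Definition closed_simplex_simps s := [fset t in fpowerset s | t != fset0].

Fact closed_simplex_neq0 s t : t \in closed_simplex_simps s -> t != fset0.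
Proof. by rewrite !inE => /andP[]. Qed.

Fact closed_simplex_closed s t u : t \in closed_simplex_simps s ->
  u `<=` t -> u != fset0 -> u \in closed_simplex_simps s.
Proof.
rewrite !inE /= !fpowersetE => /andP[ts _] ut ->.
by rewrite (fsubset_trans ut ts).
Qed.

Definition closed_simplex s : scomplex V :=
  SComplex (@closed_simplex_neq0 s) (@closed_simplex_closed s).

Definition skel_simps (k : nat) W := [fset s in simps W | (sdim s <= k)%N].

Fact skel_neq0 k W s : s \in skel_simps k W -> s != fset0.
Proof. by rewrite !inE => /andP[/simps_neq0]. Qed.

Fact skel_closed k W s t : s \in skel_simps k W ->
  t `<=` s -> t != fset0 -> t \in skel_simps k W.
Proof.
rewrite !inE /= => /andP[sW sk] ts t0; rewrite (simps_closed sW ts t0) /=.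
apply: leq_trans sk; rewrite /sdim -!subn1 leq_sub2r //.
exact: fsubset_leq_card.
Qed.

Definition skel k W : scomplex V := SComplex (@skel_neq0 k W) (@skel_closed k W).

Definition is_flag (c : {fset {fset V}}) : bool :=
  (c != fset0) && all (fun s => all (fun t => (s `<=` t) || (t `<=` s)) c) c.

Definition flag_min_dim_ge (c : {fset {fset V}}) (m : nat) : bool :=
  has (fun s => all (fun t => s `<=` t) c && (m <= sdim s)%N) c.

Definition subdiv_simps W (k : nat) :=
  [fset c in fpowerset (simps W) | is_flag c && flag_min_dim_ge c k.-1].

Fact subdiv_neq0 W k c : c \in subdiv_simps W k -> c != fset0.
Proof. by rewrite !inE => /andP[_ /andP[/andP[]]]. Qed.

Fact flag_min (c : {fset {fset V}}) : is_flag c ->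
  exists2 s, s \in c & all (fun t => s `<=` t) c.
Proof.
case/andP => /fset0Pn[s0 s0c] /allP flagc.
case: (@arg_minnP _ [` s0c] predT (fun x : c => #|` val x|)) => // s _ smin.
exists (val s); first exact: valP.
apply/allP => t tc; have /allP/(_ t tc)/orP[//|ts] := flagc _ (valP s).
by rewrite (eqP (_ : t == val s)) // eqEfcard ts (smin [` tc]).
Qed.

Fact subdiv_closed W k c c' : c \in subdiv_simps W k ->
  c' `<=` c -> c' != fset0 -> c' \in subdiv_simps W k.
Proof.
rewrite !inE /= !fpowersetE => /andP[cW /andP[flagc minc]] c'c c'0.
have flagc' : is_flag c'.
  rewrite /is_flag c'0 /=; apply/allP => s sc'; apply/allP => t tc'.
  have /andP[_ /allP h] := flagc.
  by have /allP := h s (fsubsetP c'c _ sc'); apply; apply: (fsubsetP c'c).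
rewrite (fsubset_trans c'c cW) flagc' /=.
have [s sc' mins] := flag_min flagc'.
have /hasP[s0 s0c /andP[/allP min0 dim0]] := minc.
apply/hasP; exists s => //; rewrite mins /=.
apply: leq_trans dim0 _; rewrite /sdim -!subn1 leq_sub2r //.
by apply: fsubset_leq_card; apply: min0; apply: (fsubsetP c'c).
Qed.

Definition subdiv W k : scomplex {fset V} :=
  SComplex (@subdiv_neq0 W k) (@subdiv_closed W k).

End Complexes.

Record sdiagram d (P : porderType d) := SDiagram {
  svert : P -> choiceType;
  scplx : forall p, scomplex (svert p);
  smap : forall p q, (p <= q)%O -> svert p -> svert q }.

(* A simplicial map is determined by its values on vertices, so that the
   functor laws are only required there. *)
Record is_sfunctor d (P : porderType d) (G : sdiagram P) : Prop := IsSFunctor {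
  smap_simplicial : forall p q (h : (p <= q)%O) s,
    s \in simps (scplx G p) -> smap h @` s \in simps (scplx G q);
  smap_id : forall p (h : (p <= p)%O) v,
    vertex (scplx G p) v -> smap h v = v;
  smap_comp : forall p q r (h : (p <= q)%O) (h' : (q <= r)%O)
    (h'' : (p <= r)%O) v,
    vertex (scplx G p) v -> smap h'' v = smap h' (smap h v) }.

Record sfunctor d (P : porderType d) := SFunctor {
  sdiag :> sdiagram P;
  sdiagP : is_sfunctor sdiag }.

Section SFunctorSkeleton.
Context d (P : porderType d) (k : nat) (G : sfunctor P).

Definition skeleton_diagram : sdiagram P :=
  SDiagram (fun p => skel k (scplx G p)) (@smap _ _ G).

Fact skeleton_is_sfunctor : is_sfunctor skeleton_diagram.
Proof.
have vtx p v : vertex (skel k (scplx G p)) v -> vertex (scplx G p) v.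
  by rewrite /vertex /= !inE => /andP[].
split=> /= [p q h s|p h v /vtx|p q r h h' h'' v /vtx].
- rewrite !inE /= => /andP[sG sk]; rewrite smap_simplicial //=; last exact: sdiagP.
  apply: leq_trans sk; rewrite /sdim -!subn1 leq_sub2r //.
  exact: leq_imfset_card.
- exact/smap_id/sdiagP.
- exact/smap_comp/sdiagP.
Qed.

Definition skeleton : sfunctor P := SFunctor skeleton_is_sfunctor.

End SFunctorSkeleton.

Record filtration d (P : porderType d) (V : choiceType) := Filtration {
  fcplx :> P -> scomplex V;
  fcplx_mono : forall p q, (p <= q)%O -> simps (fcplx p) `<=` simps (fcplx q) }.

Section Filtrations.
Context d (P : porderType d) (V : choiceType) (F : filtration P V).

Definition filtration_diagram : sdiagram P :=
  SDiagram (svert := fun=> V) F (fun _ _ _ => id).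

Fact filtration_is_sfunctor : is_sfunctor filtration_diagram.
Proof.
split=> //= p q h s sF; rewrite imfset_id.
exact: fsubsetP (fcplx_mono F h) _ sF.
Qed.

Definition filtration_sfunctor : sfunctor P := SFunctor filtration_is_sfunctor.

Definition colim : set {fset V} := [set s | exists p, s \in simps (F p)].

Definition colim_vertices : set V := [set v | colim [fset v]].

Definition SF_cplx (x : posnat^d *p P) : scomplex {fset V} :=
  subdiv (F x.2) ((x.1 : posnat)).

Fact SF_mono (x y : posnat^d *p P) : (x <= y)%O ->
  simps (SF_cplx x) `<=` simps (SF_cplx y).
Proof.
case: x y => [k p] [k' p'] /andP[/= kk' pp'].
have {}kk' : (k' <= k)%N by rewrite leEdual in kk'.
apply/fsubsetP => c; rewrite !inE /= !fpowersetE.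
case/andP=> cF /andP[-> /hasP[s sc /andP[smin sdim]]].
rewrite (fsubset_trans cF (fcplx_mono F pp')) /=.
apply/hasP; exists s => //; rewrite smin /=.
by apply: leq_trans sdim; rewrite -!subn1 leq_sub2r.
Qed.

Definition SF : filtration (posnat^d *p P) {fset V} := Filtration SF_mono.

End Filtrations.

Section MaximalSets.
Context d (T : porderType d) (V : choiceType) (F : filtration T V).

Definition comaximal_sets (k : nat) : set {fset {fset V}} :=
  [set S | [/\ S != fset0, (#|` S| <= k.+1)%N, ([set` S] `<=` colim F)%classic &
    exists t, S `<=` maxsimps (F t)]].

(* This set is finite whenever [colim F] is finite, in particular whenever [F]
   is finitely presented; [fset_set] would send an infinite set to [fset0]. *)
Definition m_num (k : nat) : nat := #|` fset_set (comaximal_sets k)|.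

End MaximalSets.

Section Nerve.
Context d (T : porderType d) (V : choiceType) (F : filtration T V).
Variable lev : rel V.

Fixpoint lexle (s t : seq V) : bool :=
  match s, t with
  | [::], _ => true
  | _, [::] => false
  | x :: s', y :: t' => if x == y then lexle s' t' else lev x y
  end.

Definition simplex_lexle (s t : {fset V}) : bool :=
  lexle (sort lev s) (sort lev t).

Definition lexmin_coface (t : T) (s u : {fset V}) : Prop :=
  [/\ u \in maxsimps (F t), s `<=` u &
    forall w, w \in maxsimps (F t) -> s `<=` w -> simplex_lexle u w].

Definition single_step (t t' : T) : Prop :=
  (t <= t')%O /\ forall r, (t <= r <= t')%O ->
    simps (F r) = simps (F t) \/ simps (F r) = simps (F t').

Definition cover_step (x y : T * {fset V}) : Prop :=
  single_step x.1 y.1 /\ lexmin_coface y.1 x.2 y.2.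

(* The map from the maximal simplices of [F t] to those of [F t'], [t <= t'].
   Sending [s] straight to the lexicographically minimal maximal simplex of
   [F t'] containing [s] is not functorial in general: a simplex of
   [F t'] containing [s] that is smaller than the image of [s] at an
   intermediate index may appear later.  The rule is therefore applied between
   indices [t <= t'] such that [F] takes no value other than [F t] and [F t']
   in between, and extended to all [t <= t'] by composition.  This is the only
   functorial family that follows the rule on such pairs, so that it is the
   family given by the rule on all pairs when that one is functorial. *)
Definition cover_map (t t' : T) (s : {fset V}) : {fset V} :=
  xget s [set u | clos_refl_trans _ cover_step (t, s) (t', u)].

Definition nerve_simps (x : posnat^d *p T) : {fset {fset {fset V}}} :=
  [fset S in fpowerset (maxsimps (F x.2)) | (S != fset0) &&
    `[< exists c, forall s, s \in S ->
          c \in simps (subdiv (closed_simplex s) (x.1 : posnat)) >]].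

Fact nerve_neq0 x S : S \in nerve_simps x -> S != fset0.
Proof. by rewrite !inE => /andP[_ /andP[]]. Qed.

Fact nerve_closed x S S' : S \in nerve_simps x -> S' `<=` S ->
  S' != fset0 -> S' \in nerve_simps x.
Proof.
rewrite !inE /= !fpowersetE => /andP[SF /andP[_ /asboolP[c cS]]] S'S ->.
rewrite (fsubset_trans S'S SF) /=; apply/asboolP; exists c => s sS'.
exact/cS/(fsubsetP S'S).
Qed.

Definition nerve_cplx x : scomplex {fset V} :=
  SComplex (@nerve_neq0 x) (@nerve_closed x).

Definition nerve_diagram : sdiagram (posnat^d *p T) :=
  SDiagram (svert := fun=> {fset V}) nerve_cplx
    (fun x y _ => cover_map x.2 y.2).

End Nerve.

Section Realization.
Variable R : realType.

Section Complex.
Variables (V : choiceType) (W : scomplex V).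

Definition bary_coords : set {ptws V -> R} :=
  [set x | exists2 s, s \in simps W &
    [/\ forall v, 0 <= x v, forall v, v \notin s -> x v = 0 &
        \sum_(v <- s) x v = 1]].

(* As [W] is finite, the product topology induces the usual one. *)
Definition realization : topologicalType := set_type bary_coords.

Definition vertices : {fset V} := \bigcup_(s <- simps W) s.

End Complex.

Section Map.
Variables (V V' : choiceType) (W : scomplex V) (W' : scomplex V').
Variable f : V -> V'.

Definition push_coords (x : {ptws V -> R}) : {ptws V' -> R} :=
  fun w => \sum_(v <- vertices W | f v == w) x v.

Lemma vertexE s v : s \in simps W -> v \in s -> v \in vertices W.
Proof. by move=> sW vs; apply/bigfcupP; exists s; rewrite ?sW. Qed.

Lemma vertices_vertex v : v \in vertices W -> vertex W v.
Proof.
move=> /bigfcupP[s /andP[sW _] vs]; apply: (simps_closed sW).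
  by rewrite fsub1set.
by apply/fset0Pn; exists v; rewrite inE.
Qed.

Lemma sum_support (A s : {fset V}) (Q : pred V) (x : V -> R) :
  s `<=` A -> (forall v, v \notin s -> x v = 0) ->
  \sum_(v <- A | Q v) x v = \sum_(v <- s | Q v) x v.
Proof.
move=> sA x0; rewrite (bigID (fun v => v \in s)) /= [X in _ + X]big1 ?addr0.
  apply: eq_fbig_cond => // v; rewrite !inE /=.
  by case vs: (v \in s); rewrite ?andbF ?andbT //= (fsubsetP sA _ vs).
by move=> v /andP[_ /x0].
Qed.

Lemma simps_vertices s : s \in simps W -> s `<=` vertices W.
Proof. by move=> sW; apply/fsubsetP => v; exact: vertexE. Qed.

Hypothesis simplicial_f : forall s, s \in simps W -> f @` s \in simps W'.

Fact push_coords_realization x :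
  bary_coords W x -> bary_coords W' (push_coords x).
Proof.
case=> s sW [x_ge0 x0 x1]; exists (f @` s); first exact: simplicial_f.
split=> [w|w wfs|].
- by apply: sumr_ge0.
- rewrite /push_coords (sum_support _ (simps_vertices sW) x0).
  rewrite big_seq_cond big1 // => v /andP[vs /eqP fvw].
  by case/negP: wfs; rewrite -fvw in_imfset.
- rewrite -x1; under eq_bigr do
    rewrite /push_coords (sum_support _ (simps_vertices sW) x0).
  by rewrite -partition_big_imfset.
Qed.

Definition push (x : realization W) : realization W' :=
  exist _ (push_coords (set_val x))
    (mem_set (push_coords_realization (set_valP x))).

Fact push_continuous : continuous push.
Proof.
apply: (@continuous_comp_initial _ _ _ set_val push).
have coord w : continuous (fun x : realization W => push_coords (set_val x) w).
  rewrite /push_coords.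
  have := @continuous_big R V +%R 0 (fun v => f v == w) (@add_continuous R)
    (realization W) (vertices W)
    (fun v (x : realization W) => (set_val x : V -> R) v).
  apply=> v _ x.
  apply: (@continuous_comp _ _ _ (set_val : realization W -> {ptws V -> R})
    (fun y : {ptws V -> R} => y v)).
    exact: initial_continuous.
  exact: (@proj_continuous _ (fun _ : V => R : topologicalType) v).
move=> x; apply/cvg_sup; first exact/fmap_filter/nbhs_filter.
move=> w; move: x; apply/(@continuousP _ (initial_topology (@^~ w))).
move=> A [B oB <-]; rewrite -comp_preimage.
by apply: open_comp => // + _; exact: coord.
Qed.

End Map.
End Realization.

Record tfunctor d (P : porderType d) := TFunctor {
  tobj :> P -> topologicalType;
  tmap : forall p q, (p <= q)%O -> tobj p -> tobj q;
  tmap_continuous : forall p q (h : (p <= q)%O), continuous (tmap h);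
  tmap_id : forall p (h : (p <= p)%O) x, tmap h x = x;
  tmap_comp : forall p q r (h : (p <= q)%O) (h' : (q <= r)%O)
    (h'' : (p <= r)%O) x, tmap h'' x = tmap h' (tmap h x) }.

Section WeakEquivalence.
Variable R : realType.

Definition homotopic (X Y : topologicalType) (f g : X -> Y) : Prop :=
  exists H : X * R -> Y,
    [/\ {within [set: X] `*` `[0, 1], continuous H},
        forall x, H (x, 0) = f x & forall x, H (x, 1) = g x].

Definition homotopy_equivalence (X Y : topologicalType) (f : X -> Y) : Prop :=
  continuous f /\ exists g : Y -> X,
    [/\ continuous g, homotopic (g \o f) id & homotopic (f \o g) id].

Context d (P : porderType d).

Definition objectwise_homotopy_equivalence (G G' : tfunctor P) : Prop :=
  exists f : forall p, G p -> G' p,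
    (forall p q (h : (p <= q)%O) x, f q (tmap h x) = tmap h (f p x)) /\
    (forall p, homotopy_equivalence (f p)).

Definition weakly_equivalent : tfunctor P -> tfunctor P -> Prop :=
  clos_refl_sym_trans _ objectwise_homotopy_equivalence.

Section RealizationFunctor.
Variable G : sfunctor P.

Definition realization_map p q (h : (p <= q)%O) :
    realization R (scplx G p) -> realization R (scplx G q) :=
  push (@smap_simplicial _ _ _ (sdiagP G) p q h).

Lemma realization_out (V : choiceType) (W : scomplex V)
  (x : realization R W) v : v \notin vertices W -> (set_val x : V -> R) v = 0.
Proof.
have [s sW [_ x0 _]] := set_valP x => vW; apply: x0.
by apply: contra vW; exact: vertexE.
Qed.

Lemma realization_ext (V : choiceType) (W : scomplex V)
  (x y : realization R W) :
  (forall v, (set_val x : V -> R) v = (set_val y : V -> R) v) -> x = y.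
Proof. by move=> xy; apply/val_inj/funext. Qed.

Lemma realization_mapE p q (h : (p <= q)%O) x w :
  (set_val (realization_map h x) : svert G q -> R) w =
  \sum_(v <- vertices (scplx G p) | smap h v == w)
     (set_val x : svert G p -> R) v.
Proof. by []. Qed.

Fact realization_map_id p (h : (p <= p)%O) x : realization_map h x = x.
Proof.
apply: realization_ext => w; rewrite realization_mapE.
transitivity (\sum_(v <- vertices (scplx G p) | v == w)
    (set_val x : svert G p -> R) v).
  rewrite [LHS]big_seq_cond [RHS]big_seq_cond; apply: eq_bigl => v /=.
  apply: andb_id2l => vW; by rewrite (smap_id (sdiagP G)) // vertices_vertex.
case wW: (w \in vertices (scplx G p)).
  by rewrite -big_filter filter_pred1_uniq // big_seq1.
rewrite realization_out ?wW // big_seq_cond big1 // => v /andP[vW /eqP vw].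
by rewrite -vw vW in wW.
Qed.

Fact realization_map_comp p q r (h : (p <= q)%O) (h' : (q <= r)%O)
  (h'' : (p <= r)%O) x :
  realization_map h'' x = realization_map h' (realization_map h x).
Proof.
apply: realization_ext => w; rewrite !realization_mapE.
have sum1 (A : {fset svert G q}) (Q : pred (svert G q)) u (c : R) : u \in A ->
    \sum_(v <- A | Q v) (if u == v then c else 0) = if Q u then c else 0.
  move=> uA; rewrite big_mkcond (big_fsetD1 _ uA) /= eqxx big1_fset ?addr0 //.
  by move=> v; rewrite !inE eq_sym => /andP[/negbTE-> _]; case: ifP.
under [RHS]eq_bigr do rewrite realization_mapE big_mkcond.
rewrite exchange_big /= [LHS]big_mkcond [LHS]big_seq [RHS]big_seq.
apply: eq_bigr => v vX; have vG := vertices_vertex vX.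
rewrite sum1; first by rewrite (smap_comp (sdiagP G) h h').
apply: (@vertexE _ _ (smap h @` [fset v])); first exact: (smap_simplicial (sdiagP G)).
by rewrite in_imfset // inE.
Qed.

Definition realization_functor : tfunctor P :=
  TFunctor (fun p q h => @push_continuous R _ _ _ _ _
    (@smap_simplicial _ _ _ (sdiagP G) p q h))
    realization_map_id realization_map_comp.

End RealizationFunctor.

Definition simplicial_model (N : sfunctor P) (G : tfunctor P) : Prop :=
  weakly_equivalent (realization_functor N) G.

End WeakEquivalence.

Record pmodule (K : fieldType) d (P : porderType d) := PModule {
  pobj :> P -> lmodType K;
  pmod_map : forall p q, (p <= q)%O -> {linear pobj p -> pobj q};
  pmod_map_id : forall p (h : (p <= p)%O) x, pmod_map h x = x;
  pmod_map_comp : forall p q r (h : (p <= q)%O) (h' : (q <= r)%O)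
    (h'' : (p <= r)%O) x, pmod_map h'' x = pmod_map h' (pmod_map h x) }.

Section PersistenceModules.
Local Open Scope classical_set_scope.
Context (K : fieldType) d (P : porderType d).
Implicit Types M N : pmodule K P.

Record pmorphism M N := PMorphism {
  pfun :> forall p, {linear M p -> N p};
  pfun_natural : forall p q (h : (p <= q)%O) x,
    pfun q (pmod_map M h x) = pmod_map N h (pfun p x) }.

Definition piso M N : Prop :=
  exists f : pmorphism M N, forall p, bijective (f p).

Definition pexact M N L (f : pmorphism M N) (g : pmorphism N L) : Prop :=
  forall p y, g p y = 0 <-> exists x, f p x = y.

Definition pepi M N (f : pmorphism M N) : Prop :=
  forall p y, exists x, f p x = y.

Definition is_submodule M (N : forall p, set (M p)) : Prop :=
  (forall p, N p 0 /\ forall a x y, N p x -> N p y -> N p (a *: x + y)) /\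
  (forall p q (h : (p <= q)%O) x, N p x -> N q (pmod_map M h x)).

Definition generates M (S : set {p : P & M p}) : Prop :=
  forall N : forall p, set (M p), is_submodule N ->
    (forall p x, S (existT _ p x) -> N p x) -> forall p x, N p x.

Definition minimal_generating_set M (S : set {p : P & M p}) : Prop :=
  generates S /\ forall S', S' `<=` S -> generates S' -> S' = S.

Definition finitely_generated M : Prop :=
  exists2 S : set {p : P & M p}, finite_set S & generates S.

Section Free.
Variables (I : choiceType) (g : I -> P).

Definition free_pred (p : P) : {pred I -> K^o} :=
  fun c => `[< finite_set [set i | c i != 0] /\
               forall i, c i != 0 -> (g i <= p)%O >].

Fact free_submod p : submod_closed (free_pred p).
Proof.
split=> [|a c e /asboolP[cfin cp] /asboolP[efin ep]]; apply/asboolP; split.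
- rewrite (_ : [set _ | _] = set0) //; apply/seteqP; split=> i //=.
  by rewrite eqxx.
- by move=> i; rewrite eqxx.
- apply: (@sub_finite_set _ _ ([set i | c i != 0] `|` [set i | e i != 0])).
    move=> i /=; apply: contraPP => /not_orP[/negP/negPn/eqP ci /negP/negPn/eqP ei].
    by apply/negP/negPn; rewrite !fctE ci ei scaler0 addr0.
  by rewrite finite_setU.
- move=> i; have [ci|/cp//] := eqVneq (c i) 0.
  have [ei|/ep//] := eqVneq (e i) 0.
  by rewrite !fctE ci ei scaler0 addr0 eqxx.
Qed.

HB.instance Definition _ p :=
  GRing.isSubmodClosed.Build K (I -> K^o) (free_pred p) (free_submod p).

Record free_obj (p : P) := FreeObj {
  free_val : I -> K^o;
  free_valP : free_val \in free_pred p }.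

HB.instance Definition _ p := [isSub for @free_val p].
HB.instance Definition _ p := [Choice of free_obj p by <:].
HB.instance Definition _ p := [SubChoice_isSubLmodule of free_obj p by <:].

Fact free_map_subproof p q (h : (p <= q)%O) (c : free_obj p) :
  free_val c \in free_pred q.
Proof.
have /asboolP[cfin cp] := free_valP c; apply/asboolP; split=> // i /cp gp.
exact: le_trans gp h.
Qed.

Definition free_map p q (h : (p <= q)%O) (c : free_obj p) : free_obj q :=
  FreeObj (free_map_subproof h c).

Fact free_map_linear p q (h : (p <= q)%O) : linear (free_map h).
Proof. by move=> a x y; apply: val_inj. Qed.

HB.instance Definition _ p q (h : (p <= q)%O) :=
  GRing.isLinear.Build K (free_obj p) (free_obj q) _ (free_map h)
    (free_map_linear h).

(* The direct sum of the modules K^<g i>, i in I: its value at [p] consists of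
   the finitely supported families of scalars indexed by the [i] such that
   [g i <= p]. *)
Definition free_pmodule : pmodule K P.
Proof.
refine (@PModule K d P free_obj (fun p q h => free_map h) _ _).
- by move=> p h x; apply: val_inj.
- by move=> p q r h h' h'' x; apply: val_inj.
Defined.

End Free.
End PersistenceModules.

Section Presentations.
Local Open Scope classical_set_scope.
Context (K : fieldType) d (P : porderType d).
Implicit Types M N : pmodule K P.

Definition is_free M : Prop :=
  exists (I : choiceType) (g : I -> P), piso M (free_pmodule K g).

(* [e] exhibits [M] as a cokernel of [f]. *)
Definition finitely_presented_module M : Prop :=
  exists (F0 F1 : pmodule K P) (f : pmorphism F1 F0) (e : pmorphism F0 M),
    [/\ is_free F0 /\ finitely_generated F0,
        is_free F1 /\ finitely_generated F1,
        pexact f e & pepi e].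

Record pcomplex := PComplex {
  cmod :> nat -> pmodule K P;
  cdiff : forall i, pmorphism (cmod i.+1) (cmod i);
  cdiffK : forall i p x, cdiff i p (cdiff i.+1 p x) = 0 }.

Definition complex_iso (C D : pcomplex) : Prop :=
  exists f : forall i, pmorphism (C i) (D i),
    (forall i p, bijective (f i p)) /\
    (forall i p x, f i p (cdiff C i p x) = cdiff D i p (f i.+1 p x)).

Definition free_resolution M (C : pcomplex) : Prop :=
  [/\ forall i, is_free (C i),
      forall i, pexact (cdiff C i.+1) (cdiff C i) &
      exists e : pmorphism (C 0) M, pexact (cdiff C 0) e /\ pepi e].

Section DirectSum.

Section Modules.
Variables M N : pmodule K P.

Definition sum_map p q (h : (p <= q)%O) (x : (M p * N p)%type) : (M q * N q)%type :=
  (pmod_map M h x.1, pmod_map N h x.2).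

Fact sum_map_linear p q (h : (p <= q)%O) : linear (sum_map h).
Proof. by move=> a x y; rewrite /sum_map /= !linearP. Qed.

HB.instance Definition _ p q (h : (p <= q)%O) :=
  GRing.isLinear.Build K (M p * N p)%type (M q * N q)%type _ (sum_map h)
    (sum_map_linear h).

Definition sum_pmodule : pmodule K P.
Proof.
refine (@PModule K d P (fun p => (M p * N p)%type)
  (fun p q h => sum_map h) _ _).
- by move=> p h [x y]; rewrite /= /sum_map !pmod_map_id.
- by move=> p q r h h' h'' [x y]; rewrite /= /sum_map !(pmod_map_comp h h').
Defined.

End Modules.

Section Morphisms.
Variables (M M' N N' : pmodule K P).
Variables (f : pmorphism M M') (g : pmorphism N N').

Definition sum_fun p (x : (M p * N p)%type) : (M' p * N' p)%type := (f p x.1, g p x.2).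

Fact sum_fun_linear p : linear (@sum_fun p).
Proof. by move=> a x y; rewrite /sum_fun /= !linearP. Qed.

HB.instance Definition _ p :=
  GRing.isLinear.Build K (M p * N p)%type (M' p * N' p)%type _ (@sum_fun p)
    (@sum_fun_linear p).

Definition sum_pmorphism : pmorphism (sum_pmodule M N) (sum_pmodule M' N').
Proof.
refine (@PMorphism K d P (sum_pmodule M N) (sum_pmodule M' N')
  (fun p => @sum_fun p) _).
by move=> p q h [x y]; rewrite /= /sum_fun /sum_map !pfun_natural.
Defined.

End Morphisms.

Variables C D : pcomplex.

Definition sum_complex : pcomplex.
Proof.
refine (@PComplex (fun i => sum_pmodule (C i) (D i))
  (fun i => sum_pmorphism (cdiff C i) (cdiff D i)) _).
by move=> i p [x y]; rewrite /= /sum_fun /= !cdiffK.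
Defined.

End DirectSum.

Definition minimal_free_resolution M (C : pcomplex) : Prop :=
  free_resolution M C /\
  forall C', free_resolution M C' -> exists D, complex_iso C' (sum_complex C D).

Definition betti M (i n : nat) : Prop :=
  exists C : pcomplex, minimal_free_resolution M C /\
    exists S : set {p : P & C i p}, minimal_generating_set S /\ (S #= `I_n)%card.

End Presentations.

Section Chains.
Variable K : fieldType.

(* The coefficient of the simplex [t] in the image under [f] of the simplex
   [s], where every simplex is oriented by the enumeration of its vertices.
   The matrix has a zero column if [f @` s != t] and two equal rows if [f]
   identifies two vertices of [s]; otherwise it is the permutation matrix that
   compares the two orientations of [t]. *)
Definition incidence (V V' : choiceType) (f : V -> V') (j : nat)
    (s : {fset V}) (t : {fset V'}) : K :=
  \det (\matrix_(a < j.+1, b < j.+1)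
          (onth (map f (enum_fset s)) a == onth (enum_fset t) b)%:R).

Definition dim_simps (V : choiceType) (W : scomplex V) (j : nat) :=
  [fset s in simps W | #|` s| == j.+1].

Definition chains (V : choiceType) (W : scomplex V) (j : nat) : lmodType K :=
  {ffun dim_simps W j -> K^o}.

Section ChainMap.
Variables (V V' : choiceType) (W : scomplex V) (W' : scomplex V').
Variables (f : V -> V') (j : nat).

Definition chain_map (c : chains W j) : chains W' j :=
  [ffun t => \sum_s c s * incidence f j (val s) (val t)].

Fact chain_map_linear : linear chain_map.
Proof.
move=> a x y; apply/ffunP => t; rewrite !ffunE scaler_sumr -big_split /=.
apply: eq_bigr => s _; rewrite !ffunE mulrDl; congr (_ + _).
by rewrite /GRing.scale /= mulrA.
Qed.

HB.instance Definition _ :=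
  GRing.isLinear.Build K (chains W j) (chains W' j) _ chain_map chain_map_linear.

End ChainMap.

Lemma incidence0 (V V' : choiceType) (f : V -> V') (j : nat)
    (s : {fset V}) (t : {fset V'}) :
  #|` s| = j.+1 -> #|` t| = j.+1 -> f @` s != t -> incidence f j s t = 0.
Proof.
move=> sj tj fst.
have /fsubsetPn[w wt wfs] : ~~ (t `<=` f @` s).
  apply: contra fst => tfs; rewrite eq_sym eqEfcard tfs tj -sj.
  exact: leq_imfset_card.
have bj : (index w t < j.+1)%N by rewrite -tj index_mem.
rewrite /incidence (expand_det_col _ (Ordinal bj)) big1 // => a _.
rewrite mxE /= [onth t _](_ : _ = Some w); last first.
  by rewrite onthE (nth_map w) ?index_mem // nth_index.
case: eqP => [E|]; last by rewrite mul0r.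
case/negP: wfs; have aj : (a < size (enum_fset s))%N by rewrite sj.
move: E; rewrite onthE; have [v0 v0s] : exists v, v \in s.
  by apply/fset0Pn; rewrite -cardfs_gt0 sj.
rewrite (nth_map w) ?size_map // (nth_map v0) // => -[<-].
by rewrite in_imfset //=; apply: mem_nth.
Qed.

Lemma incidence_comp (V V' V'' : choiceType) (f : V -> V') (g : V' -> V'')
    (h : V -> V'') (j : nat) (s : {fset V}) (u : {fset V''}) :
  #|` s| = j.+1 -> #|` (f @` s)| = j.+1 ->
  (forall v, v \in s -> h v = g (f v)) ->
  incidence h j s u = incidence f j s (f @` s) * incidence g j (f @` s) u.
Proof.
move=> sj fsj hgf; rewrite -det_mulmx; congr (\det _).
apply/matrixP => a b; rewrite !mxE.
have aj : (a < size (enum_fset s))%N by rewrite sj.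
have [v0 v0s] : exists v, v \in s by apply/fset0Pn; rewrite -cardfs_gt0 sj.
have vs : nth v0 s a \in s by apply: mem_nth.
have ffs : f (nth v0 s a) \in f @` s by rewrite in_imfset.
have mj : (index (f (nth v0 s a)) (f @` s) < j.+1)%N.
  by move: ffs; rewrite -index_mem fsj.
have onthm (A B : choiceType) (k : A -> B) (r : seq A) x0 (i : nat) :
    (i < size r)%N -> onth (map k r) i = Some (k (nth x0 r i)).
  by move=> ir; rewrite onthE (nth_map (k x0)) ?size_map // (nth_map x0).
have onths (A : choiceType) (r : seq A) x0 (i : nat) :
    (i < size r)%N -> onth r i = Some (nth x0 r i).
  by move=> ir; rewrite onthE (nth_map x0).
rewrite (bigD1 (Ordinal mj)) //= !mxE /= big1 ?addr0 => [|m mi].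
  rewrite !(onthm _ _ _ _ v0) // (onthm _ _ _ _ (f v0)) ?index_mem //.
  rewrite (onths _ _ (f v0)) ?index_mem // nth_index // eqxx mul1r.
  by rewrite hgf.
rewrite !mxE (onthm _ _ _ _ v0) // (onths _ _ (f v0)); last by rewrite fsj.
case: eqP => [[E]|]; last by rewrite mul0r.
case/eqP: mi; apply/val_inj => /=; rewrite E index_uniq ?fset_uniq //.
by rewrite fsj.
Qed.

Lemma incidence_id (V : choiceType) (f : V -> V) (j : nat) (s t : {fset V}) :
  #|` s| = j.+1 -> #|` t| = j.+1 -> (forall v, v \in s -> f v = v) ->
  incidence f j s t = (s == t)%:R.
Proof.
move=> sj tj fid; have fs : f @` s = s.
  by rewrite -[RHS]imfset_id; apply: eq_in_imfset.
case: (eqVneq s t) => [<-|st]; last by rewrite incidence0 // fs.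
rewrite /incidence (_ : \matrix_(_, _) _ = 1%:M) ?det1 //.
apply/matrixP => a b; rewrite !mxE.
have [v0 v0s] : exists v, v \in s by apply/fset0Pn; rewrite -cardfs_gt0 sj.
rewrite !onthE -map_comp !(nth_map v0) ?sj //=.
rewrite fid; last by apply: mem_nth; rewrite sj.
by rewrite (inj_eq Some_inj) nth_uniq ?fset_uniq ?sj.
Qed.

Section ChainModule.
Context d (P : porderType d) (G : sfunctor P) (j : nat).

Lemma dim_simpsP (V : choiceType) (W : scomplex V) (s : dim_simps W j) :
  (val s \in simps W) /\ #|` val s| = j.+1.
Proof. by have := valP s; rewrite !inE => /andP[? /eqP]. Qed.

Lemma simplex_vertex (V : choiceType) (W : scomplex V) s v :
  s \in simps W -> v \in s -> vertex W v.
Proof. by move=> sW vs; apply: vertices_vertex; exact: vertexE vs. Qed.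

Definition chain_module : pmodule K P.
Proof.
refine (@PModule K d P (fun p => chains (scplx G p) j)
  (fun p q h => @chain_map _ _ (scplx G p) (scplx G q) (smap h) j)
  _ _).
- move=> p h c; apply/ffunP => t; rewrite ffunE (bigD1 t) //= big1 ?addr0.
    have [tG tj] := dim_simpsP t.
    rewrite incidence_id // ?eqxx ?mulr1 // => v vt.
    by apply: (smap_id (sdiagP G)); exact: simplex_vertex vt.
  move=> s st; have [sG sj] := dim_simpsP s; have [tG tj] := dim_simpsP t.
  rewrite incidence_id // ?(inj_eq val_inj) ?(negbTE st) ?mulr0 // => v vs.
  by apply: (smap_id (sdiagP G)); exact: simplex_vertex vs.
- move=> p q r h h' h'' c; apply/ffunP => u; rewrite !ffunE.
  under [RHS]eq_bigr do rewrite ffunE mulr_suml.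
  rewrite exchange_big /=; apply: eq_bigr => s _.
  have [sG sj] := dim_simpsP s; have [uG uj] := dim_simpsP u.
  have hgf v : v \in val s -> smap h'' v = smap h' (smap h v).
    by move=> vs; apply: (smap_comp (sdiagP G)); exact: simplex_vertex vs.
  under eq_bigr do rewrite -mulrA; rewrite -mulr_sumr; congr (_ * _).
  have [fsj|fsj] := eqVneq (#|` smap h @` val s|) j.+1.
    have tG : smap h @` val s \in dim_simps (scplx G q) j.
      by rewrite !inE /= fsj eqxx andbT; exact: (smap_simplicial (sdiagP G)).
    rewrite (bigD1 [` tG]) //= big1 ?addr0; first exact: incidence_comp.
    move=> t tfs; have [_ tj] := dim_simpsP t.
    rewrite [X in X * _]incidence0 ?mul0r //.
    by apply: contra tfs => /eqP E; apply/eqP/val_inj; rewrite /= E.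
  rewrite big1 => [|t _]; last first.
    have [_ tj] := dim_simpsP t; rewrite [X in X * _]incidence0 ?mul0r //.
    by apply: contra fsj => /eqP ->; rewrite tj.
  rewrite incidence0 //; apply: contra fsj => /eqP E.
  have <- : #|` smap h'' @` val s| = j.+1 by rewrite E.
  rewrite eqn_leq; apply/andP; split.
    rewrite E uj -sj; exact: leq_imfset_card.
  have -> : smap h'' @` val s = smap h' @` (smap h @` val s).
    by rewrite -imfset_comp; apply: eq_in_imfset.
  exact: leq_imfset_card.
Defined.

End ChainModule.

Section Size.
Context d (P : porderType d).
Implicit Type G : sfunctor P.

Definition finitely_presented G : Prop :=
  forall j, finitely_presented_module (chain_module G j).

(* [b j] is the number of generators [beta_0 (C_j G)]; the sum of these numbers
   over all [j] is finite exactly if they vanish from some [m] on. *)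
Definition has_size G (n : nat) : Prop :=
  finitely_presented G /\
  exists (b1 : nat) (b : nat -> nat) (m : nat),
    [/\ betti (chain_module G 0) 1 b1,
        forall j, betti (chain_module G j) 0 (b j),
        forall j, (m <= j)%N -> b j = 0%N &
        n = (b1 + \sum_(j < m) b j)%N].

End Size.
End Chains.

(* Main.v *)
From Stdlib Require Import Relation_Operators.
Require Import Defs.
From HB Require Import structures.
From mathcomp Require Import all_boot all_order all_algebra finmap.
From mathcomp Require Import wochoice all_classical all_reals topology normedtype.
From mathcomp Require Import lra.

Set Implicit Arguments.
Unset Strict Implicit.
Unset Printing Implicit Defensive.
Import Order.TTheory GRing.Theory Num.Theory.
Import numFieldNormedType.Exports.

(** ** Why the theorem holds

    A finitely presented filtration [F] has finitely many simplices, and every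
    simplex is born at one of finitely many critical grades
    ([critical_grades]). Hence each set [S] of maximal simplices of some [F t]
    is a set of maximal simplices exactly on an interval of indices: it is born
    with the last of its members and dies when one of them ceases to be
    maximal, for a simplex that is contained in a larger one remains so
    ([comax_alive]).

    The nerve as a model ([nerve_model]). At the index [p] the subdivision is
    the order complex of the faces of size at least [k], and a finite set [S]
    of maximal simplices is a simplex of the nerve exactly if the common face
    of its members has size at least [k]. Let [B] be the space of pairs [(x, y)]
    of a point [x] of the subdivision and a point [y] of the nerve such that
    some member of the flag supporting [x] lies in all the simplices supporting
    [y]. As the cover maps send a simplex to a larger one, [B] is functorial,
    and both projections are natural. The first projection has a section [b],
    which sends a face to its maximal cofaces, and its fibers are simplices
    ([link_fst_equivalence]). The second one has a section [r], which spreads a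
    point of the nerve over a barycentric flag of its support and sends each
    set in it to its common face. In the fiber over [y] a point [x] is moved to
    [r y] in three stages: each member [u] of its flag is pushed to its hull,
    the intersection of the maximal cofaces of [u]; these hulls also support
    [r (b x)]; and [r] maps the segment from [b x] to [y] into the fiber
    ([link_snd_equivalence]).

    The size of the nerve ([nerve_skeleton_size]). The [j]-chains of the nerve
    have a generator for each set of [j + 1] comaximal simplices with a common
    face, in its grade of birth, and a relation in its grade of death that
    equates it to its image under the cover map, up to sign, or to zero. An
    image is born later, so that the matrix of the relations is unitriangular,
    and generators and relations form a free resolution of length one
    ([comax_presentation]). Cancelling unit entries makes it minimal
    ([pres_reduce], [pres_complex_minimal]) and does not increase ranks. Thus
    the generators of all degrees number at most [m_k], and so do the relations
    among the vertices, whence the constant 2.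

    The lower bound ([model_size_lower_bound]). A simplex [s] that is maximal in
    some [F t] is maximal when it is born, and then it is an isolated point of
    the subdivision at the level [#|s|]. That point is reached from no smaller
    grade, neither from an earlier index nor from a higher level. So each such
    [s] contributes a generator to the persistent [pi_0] of the subdivision.
    Clopen sets record this in a form that is invariant under homotopy
    equivalences ([separated_weakly_equivalent]), and in any model the linear
    functionals that count the vertices in these clopen sets show that the
    module of vertices needs at least one generator for each [s]
    ([generators_lower_bound]). *)

(** * Persistence modules and free modules *)

Lemma mem_setb (T : Type) (b : pred T) x : (x \in [set y | b y]%classic) = b x.
Proof. by apply/idP/idP => [/set_mem|/mem_set]. Qed.

Section Modules.
Local Open Scope ring_scope.
Context (K : fieldType) d (P : porderType d).
Implicit Types M N L : pmodule K P.

(** The structure maps as total functions of the grades, zero between grades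
    that are not comparable in the right direction, so that sums over
    generators need not carry proofs of comparability. *)
Definition pact M (q p : P) : M q -> M p :=
  match boolP (q <= p)%O with
  | AltTrue h => pmod_map M h
  | AltFalse _ => fun=> 0
  end.

Lemma pactE M q p (h : (q <= p)%O) x : pact p x = pmod_map M h x.
Proof.
rewrite /pact; case: {-}_ / boolP => [h'|]; last by rewrite h.
by rewrite (bool_irrelevance h h').
Qed.

Lemma pact_out M q p (x : M q) : ~~ (q <= p)%O -> pact p x = 0.
Proof.
by move=> h; rewrite /pact; case: {-}_ / boolP => [h'|//]; rewrite h' in h.
Qed.

Fact pact_is_linear M q p : linear (@pact M q p).
Proof.
move=> a x y; case qp : (q <= p)%O; first by rewrite !(pactE qp) linearP.
by rewrite !pact_out ?qp // scaler0 addr0.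
Qed.

HB.instance Definition _ M q p :=
  GRing.isLinear.Build K (M q) (M p) _ (@pact M q p) (@pact_is_linear M q p).

Lemma pact_id M p (x : M p) : pact p x = x.
Proof. by rewrite (pactE (lexx p)) pmod_map_id. Qed.

Lemma pact_comp M q p r (x : M q) : (q <= p)%O -> (p <= r)%O ->
  pact r (pact p x) = pact r x.
Proof.
move=> qp pr; rewrite (pactE qp) (pactE pr) (pactE (le_trans qp pr)).
by rewrite (pmod_map_comp qp pr).
Qed.

Lemma pfun_pact M N (f : pmorphism M N) q p (x : M q) :
  f p (pact p x) = pact p (f q x).
Proof.
case qp : (q <= p)%O; first by rewrite !(pactE qp) pfun_natural.
by rewrite !pact_out ?qp // linear0.
Qed.

Definition pzero M N : pmorphism M N.
Proof.
refine (@PMorphism K d P M N (fun p => \0%R) _).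
by move=> p q h x; rewrite /= linear0.
Defined.

Definition pid M : pmorphism M M.
Proof. by refine (@PMorphism K d P M M (fun p => idfun) _). Defined.

Definition pcomp M N L (f : pmorphism N L) (g : pmorphism M N) : pmorphism M L.
Proof.
refine (@PMorphism K d P M L (fun p => f p \o g p) _).
by move=> p q h x; rewrite /= !pfun_natural.
Defined.

(** The lift is unique, so that choosing preimages pointwise gives a linear
    and natural map. *)
Lemma plift_mono M N L (i : pmorphism N L) (h : pmorphism M L) :
  (forall p, injective (i p)) -> (forall p x, exists y, i p y = h p x) ->
  exists l : pmorphism M N, forall p x, i p (l p x) = h p x.
Proof.
move=> inj ex; pose l' p (x : M p) : N p := projT1 (cid (ex p x)).
have l'P p x : i p (l' p x) = h p x by rewrite /l'; case: cid.
have lin p : linear (l' p).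
  by move=> a x y; apply: (inj p); rewrite linearP !l'P linearP.
pose lL p : {linear M p -> N p} :=
  HB.pack (l' p) (GRing.isLinear.Build K (M p) (N p) _ (l' p) (lin p)).
have nat p q (hpq : (p <= q)%O) x :
    lL q (pmod_map M hpq x) = pmod_map N hpq (lL p x).
  by apply: (inj q); rewrite (pfun_natural i) /= !l'P pfun_natural.
by exists (PMorphism nat) => p x; exact: l'P.
Qed.

Section FreeModule.
Variables (I : choiceType) (g : I -> P).
Local Notation F := (free_pmodule K g).

Definition fcoef p (c : F p) (i : I) : K := free_val c i.

Arguments fcoef : simpl never.

Lemma fcoef_ext p (c e : F p) : (forall i, fcoef c i = fcoef e i) -> c = e.
Proof. by move=> ce; apply: val_inj; apply/funext. Qed.

Lemma fcoef_linear p a (c e : F p) i :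
  fcoef (a *: c + e) i = a * fcoef c i + fcoef e i.
Proof. by []. Qed.

Lemma fcoefZ p a (c : F p) i : fcoef (a *: c) i = a * fcoef c i.
Proof. by []. Qed.

Lemma fcoef_sum p (J : Type) (r : seq J) (Q : pred J) (c : J -> F p) i :
  fcoef (\sum_(j <- r | Q j) c j) i = \sum_(j <- r | Q j) fcoef (c j) i.
Proof. by elim/big_rec2: _ => // j x y _ <-. Qed.

Lemma fcoef_le p (c : F p) i : fcoef c i != 0 -> (g i <= p)%O.
Proof. by have /asboolP[_] := free_valP c; exact. Qed.

Lemma fcoef_finite p (c : F p) : finite_set [set i | fcoef c i != 0]%classic.
Proof. by have /asboolP[] := free_valP c. Qed.

Lemma fcoef_pact q p (c : F q) i : (q <= p)%O -> fcoef (pact p c) i = fcoef c i.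
Proof. by move=> qp; rewrite (pactE qp). Qed.

Fact fbasis_subproof i : (fun i' => (i' == i)%:R) \in @free_pred K _ _ _ g (g i).
Proof.
apply/asboolP; split=> [|i']; last by have [->//|] := eqVneq i' i; rewrite eqxx.
apply: (@sub_finite_set _ _ [set i]%classic) => //= i' /=.
by have [->//|] := eqVneq i' i; rewrite eqxx.
Qed.

Definition fbasis i : F (g i) := FreeObj (fbasis_subproof i).

Arguments fbasis : simpl never.

Lemma fcoef_basis i i' : fcoef (fbasis i) i' = (i' == i)%:R.
Proof. by []. Qed.

Section Extension.
Variables (N : pmodule K P) (y : forall i, N (g i)).

(** The sum ranges over the support of [c], which makes sense for infinitely
    many generators. *)
Definition fext_fun p (c : F p) : N p :=
  \sum_(i <- fset_set [set i | fcoef c i != 0]%classic) fcoef c i *: pact p (y i).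

Lemma fext_seq p (c : F p) (r : seq I) : uniq r ->
  (forall i, fcoef c i != 0 -> i \in r) ->
  fext_fun c = \sum_(i <- r) fcoef c i *: pact p (y i).
Proof.
move=> ur cr; rewrite [RHS](bigID (fun i => fcoef c i != 0)) /=.
rewrite [X in _ = _ + X]big1 ?addr0 => [|i /negPn/eqP ->]; last by rewrite scale0r.
rewrite -big_filter; apply: perm_big; apply: uniq_perm.
- exact: fset_uniq.
- exact: filter_uniq.
move=> i; rewrite mem_filter in_fset_set; last exact: fcoef_finite.
by rewrite mem_setb; case: (boolP (fcoef c i != 0)) => //= h; rewrite cr.
Qed.

Fact fext_linear p : linear (@fext_fun p).
Proof.
move=> a c e.
pose A := fset_set ([set i | fcoef c i != 0] `|` [set i | fcoef e i != 0])%classic.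
have finA : finite_set ([set i | fcoef c i != 0] `|` [set i | fcoef e i != 0])%classic.
  by rewrite finite_setU; split; exact: fcoef_finite.
rewrite !(@fext_seq _ _ A) ?fset_uniq //.
- rewrite scaler_sumr -big_split; apply: eq_bigr => i _.
  by rewrite fcoef_linear scalerDl scalerA.
- by move=> i h; rewrite in_fset_set //; apply/mem_set; right.
- by move=> i h; rewrite in_fset_set //; apply/mem_set; left.
- move=> i; rewrite fcoef_linear in_fset_set // => h; apply/mem_set; move: h => /=.
  have [->|] := eqVneq (fcoef c i) 0; last by left.
  by rewrite mulr0 add0r; right.
Qed.

HB.instance Definition _ p :=
  GRing.isLinear.Build K (F p) (N p) _ (@fext_fun p) (@fext_linear p).

Fact fext_natural p q (h : (p <= q)%O) (c : F p) :
  fext_fun (pmod_map F h c) = pmod_map N h (fext_fun c).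
Proof.
rewrite (@fext_seq q _ (fset_set [set i | fcoef c i != 0]%classic)) ?fset_uniq //.
  rewrite linear_sum; apply: eq_big_seq => i.
  rewrite in_fset_set ?mem_setb; last exact: fcoef_finite.
  move=> /fcoef_le gp.
  by rewrite -!(pactE h) fcoef_pact // linearZ /= pact_comp.
by move=> i ci; rewrite in_fset_set ?mem_setb //; exact: fcoef_finite.
Qed.

Definition fext : pmorphism F N :=
  @PMorphism K d P F N (fun p => @fext_fun p) fext_natural.

Arguments fext : simpl never.

Lemma fextE p (c : F p) (r : seq I) : uniq r ->
  (forall i, fcoef c i != 0 -> i \in r) ->
  fext p c = \sum_(i <- r) fcoef c i *: pact p (y i).
Proof. exact: fext_seq. Qed.

Lemma fext_basis i : fext (g i) (fbasis i) = y i.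
Proof.
rewrite (@fextE _ _ [:: i]) //=; first by rewrite big_seq1 fcoef_basis eqxx scale1r pact_id.
by move=> i'; rewrite fcoef_basis inE; have [//|_] := eqVneq i' i; rewrite eqxx.
Qed.

End Extension.

Lemma fbasis_sum p (c : F p) (r : seq I) : uniq r ->
  (forall i, fcoef c i != 0 -> i \in r) ->
  c = \sum_(i <- r) fcoef c i *: pact p (fbasis i).
Proof.
move=> ur cr; apply: fcoef_ext => i; rewrite fcoef_sum.
transitivity (\sum_(i' <- r) if i' == i then fcoef c i else 0); last first.
  apply: eq_bigr => i' _; rewrite fcoefZ.
  have [->|] := eqVneq i' i.
    have [->|ci] := eqVneq (fcoef c i) 0; first by rewrite mul0r.
    by rewrite fcoef_pact ?(fcoef_le ci) // fcoef_basis eqxx mulr1.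
  move=> ii'; have [->|ci] := eqVneq (fcoef c i') 0; first by rewrite mul0r.
  rewrite fcoef_pact ?(fcoef_le ci) // fcoef_basis eq_sym (negbTE ii') mulr0 //.
rewrite -big_mkcond -big_filter; have [ci|ci] := eqVneq (fcoef c i) 0.
  by rewrite ci big1.
rewrite (_ : [seq i' <- r | i' == i] = [:: i]) ?big_seq1 //.
by apply: (filter_pred1_uniq ur); exact: cr.
Qed.

Lemma fbasis_ext N (f f' : pmorphism F N) :
  (forall i, f (g i) (fbasis i) = f' (g i) (fbasis i)) -> forall p x, f p x = f' p x.
Proof.
move=> ff' p x; rewrite (@fbasis_sum _ x (fset_set [set i | fcoef x i != 0]%classic)).
- rewrite !linear_sum; apply: eq_bigr => i _.
  by rewrite !linearZ /= !pfun_pact ff'.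
- exact: fset_uniq.
- by move=> i xi; rewrite in_fset_set ?mem_setb //; exact: fcoef_finite.
Qed.

End FreeModule.

(** Free modules are projective: images of the basis elements can be chosen
    freely. *)
Lemma plift_free M N L (q : pmorphism M L) (h : pmorphism N L) :
  is_free N -> (forall p x, exists y, q p y = h p x) ->
  exists l : pmorphism N M, forall p x, q p (l p x) = h p x.
Proof.
move=> [I [g [phi phi_bij]]] ex.
have [psi psiK] : exists psi : pmorphism (free_pmodule K g) N,
    forall p x, phi p (psi p x) = x.
  apply: (plift_mono (h := pid _)); first by move=> p; exact: bij_inj.
  by move=> p x; have [k _ kK] := phi_bij p; exists (k x); rewrite kK.
have psiK' p x : psi p (phi p x) = x.
  by apply: (bij_inj (phi_bij p)); rewrite psiK.
pose y i := projT1 (cid (ex (g i) (psi (g i) (fbasis g i)))).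
have yP i : q (g i) (y i) = h (g i) (psi (g i) (fbasis g i)) by rewrite /y; case: cid.
exists (pcomp (fext y) phi) => p x /=.
have -> : h p x = pcomp h psi p (phi p x) by rewrite /= psiK'.
move: (phi p x) => {}x.
by apply: (@fbasis_ext _ _ L (pcomp q (fext y)) (pcomp h psi)) => i /=; rewrite fext_basis yP.
Qed.

End Modules.

Arguments fcoef : simpl never.
Arguments fbasis : simpl never.
Arguments fext : simpl never.

Section FiniteFree.
Local Open Scope ring_scope.
Context (K : fieldType) d (P : porderType d) (I : finType) (g : I -> P).
Local Notation F := (free_pmodule K g).

Lemma fext_sum (N : pmodule K P) (y : forall i, N (g i)) p (c : F p) :
  fext y p c = \sum_i fcoef c i *: pact p (y i).
Proof. by apply: fextE => [|i _]; rewrite ?index_enum_uniq ?mem_index_enum. Qed.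

Lemma fbasis_sum_fin p (c : F p) :
  c = \sum_i fcoef c i *: pact p (fbasis K g i).
Proof. by apply: fbasis_sum => [|i _]; rewrite ?index_enum_uniq ?mem_index_enum. Qed.

Lemma fbasis_ind (Q : forall p, F p -> Prop) p :
  Q p 0 -> (forall a x y, Q p x -> Q p y -> Q p (a *: x + y)) ->
  (forall i, (g i <= p)%O -> Q p (pact p (fbasis K g i))) -> forall x, Q p x.
Proof.
move=> Q0 QD Qb x; rewrite (fbasis_sum_fin x).
elim/big_rec: _ => // i y _ Qy; have [xi|/fcoef_le gi] := eqVneq (fcoef x i) 0.
  by rewrite xi scale0r add0r.
by apply: QD => //; exact: Qb.
Qed.

Definition standard_basis : set {p : P & F p} :=
  [set existT _ (g i) (fbasis K g i) | i in [set: I]].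

Lemma standard_basis_generates : generates standard_basis.
Proof.
move=> N [Nlin Nmap] Nb p; apply: fbasis_ind; first by case: (Nlin p).
  by move=> a x y Nx Ny; case: (Nlin p) => _; exact.
move=> i gi; rewrite (pactE gi); apply: Nmap; apply: Nb.
by exists i.
Qed.

(** Without the basis element of [i] only elements with zero coefficient at
    [i] are generated. *)
Lemma standard_basis_minimal : minimal_generating_set standard_basis.
Proof.
split; first exact: standard_basis_generates.
move=> S' S'S gen; apply/seteqP; split=> // _ [i _ <-].
apply: contrapT => iS'.
suff : fcoef (fbasis K g i) i = 0 by rewrite fcoef_basis eqxx => /eqP; rewrite oner_eq0.
apply: (gen (fun p => [set x : F p | fcoef x i = 0]%classic)).
  split=> [p|p q h x xi]; last first.
    by change (fcoef (pmod_map F h x) i = 0); rewrite -(pactE h) fcoef_pact.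
  by split=> //= a x y; rewrite fcoef_linear => -> ->; rewrite mulr0 addr0.
move=> p x S'x.
suff: forall z : {p : P & F p}, S' z -> fcoef (projT2 z) i = 0.
  by move/(_ _ S'x).
move=> z S'z; have [i' _ E] := S'S _ S'z; move: S'z; rewrite -E /= => S'i'.
rewrite fcoef_basis; case: eqVneq => // ii'; by rewrite ii' in iS'.
Qed.

Lemma standard_basis_card : (standard_basis #= `I_#|I|)%card.
Proof.
pose f (k : 'I_#|I|) : {p : P & F p} := existT _ (g (enum_val k)) (fbasis K g (enum_val k)).
have -> : standard_basis = (f @` setT)%classic.
  apply/seteqP; split=> [_ [i _ <-]|_ [k _ <-]]; last by exists (enum_val k).
  by exists (enum_rank i); rewrite /f ?enum_rankK.
apply: card_eq_trans (inj_card_eq _) _; last by rewrite card_eq_sym card_II.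
move=> k l _ _ fkl; apply: enum_val_inj; apply/eqP; apply: contraT => kl.
have := congr1 (fun z : {p : P & F p} => fcoef (projT2 z) (enum_val l)) fkl.
rewrite /= !fcoef_basis eqxx eq_sym (negbTE kl) => /eqP.
by rewrite eq_sym oner_eq0.
Qed.

Lemma free_is_free : is_free F.
Proof. by exists I, g; exists (pid F) => p; exists id. Qed.

Lemma free_finitely_generated : finitely_generated F.
Proof.
exists standard_basis; last exact: standard_basis_generates.
by apply/finite_setP; exists #|I|; exact: standard_basis_card.
Qed.

(** The endomorphisms that differ from the identity by a map into the radical:
    each basis element is changed by elements of strictly smaller grade. *)
Definition unipotent (u : pmorphism F F) : Prop := forall i i',
  fcoef (u (g i) (fbasis K g i) - fbasis K g i) i' != 0 -> (g i' < g i)%O.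

(** A preimage of each basis element is built by induction over the finitely
    many grades below its own: the error made by the basis element itself
    consists of basis elements of smaller grade. *)
Lemma unipotent_right_inverse u : unipotent u ->
  exists2 v, unipotent v & forall p x, u p (v p x) = x.
Proof.
move=> uni.
pose sm i (y : F (g i)) := u (g i) y = fbasis K g i /\
  forall i', fcoef (y - fbasis K g i) i' != 0 -> (g i' < g i)%O.
have ex i : exists y, sm i y.
  have [n] := ubnP #|[pred i' | (g i' < g i)%O]|; elim: n i => // n IH i ni.
  have IH' i' : exists y : F (g i'), (g i' < g i)%O -> u (g i') y = fbasis K g i'.
    case: (boolP (g i' < g i)%O) => [lt|_]; last by exists 0.
    case: (IH i') => [|y [yE _]]; last by exists y.
    rewrite -ltnS; apply: leq_trans ni; rewrite ltnS; apply: proper_card.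
    apply/properP; split.
      by apply/fintype.subsetP => k; rewrite !inE => h; exact: lt_trans lt.
    by exists i'; rewrite !inE // ltxx.
  pose y i' := projT1 (cid (IH' i')).
  have yP i' : (g i' < g i)%O -> u (g i') (y i') = fbasis K g i'.
    by rewrite /y; case: cid.
  pose r := u (g i) (fbasis K g i) - fbasis K g i.
  exists (fbasis K g i - \sum_i' fcoef r i' *: pact (g i) (y i')); split.
    rewrite linearB linear_sum /=.
    have -> : \sum_i' u (g i) (fcoef r i' *: pact (g i) (y i')) = r.
      rewrite [RHS]fbasis_sum_fin; apply: eq_bigr => i' _.
      have [->|ri'] := eqVneq (fcoef r i') 0; first by rewrite !scale0r linear0.
      by rewrite linearZ /= pfun_pact yP //; exact: uni ri'.
    by rewrite /r subKr.
  move=> i'; rewrite addrAC subrr add0r => h.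
  have {h} : exists k, fcoef (fcoef r k *: pact (g i) (y k)) i' != 0.
    apply: contrapT => /forallNP k0; case/negP: h; apply/eqP.
    rewrite -scaleN1r fcoefZ fcoef_sum big1 ?mulr0 // => k _.
    by have /negP/negPn/eqP := k0 k.
  move=> [k]; rewrite fcoefZ mulf_eq0 negb_or => /andP[/uni gk yk].
  rewrite fcoef_pact ?ltW // in yk.
  exact: le_lt_trans (fcoef_le yk) gk.
pose v := fext (fun i => projT1 (cid (ex i))).
have vP i : sm i (v (g i) (fbasis K g i)) by rewrite fext_basis; case: cid.
exists v; first by move=> i; case: (vP i).
move=> p x; apply: (@fbasis_ext _ _ _ _ _ _ (pcomp u v) (pid F)) => i /=.
by case: (vP i).
Qed.

(** The right inverse is unipotent and has itself a right inverse, which must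
    be [u]. *)
Lemma unipotent_inverse u : unipotent u -> exists v : pmorphism F F,
  (forall p x, u p (v p x) = x) /\ (forall p x, v p (u p x) = x).
Proof.
move=> /unipotent_right_inverse[v /unipotent_right_inverse[w _ vw] uv].
exists v; split=> // p x.
by rewrite -[X in u p X](vw p) uv vw.
Qed.

End FiniteFree.

Section Splitting.
Local Open Scope ring_scope.
Context (K : fieldType) d (P : porderType d).
Implicit Types M N L : pmodule K P.

Section Kernel.
Variables (M N : pmodule K P) (f : pmorphism M N).

Definition ker_pred p : {pred M p} := fun x => f p x == 0.

Fact ker_submod p : submod_closed (@ker_pred p).
Proof.
split=> [|a x y]; rewrite !unfold_in ?linear0 // linearP.
by move=> /eqP -> /eqP ->; rewrite scaler0 addr0.
Qed.

HB.instance Definition _ p :=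
  GRing.isSubmodClosed.Build K (M p) (@ker_pred p) (ker_submod p).

Record ker_obj (p : P) := KerObj {
  ker_val : M p;
  ker_valP : ker_val \in @ker_pred p }.

HB.instance Definition _ p := [isSub for @ker_val p].
HB.instance Definition _ p := [Choice of ker_obj p by <:].
HB.instance Definition _ p := [SubChoice_isSubLmodule of ker_obj p by <:].

Lemma ker_val0 p (x : ker_obj p) : f p (ker_val x) = 0.
Proof. exact/eqP/(ker_valP x). Qed.

Definition mk_ker p (x : M p) (h : f p x = 0) : ker_obj p :=
  KerObj (introT eqP h : x \in @ker_pred p).

Fact ker_map_subproof p q (h : (p <= q)%O) (x : ker_obj p) :
  f q (pmod_map M h (ker_val x)) = 0.
Proof. by rewrite pfun_natural ker_val0 linear0. Qed.

Definition ker_map p q (h : (p <= q)%O) (x : ker_obj p) : ker_obj q :=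
  mk_ker (ker_map_subproof h x).

Fact ker_map_linear p q (h : (p <= q)%O) : linear (ker_map h).
Proof. by move=> a x y; apply: val_inj; rewrite /= linearP. Qed.

HB.instance Definition _ p q (h : (p <= q)%O) :=
  GRing.isLinear.Build K (ker_obj p) (ker_obj q) _ (ker_map h)
    (ker_map_linear h).

Definition ker_pmodule : pmodule K P.
Proof.
refine (@PModule K d P ker_obj (fun p q h => ker_map h) _ _).
- by move=> p h x; apply: val_inj; rewrite /= pmod_map_id.
- by move=> p q r h h' h'' x; apply: val_inj; rewrite /= (pmod_map_comp h h').
Defined.

End Kernel.

Section KernelMap.
Variables (M N M' N' : pmodule K P) (f : pmorphism M N) (f' : pmorphism M' N').
Variables (a : pmorphism M M') (b : pmorphism N N').
Hypothesis comm : forall p x, f' p (a p x) = b p (f p x).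

Fact ker_fun_subproof p (x : ker_obj f p) : f' p (a p (ker_val x)) = 0.
Proof. by rewrite comm ker_val0 linear0. Qed.

Definition ker_fun p (x : ker_obj f p) : ker_obj f' p :=
  mk_ker (ker_fun_subproof x).

Fact ker_fun_linear p : linear (@ker_fun p).
Proof. by move=> c x y; apply: val_inj; rewrite /= linearP. Qed.

HB.instance Definition _ p :=
  GRing.isLinear.Build K (ker_obj f p) (ker_obj f' p) _ (@ker_fun p)
    (@ker_fun_linear p).

Definition ker_pmorphism : pmorphism (ker_pmodule f) (ker_pmodule f').
Proof.
refine (@PMorphism K d P (ker_pmodule f) (ker_pmodule f') (fun p => @ker_fun p) _).
by move=> p q h x; apply: val_inj; rewrite /= pfun_natural.
Defined.

End KernelMap.

(** The complement is the kernel of the retraction [g]. *)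
Lemma complex_retract_split (C C' : pcomplex K P)
    (f : forall i, pmorphism (C i) (C' i)) (g : forall i, pmorphism (C' i) (C i)) :
  (forall i p x, f i p (cdiff C i p x) = cdiff C' i p (f i.+1 p x)) ->
  (forall i p x, g i p (cdiff C' i p x) = cdiff C i p (g i.+1 p x)) ->
  (forall i p x, g i p (f i p x) = x) ->
  exists D, complex_iso C' (sum_complex C D).
Proof.
move=> fd gd gf.
have DK i p (x : ker_pmodule (g i.+2) p) : ker_pmorphism (f := g i.+1) (gd i) p
    (ker_pmorphism (f := g i.+2) (gd i.+1) p x) = 0.
  by apply: val_inj; rewrite /= cdiffK.
pose D := @PComplex K d P (fun i => ker_pmodule (g i))
  (fun i => ker_pmorphism (f := g i.+1) (gd i)) DK.
exists D.
have kerP i p x : g i p (x - f i p (g i p x)) = 0 by rewrite linearB /= gf subrr.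
pose phi i p (x : C' i p) : (sum_complex C D) i p :=
  (g i p x, mk_ker (kerP i p x)).
have lin i p : linear (phi i p).
  move=> a x y; congr pair; first by rewrite linearP.
  by apply: val_inj; rewrite /= !linearP /= scalerN scalerBr addrACA.
pose phiL i p : {linear C' i p -> (sum_complex C D) i p} :=
  HB.pack (phi i p) (GRing.isLinear.Build K _ _ _ (phi i p) (lin i p)).
have nat i p q (h : (p <= q)%O) x :
    phiL i q (pmod_map (C' i) h x) = pmod_map (sum_complex C D i) h (phiL i p x).
  rewrite /= /sum_map /= /phi; congr pair; first by rewrite pfun_natural.
  by apply: val_inj; rewrite /= linearB !pfun_natural.
exists (fun i => PMorphism (nat i)); split=> [i p|i p x] /=.
  exists (fun z => f i p z.1 + ker_val z.2) => [x|[c [e ke]]]; first by rewrite /= subrKC.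
  have ge : g i p e = 0 by exact/eqP.
  rewrite /phi /=; have gE : g i p (f i p c + e) = c by rewrite linearD /= gf ge addr0.
  congr pair => //; apply: val_inj => /=.
  by rewrite gE addrAC subrr add0r.
rewrite /sum_fun /phi /=; congr pair; first by rewrite gd.
by apply: val_inj; rewrite /= linearB /= gd fd.
Qed.

End Splitting.

(** * Finite presentations and minimal free resolutions *)

Section Presentations.
Local Open Scope ring_scope.
Context (K : fieldType) d (P : porderType d) (M : pmodule K P) (X : finType).
Implicit Types (I J : {set X}) (gI gJ : X -> P) (A : X -> X -> K).

(** A free resolution [0 -> F1 -> F0 -> M] in coordinates. All index sets are
    subsets of one finite type [X], so that cancelling a generator against a
    relation only removes elements of [I] and [J]. *)
Record is_presentation I J gI gJ A (m : forall x, M (gI x)) : Prop := IsPresentation {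
  pres_grade : forall j i, j \in J -> i \in I -> A j i != 0 -> (gI i <= gJ j)%O;
  pres_gen : forall p x, exists2 c : X -> K,
    forall i, c i != 0 -> i \in I /\ (gI i <= p)%O &
    x = \sum_(i in I) c i *: pact p (m i);
  pres_rel : forall j, j \in J -> \sum_(i in I) A j i *: pact (gJ j) (m i) = 0;
  pres_exact : forall p (c : X -> K),
    (forall i, c i != 0 -> i \in I /\ (gI i <= p)%O) ->
    \sum_(i in I) c i *: pact p (m i) = 0 ->
    exists2 e : X -> K, forall j, e j != 0 -> j \in J /\ (gJ j <= p)%O &
      forall i, i \in I -> c i = \sum_(j in J) e j * A j i;
  pres_free : forall e : X -> K,
    (forall i, i \in I -> \sum_(j in J) e j * A j i = 0) ->
    forall j, j \in J -> e j = 0 }.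

Lemma pres_rel_le I J gI gJ A m p j : @is_presentation I J gI gJ A m ->
  j \in J -> (gJ j <= p)%O -> \sum_(i in I) A j i *: pact p (m i) = 0.
Proof.
move=> pr jJ jp; rewrite -[RHS](linear0 (@pact _ _ _ M (gJ j) p)) -(pres_rel pr jJ).
rewrite linear_sum; apply: eq_bigr => i iI.
have [->|Aji] := eqVneq (A j i) 0; first by rewrite !scale0r linear0.
by rewrite linearZ /= pact_comp // (pres_grade pr).
Qed.

(** Cancellation of a generator [i0] against a relation [j0] of the same grade,
    as in Gaussian elimination. *)
Lemma pres_cancel I J gI gJ A m i0 j0 : @is_presentation I J gI gJ A m ->
  i0 \in I -> j0 \in J -> A j0 i0 != 0 -> gI i0 = gJ j0 ->
  @is_presentation (I :\ i0) (J :\ j0) gI gJ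
    (fun j i => A j i - A j i0 / A j0 i0 * A j0 i) m.
Proof.
move=> pr i0I j0J a0 g0; set a := A j0 i0 in a0 *.
(* The relation [j0] expresses the generator [i0] by the others. *)
have m0E p : (gI i0 <= p)%O ->
    pact p (m i0) = - a^-1 *: \sum_(i in I :\ i0) A j0 i *: pact p (m i).
  move=> i0p; have := pres_rel_le pr j0J (p := p); rewrite -g0 => /(_ i0p).
  rewrite (big_setD1 _ i0I) /= -/a => /eqP; rewrite addr_eq0 => /eqP E.
  by rewrite scaleNr -scalerN -E scalerA mulVf ?scale1r.
have gA j i : j \in J -> i \in I -> A j i0 / a * A j0 i != 0 -> (gI i <= gJ j)%O.
  rewrite !mulf_eq0 !negb_or => jJ iI /andP[/andP[A1 _] A2].
  apply: le_trans (pres_grade pr j0J iI A2) _.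
  by rewrite -g0 (pres_grade pr).
have sumE p (c : X -> K) : (c i0 != 0 -> (gI i0 <= p)%O) ->
    \sum_(i in I) c i *: pact p (m i) =
    \sum_(i in I :\ i0) (c i - c i0 / a * A j0 i) *: pact p (m i).
  move=> ci0; rewrite (big_setD1 _ i0I) /=.
  under [RHS]eq_bigr do rewrite scalerBl -scalerA.
  rewrite sumrB -scaler_sumr addrC; congr (_ + _).
  have [->|/ci0 i0p] := eqVneq (c i0) 0; first by rewrite mul0r !scale0r oppr0.
  by rewrite m0E // scalerA mulrN scaleNr.
have sumJ (e : X -> K) i : \sum_(j in J) e j * A j i0 = 0 ->
    \sum_(j in J) e j * A j i =
    \sum_(j in J :\ j0) e j * (A j i - A j i0 / a * A j0 i).
  rewrite (big_setD1 _ j0J) /= -/a => /eqP; rewrite addr_eq0 => /eqP ej0.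
  rewrite (big_setD1 _ j0J) /=; under [RHS]eq_bigr do rewrite mulrBr !mulrA.
  rewrite sumrB addrC; congr (_ + _).
  rewrite -!mulr_suml -[e j0](mulfK a0) ej0 !mulNr //.
split.
- move=> j i /setD1P[_ jJ] /setD1P[_ iI] h.
  have [A0|/(pres_grade pr jJ iI)//] := eqVneq (A j i) 0.
  by apply: gA => //; apply: contra h => /eqP ->; rewrite A0 subr0.
- move=> p x; have [c cI ->] := pres_gen pr x.
  exists (fun i => if i \in I :\ i0 then c i - c i0 / a * A j0 i else 0).
    move=> i; case: ifP => [/setD1P[ii0 iI]|]; last by rewrite eqxx.
    have [ci|/cI[_ ip] _] := eqVneq (c i) 0; last by [].
    rewrite ci sub0r oppr_eq0 !mulf_eq0 !negb_or => /andP[/andP[/cI[_ i0p] _] A2].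
    split=> //.
    by apply: le_trans (pres_grade pr j0J iI A2) _; rewrite -g0.
  rewrite sumE; last by move=> /cI[].
  by apply: eq_bigr => i ->.
- move=> j /setD1P[_ jJ]; rewrite -sumE; first exact: pres_rel pr _ jJ.
  exact: pres_grade pr _ _ jJ i0I.
- move=> p c cI c0.
  have ci0 : c i0 = 0.
    by have [//|/cI[/setD1P[]]] := eqVneq (c i0) 0; rewrite eqxx.
  have [||e eJ eP] := pres_exact pr (p := p) (c := c).
  + by move=> i /cI[/setD1P[]].
  + by rewrite (big_setD1 _ i0I) /= ci0 scale0r add0r.
  exists (fun j => if j == j0 then 0 else e j).
    move=> j; have [->|jj0] := eqVneq j j0; first by rewrite eqxx.
    by move=> /eJ[jJ jp]; rewrite in_setD1 jj0.
  move=> i /setD1P[ii0 iI]; rewrite eP // sumJ -?eP //.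
  by apply: eq_bigr => j /setD1P[/negbTE -> _].
- move=> e e0.
  pose e' j := if j == j0 then - (\sum_(j in J :\ j0) e j * A j i0) / a else e j.
  have e'E j : j \in J :\ j0 -> e' j = e j by move=> /setD1P[/negbTE h _]; rewrite /e' h.
  have e'0 : \sum_(j in J) e' j * A j i0 = 0.
    rewrite (big_setD1 _ j0J) /= {1}/e' eqxx -/a divfK //.
    by under [X in _ + X]eq_bigr => j jJ do rewrite e'E //; rewrite addNr.
  move=> j jJ; rewrite -e'E //; case/setD1P: jJ => _.
  apply: (pres_free pr) => i iI; have [->//|ii0] := eqVneq i i0.
  rewrite sumJ // -[RHS](e0 i); last by rewrite in_setD1 ii0.
  by apply: eq_bigr => k /e'E ->.
Qed.

(** Each cancellation removes a generator; when none is possible, the matrix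
    has entries only between strictly comparable grades. *)
Lemma pres_reduce I J gI gJ A m : @is_presentation I J gI gJ A m ->
  exists I' J' A', [/\ (#|I'| <= #|I|)%N, (#|J'| <= #|J|)%N,
    @is_presentation I' J' gI gJ A' m &
    forall j i, j \in J' -> i \in I' -> A' j i != 0 -> (gI i < gJ j)%O].
Proof.
have [n] := ubnP #|I|; elim: n I J A => // n IH I J A In pr.
have [rad|] := pselect (forall j i, j \in J -> i \in I -> A j i != 0 -> (gI i < gJ j)%O).
  by exists I, J, A.
move=> /existsNP[j0] /existsNP[i0] /not_implyP[j0J] /not_implyP[i0I] /not_implyP[A0].
rewrite lt_neqAle (pres_grade pr) // andbT => /negP/negPn/eqP g0.
have [|I' [J' [A' [cI cJ pr' rad]]]] := IH _ _ _ _ (pres_cancel pr i0I j0J A0 g0).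
  by rewrite -ltnS; apply: leq_trans In; rewrite ltnS [X in (_ < X)%N](cardsD1 i0) i0I.
exists I', J', A'; split=> //.
  by apply: leq_trans cI _; rewrite subset_leq_card // subD1set.
by apply: leq_trans cJ _; rewrite subset_leq_card // subD1set.
Qed.

Section SubFree.
Variables (S : {set X}) (g : X -> P).

Definition sub_free : pmodule K P :=
  free_pmodule K (fun u : {x | x \in S} => g (val u)).

Fact sub_free_subproof p (c : X -> K) :
  (forall x, x \in S -> c x != 0 -> (g x <= p)%O) ->
  (fun u : {x | x \in S} => c (val u)) \in
    @free_pred K _ _ _ (fun u : {x | x \in S} => g (val u)) p.
Proof.
move=> cp; apply/asboolP; split; first exact: finite_finset.
by move=> u; apply: cp; exact: valP.
Qed.

Definition sub_mk p (c : X -> K)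
    (h : forall x, x \in S -> c x != 0 -> (g x <= p)%O) : sub_free p :=
  FreeObj (sub_free_subproof h).

(** Coefficients extended by zero to all of [X], to match the sums in
    [is_presentation]. *)
Definition sub_coef p (c : sub_free p) (x : X) : K :=
  if insub x is Some u then fcoef c u else 0.

Lemma sub_coef_val p (c : sub_free p) u : sub_coef c (val u) = fcoef c u.
Proof. by rewrite /sub_coef valK. Qed.

Lemma sub_coef_neq0 p (c : sub_free p) x :
  sub_coef c x != 0 -> x \in S /\ (g x <= p)%O.
Proof.
rewrite /sub_coef; case: insubP => [u xS <- /fcoef_le gp|]; last by rewrite eqxx.
by split; first exact: valP.
Qed.

Lemma sub_fext (N : pmodule K P) (y : forall x, N (g x)) p (c : sub_free p) :
  fext (fun u => y (val u)) p c = \sum_(x in S) sub_coef c x *: pact p (y x).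
Proof.
rewrite big_sub fext_sum; apply: eq_bigr => u _.
by rewrite sub_coef_val.
Qed.

End SubFree.

Section Resolution.
Variables (I J : {set X}) (gI gJ : X -> P) (A : X -> X -> K).
Variable (m : forall x, M (gI x)).
Hypothesis pr : is_presentation I J gJ A m.

Definition pres_augmentation : pmorphism (sub_free I gI) M :=
  fext (fun u : {x | x \in I} => m (val u)).

Definition pres_diff : pmorphism (sub_free J gJ) (sub_free I gI) :=
  fext (fun u : {x | x \in J} => sub_mk (fun i => pres_grade pr (i := i) (valP u)) : sub_free I gI _).

Lemma pres_augmentationE p c : pres_augmentation p c =
  \sum_(i in I) sub_coef c i *: pact p (m i).
Proof. exact: sub_fext. Qed.

Lemma pres_diffE p e i : fcoef (pres_diff p e) i =
  \sum_(j in J) sub_coef e j * A j (val i).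
Proof.
rewrite big_sub /pres_diff fext_sum fcoef_sum; apply: eq_bigr => u _.
rewrite fcoefZ sub_coef_val; have [->|/fcoef_le eu] := eqVneq (fcoef e u) 0.
  by rewrite !mul0r.
by rewrite fcoef_pact.
Qed.

Lemma pres_augmentation_epi : pepi pres_augmentation.
Proof.
move=> p x; have [c cI ->] := pres_gen pr x.
exists (sub_mk (fun i _ ci => (cI i ci).2)).
rewrite pres_augmentationE; apply: eq_bigr => i iI.
by rewrite -[i]/(val (exist _ i iI : {x | x \in I})) sub_coef_val.
Qed.

Lemma pres_diff_exact : pexact pres_diff pres_augmentation.
Proof.
move=> p x; rewrite pres_augmentationE; split=> [/(pres_exact pr)|[e <-]].
  case=> [i /sub_coef_neq0//|e eJ xE].
  exists (sub_mk (fun j _ ej => (eJ j ej).2)); apply: fcoef_ext => i.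
  have := xE (val i) (valP i); rewrite sub_coef_val => ->; rewrite pres_diffE; apply: eq_bigr => j jJ.
  by rewrite -[j]/(val (exist _ j jJ : {x | x \in J})) sub_coef_val.
transitivity (\sum_(j in J) sub_coef e j *: \sum_(i in I) A j i *: pact p (m i)).
  under [RHS]eq_bigr do rewrite scaler_sumr.
  rewrite exchange_big /=; apply: eq_bigr => i iI.
  rewrite -[i]/(val (exist _ i iI : {x | x \in I})) sub_coef_val pres_diffE /=.
  by rewrite scaler_suml; apply: eq_bigr => j _; rewrite scalerA.
apply: big1 => j jJ; have [->|/sub_coef_neq0[_ jp]] := eqVneq (sub_coef e j) 0.
  by rewrite scale0r.
by rewrite (pres_rel_le pr) ?scaler0.
Qed.

Lemma pres_diff_inj p : injective (pres_diff p).
Proof.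
move=> e e' ee'; apply: fcoef_ext => u; apply/eqP; rewrite -subr_eq0; apply/eqP.
rewrite -!sub_coef_val.
apply: (pres_free pr (e := fun j => sub_coef e j - sub_coef e' j)); last exact: valP.
move=> i iI; under eq_bigr do rewrite mulrBl.
rewrite sumrB; apply/eqP; rewrite subr_eq0; apply/eqP.
by rewrite -!(pres_diffE _ (exist _ i iI)) ee'.
Qed.

Lemma pres_finitely_presented : finitely_presented_module M.
Proof.
exists (sub_free I gI), (sub_free J gJ), pres_diff, pres_augmentation.
split; last exact: pres_augmentation_epi.
- by split; [exact: free_is_free|exact: free_finitely_generated].
- by split; [exact: free_is_free|exact: free_finitely_generated].
- exact: pres_diff_exact.
Qed.

(** The zero module as the free module on no generators, so that it is free by
    definition. *)
Definition zero_free : pmodule K P := free_pmodule K (of_void P).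

Lemma zero_freeP p (x : zero_free p) : x = 0.
Proof. by apply: fcoef_ext => -[]. Qed.

Definition pres_complex_mod (i : nat) : pmodule K P :=
  match i with
  | 0 => sub_free I gI
  | 1 => sub_free J gJ
  | _ => zero_free
  end.

Definition pres_complex_diff (i : nat) :
    pmorphism (pres_complex_mod i.+1) (pres_complex_mod i) :=
  match i with
  | 0 => pres_diff
  | _ => pzero _ _
  end.

Fact pres_complex_diffK i p x :
  pres_complex_diff i p (pres_complex_diff i.+1 p x) = 0.
Proof. by case: i x => [|i] x //=; rewrite linear0. Qed.

Definition pres_complex : pcomplex K P := PComplex pres_complex_diffK.

Lemma pres_complex_free_resolution : free_resolution M pres_complex.
Proof.
split=> [[|[|i]]|[|i] p x|].
- exact: free_is_free.
- exact: free_is_free.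
- exact: free_is_free.
- split=> [x0|[y <-]]; last exact: (pres_complex_diffK (i := 0)).
  exists 0; apply: (@pres_diff_inj p); rewrite (linear0 (cdiff pres_complex 1 p)).
  by rewrite linear0; exact: esym x0.
- split=> [_|[y <-]]; last exact: (pres_complex_diffK (i := i.+1)).
  by exists 0; rewrite (linear0 (cdiff pres_complex i.+2 p)); exact: esym (zero_freeP x).
- exists pres_augmentation; split; last exact: pres_augmentation_epi.
  exact: pres_diff_exact.
Qed.

Hypothesis rad : forall j i, j \in J -> i \in I -> A j i != 0 -> (gI i < gJ j)%O.

(** Comparison maps [f] and [g] with any free resolution exist because the
    modules are free; [g f] differs from the identity by a map into the image
    of the differential, which lies in the radical, so that [g] can be
    corrected to a left inverse of [f]. *)
Lemma pres_complex_minimal : minimal_free_resolution M pres_complex.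
Proof.
split=> [|C' [C'free C'exact [e' [e'exact e'epi]]]].
  exact: pres_complex_free_resolution.
have [f0 f0P] := plift_free (q := e') (h := pres_augmentation)
  (free_is_free _ _) (fun p x => e'epi p _).
have [g0' g0'P] := plift_free (q := pres_augmentation) (h := e') (C'free 0)
  (fun p x => pres_augmentation_epi _).
(* [g0' f0] lifts the identity of [M], so that it is unipotent by exactness and
   [rad]; composing [g0'] with its inverse makes [g0'] a retraction. *)
have [v [uv vu]] : exists v : pmorphism (sub_free I gI) (sub_free I gI),
    (forall p x, pcomp g0' f0 p (v p x) = x) /\ (forall p x, v p (pcomp g0' f0 p x) = x).
  apply: unipotent_inverse => i i' h.
  have [e eE] : exists e, pres_diff (gI (val i)) e =
      pcomp g0' f0 (gI (val i)) (fbasis K _ i) - fbasis K _ i.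
    by apply/pres_diff_exact; rewrite linearB /= g0'P f0P subrr.
  move: h; rewrite -eE pres_diffE => h.
  have {h} [j jJ] : exists2 j, j \in J & sub_coef e j * A j (val i') != 0.
    apply: contrapT => h'; case/negP: h; apply/eqP/big1 => j jJ.
    by apply/eqP; apply: contrapT => /negP h; apply: h'; exists j.
  rewrite mulf_eq0 negb_or => /andP[/sub_coef_neq0[_ jp] Aj].
  by apply: lt_le_trans jp; apply: rad => //; exact: valP.
pose g0 := pcomp v g0'.
have g0P p x : pres_augmentation p (g0 p x) = e' p x.
  by rewrite -g0'P /= -[in RHS](uv _ (g0' p x)) /= g0'P f0P.
have [f1 f1P] := plift_free (q := cdiff C' 0) (h := pcomp f0 pres_diff) (free_is_free _ _)
  (fun p x => (e'exact p _).1 (etrans (f0P p (pres_diff p x))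
     ((pres_diff_exact (pres_diff p x)).2 (ex_intro _ x erefl)))).
have [g1 g1P] := plift_mono (i := pres_diff) (h := pcomp g0 (cdiff C' 0)) pres_diff_inj
  (fun p x => (pres_diff_exact _).1 (etrans (g0P p (cdiff C' 0 p x))
     ((e'exact p (cdiff C' 0 p x)).2 (ex_intro _ x erefl)))).
pose f i : pmorphism (pres_complex i) (C' i) :=
  match i with 0 => f0 | 1 => f1 | _ => pzero _ _ end.
pose g i : pmorphism (C' i) (pres_complex i) :=
  match i with 0 => g0 | 1 => g1 | _ => pzero _ _ end.
apply: (@complex_retract_split _ _ _ _ _ f g).
- by case=> [|[|i]] p x /=; rewrite ?f1P ?linear0.
- case=> [|[|i]] p x /=; rewrite ?g1P ?linear0 //.
  by apply: (@pres_diff_inj p); rewrite g1P /= cdiffK !linear0.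
- case=> [|[|i]] p x /=; first exact: vu.
    apply: (@pres_diff_inj p); rewrite g1P -[RHS]vu; congr (v p _).
    by rewrite /= f1P.
  by rewrite (zero_freeP x).
Qed.

Lemma minimal_pres_betti : betti M 0 #|I| /\ betti M 1 #|J|.
Proof.
split; exists pres_complex; (split; first exact: pres_complex_minimal).
  exists (@standard_basis K _ _ _ (fun u : {x | x \in I} => gI (val u))); split.
    exact: standard_basis_minimal.
  by have := @standard_basis_card K _ _ _ (fun u : {x | x \in I} => gI (val u)); rewrite card_sig.
exists (@standard_basis K _ _ _ (fun u : {x | x \in J} => gJ (val u))); split.
  exact: standard_basis_minimal.
by have := @standard_basis_card K _ _ _ (fun u : {x | x \in J} => gJ (val u)); rewrite card_sig.
Qed.

End Resolution.

Theorem pres_betti I J gI gJ A m : @is_presentation I J gI gJ A m ->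
  exists b0 b1, [/\ (b0 <= #|I|)%N, (b1 <= #|J|)%N, betti M 0 b0 & betti M 1 b1].
Proof.
move=> /pres_reduce[I' [J' [A' [cI cJ pr rad]]]].
by have [b0 b1] := minimal_pres_betti pr rad; exists #|I'|, #|J'|.
Qed.

(** The matrix is unitriangular with respect to the rank [r]: eliminating the
    dead generators of a relation in order of rank leaves a combination of the
    living ones, which vanishes because these form a basis. For the same
    reason the relations are independent. *)
Theorem basis_presentation (gI gJ : X -> P) (D : {set X}) (r : X -> nat)
    (B : X -> X -> K) (m : forall x, M (gI x)) :
  let alive p x := (gI x <= p)%O && ~~ ((x \in D) && (gJ x <= p)%O) in
  (forall x, x \in D -> (gI x <= gJ x)%O) ->
  (forall x y, x \in D -> B x y != 0 -> (gI y <= gJ x)%O /\ (r x < r y)%N) ->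
  (forall x, x \in D -> pact (gJ x) (m x) = \sum_y B x y *: pact (gJ x) (m y)) ->
  (forall p (x : M p), exists c : X -> K, x = \sum_(y | alive p y) c y *: pact p (m y)) ->
  (forall p (c : X -> K), \sum_(y | alive p y) c y *: pact p (m y) = 0 ->
    forall y, alive p y -> c y = 0) ->
  @is_presentation [set: X]%SET D gI gJ (fun x y => (y == x)%:R - B x y) m.
Proof.
move=> alive gD gB mB span lin.
set A := fun x y => _.
have gA j i : j \in D -> A j i != 0 -> (gI i <= gJ j)%O.
  move=> jD; rewrite /A; have [-> _|_] := eqVneq i j; first exact: gD.
  by rewrite sub0r oppr_eq0 => /(gB _ _ jD)[].
have relA p j : j \in D -> (gJ j <= p)%O -> \sum_i A j i *: pact p (m i) = 0.
  move=> jD jp; under eq_bigr do rewrite scalerBl; rewrite sumrB.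
  rewrite (bigD1 j) //= eqxx scale1r big1 ?addr0; last first.
    by move=> i /negbTE ->; rewrite scale0r.
  apply/eqP; rewrite subr_eq0 -(pact_comp (p := gJ j)) ?gD // mB // linear_sum.
  apply/eqP; apply: eq_bigr => i _.
  have [->|/(gB _ _ jD)[gi _]] := eqVneq (B j i) 0; first by rewrite !scale0r linear0.
  by rewrite linearZ /= pact_comp.
have diagA j i : j \in D -> (r i <= r j)%N -> A j i = (i == j)%:R.
  move=> jD ij; rewrite /A; have [->|/(gB _ _ jD)[_]] := eqVneq (B j i) 0.
    by rewrite subr0.
  by rewrite ltnNge ij.
split=> //.
- by move=> j i jD _; exact: gA.
- move=> p x; have [c ->] := span p x.
  exists (fun y => if alive p y then c y else 0).
    by move=> y; rewrite finset.in_setT; case: ifP => [/andP[]|]; rewrite ?eqxx.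
  rewrite big_mkcond [RHS]big_mkcond /=; apply: eq_bigr => y _.
  by rewrite finset.in_setT; case: ifP; rewrite ?scale0r.
- move=> j jD; rewrite -[RHS](relA (gJ j) j jD) //.
  by apply: eq_bigl => i; rewrite finset.in_setT.
- move=> p c cp c0.
  pose dead x := (x \in D) && (gJ x <= p)%O.
  (* The coefficients of the relations are found rank by rank. *)
  have red k : exists2 e : X -> K, forall j, e j != 0 -> dead j &
      forall i, dead i -> (r i < k)%N -> c i = \sum_(j in D) e j * A j i.
    elim: k => [|k [e eD eP]]; first by exists (fun=> 0) => // j; rewrite eqxx.
    pose del i := if dead i && (r i == k) then c i - \sum_(j in D) e j * A j i else 0.
    exists (fun i => e i + del i).
      move=> j; rewrite /del; case: ifP => [/andP[]//|_].
      by rewrite addr0; exact: eD.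
    move=> i iD ik; under eq_bigr do rewrite mulrDl; rewrite big_split /=.
    have -> : \sum_(j in D) del j * A j i = del i.
      case/andP: (iD) => iD' _; rewrite (bigD1 i) //= diagA // eqxx mulr1 big1 ?addr0 //.
      move=> j /andP[jD ji]; rewrite /del; case: ifP => [/andP[_ /eqP rj]|]; last by rewrite mul0r.
      by rewrite diagA ?rj // eq_sym (negbTE ji) mulr0.
    rewrite /del iD /=; case: eqP => [_|/eqP rik]; first by rewrite subrKC.
    by rewrite addr0; apply: eP => //; rewrite ltn_neqAle rik.
  have [e eD eP] := red (\max_x r x).+1.
  have {}eP i : dead i -> c i = \sum_(j in D) e j * A j i.
    by move=> iD; apply: eP => //; rewrite ltnS leq_bigmax.
  exists e; first by move=> j /eD /andP[].
  have eA0 : \sum_i (\sum_(j in D) e j * A j i) *: pact p (m i) = 0.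
    under eq_bigr do rewrite scaler_suml; rewrite exchange_big big1 //= => j jD.
    under eq_bigr do rewrite -scalerA; rewrite -scaler_sumr.
    have [->|/eD/andP[_ jp]] := eqVneq (e j) 0; first by rewrite scale0r.
    by rewrite relA ?scaler0.
  have out i : ~~ (gI i <= p)%O -> c i = 0 /\ \sum_(j in D) e j * A j i = 0.
    move=> ip; split.
      by apply/eqP; apply: contraNT ip => /cp[].
    apply: big1 => j jD; have [->|/eD/andP[_ jp]] := eqVneq (e j) 0; first by rewrite mul0r.
    have [->|/(gA _ _ jD) ij] := eqVneq (A j i) 0; first by rewrite mulr0.
    by rewrite (le_trans ij jp) in ip.
  have sub0 : \sum_(i | alive p i) (c i - \sum_(j in D) e j * A j i) *: pact p (m i) = 0.
    rewrite big_mkcond /=.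
    transitivity (\sum_i (c i - \sum_(j in D) e j * A j i) *: pact p (m i)); last first.
      under eq_bigr do rewrite scalerBl; rewrite sumrB eA0 subr0 -[RHS]c0.
      by apply: eq_bigl => i; rewrite finset.in_setT.
    apply: eq_bigr => i _; case: ifP => //; rewrite /alive.
    case: (boolP (gI i <= p)%O) => [_ /negbFE /eP ->|/out[-> ->] _].
      by rewrite subrr scale0r.
    by rewrite subrr scale0r.
  move=> i _; have := lin _ _ sub0 i; rewrite /alive.
  case: (boolP (gI i <= p)%O) => [_|/out[-> ->] //].
  case: (boolP (dead i)) => [iD _|iD /(_ iD) /eqP]; first exact: eP.
  by rewrite subr_eq0 => /eqP.
- move=> e e0 j; have [n] := ubnP (r j); elim: n j => // n IH j rj jD.
  have := e0 j (finset.in_setT j); rewrite (bigD1 j) //= diagA // eqxx mulr1.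
  rewrite big1 ?addr0 // => i /andP[iD ij].
  have [Bij|/(gB _ _ iD)[_ rij]] := eqVneq (B i j) 0.
    by rewrite /A Bij eq_sym (negbTE ij) subr0 mulr0.
  by rewrite IH ?mul0r //; apply: leq_trans rij _; rewrite -ltnS.
Qed.

End Presentations.

(** * The cover by maximal simplices *)

Section LexOrder.
Variables (V : choiceType) (lev : rel V) (C : {pred V}).
Hypothesis lev_wo : wo_chain lev C.

(** The minimum of the three elements decides. *)
Lemma wo_chain_transitive : {in C & &, transitive lev}.
Proof.
move=> y x z yC xC zC xy yz.
have anti := wo_chain_antisymmetric lev_wo.
have sub : {subset pred3 x y z <= C} by move=> _ /or3P[] /eqP ->.
have [m [[mS mlb] _]] : exists! m, minimum_of lev (pred3 x y z) m.
  by apply: lev_wo => //; exists x; apply/or3P; constructor 1.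
have mx : lev m x by apply: mlb; apply/or3P; constructor 1.
have my : lev m y by apply: mlb; apply/or3P; constructor 2.
have mz : lev m z by apply: mlb; apply/or3P; constructor 3.
case/or3P: mS => /eqP mE; subst m => //.
- by rewrite (anti x y) // xy.
- by rewrite -(anti y z) // yz.
Qed.

Lemma lexle_refl s : lexle lev s s.
Proof. by elim: s => //= x s ->; rewrite eqxx. Qed.

Lemma lexle_anti s t : all [in C] s -> all [in C] t ->
  lexle lev s t -> lexle lev t s -> s = t.
Proof.
elim: s t => [|x s IH] [|y t] //= /andP[xC sC] /andP[yC tC].
have [<-|xy] := eqVneq x y; first by move=> st ts; rewrite (IH t).
move=> lxy lyx; case/eqP: xy.
by apply: (wo_chain_antisymmetric lev_wo) => //; rewrite lxy lyx.
Qed.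

Lemma lexle_total s t : all [in C] s -> all [in C] t ->
  lexle lev s t || lexle lev t s.
Proof.
elim: s t => [|x s IH] [|y t] //= /andP[xC sC] /andP[yC tC].
rewrite [y == x]eq_sym; case: eqVneq => _; first exact: IH.
exact: (wo_chainW lev_wo).
Qed.

Lemma lexle_trans s t u : all [in C] s -> all [in C] t -> all [in C] u ->
  lexle lev s t -> lexle lev t u -> lexle lev s u.
Proof.
elim: s t u => [|x s IH] [|y t] [|z u] //= /andP[xC sC] /andP[yC tC] /andP[zC uC].
have [<-|xy] := eqVneq x y.
  by case: (eqVneq x z) => // _; exact: IH.
have [<-|yz] := eqVneq y z; first by rewrite (negbTE xy).
have [<-|xz] := eqVneq x z.
  move=> lxy lyx; case/eqP: xy.
  by apply: (wo_chain_antisymmetric lev_wo) => //; rewrite lxy lyx.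
exact: wo_chain_transitive.
Qed.

Lemma exists_lexmin (A : {fset {fset V}}) s :
  (forall t, t \in A -> {subset t <= C}) -> s \in A ->
  exists2 u, u \in A & forall w, w \in A -> simplex_lexle lev u w.
Proof.
move=> AC sA.
have sortC t : t \in A -> all [in C] (sort lev t).
  by move=> tA; rewrite all_sort; apply/allP => v; apply: AC.
have: {subset (enum_fset A) <= A} by [].
have: s \in enum_fset A by [].
suff H (B : seq {fset V}) x : x \in B -> {subset B <= A} ->
    exists2 u, u \in B & forall w, w \in B -> simplex_lexle lev u w.
  by move=> /H h /h.
elim: B x => // b [|c B] IH x _ BA.
  exists b; first by rewrite inE.
  by move=> w; rewrite inE => /eqP ->; exact: lexle_refl.
have [|y yB|u uB umin] := IH c; first by rewrite inE eqxx.
  by apply: BA; rewrite inE yB orbT.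
have bA : b \in A by apply: BA; rewrite inE eqxx.
have uA : u \in A by apply: BA; rewrite inE uB orbT.
have /orP[bu|ub] := lexle_total (sortC _ bA) (sortC _ uA).
  exists b; rewrite ?inE ?eqxx // => w; rewrite inE => /orP[/eqP ->|wB].
    exact: lexle_refl.
  apply: lexle_trans bu (umin _ wB); apply: sortC => //.
  by apply: BA; rewrite inE wB orbT.
exists u; first by rewrite inE uB orbT.
by move=> w; rewrite inE => /orP[/eqP ->//|]; exact: umin.
Qed.

End LexOrder.

Section CoverMap.
Context d (T : orderType d) (V : choiceType) (F : filtration T V).
Variable lev : rel V.
Hypothesis lev_wo : wo_chain lev (mem (colim_vertices F)).
Local Open Scope fset_scope.

Lemma maxsimpsP (W : scomplex V) s : reflect
  (s \in simps W /\ forall t, t \in simps W -> s `<=` t -> t = s)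
  (s \in maxsimps W).
Proof.
rewrite /maxsimps !inE; apply: (iffP andP) => -[sW]; [move/allP|] => smax; split=> //.
  by move=> t /smax /implyP h /h /eqP.
by apply/allP => t tW; apply/implyP => /(smax t tW) ->.
Qed.

Lemma maxsimps_simps (W : scomplex V) s : s \in maxsimps W -> s \in simps W.
Proof. by case/maxsimpsP. Qed.

Lemma maxsimps_max (W : scomplex V) s t :
  s \in maxsimps W -> t \in simps W -> s `<=` t -> t = s.
Proof. by case/maxsimpsP => _; exact. Qed.

Lemma eq_maxsimps (W W' : scomplex V) :
  simps W = simps W' -> maxsimps W = maxsimps W'.
Proof. by move=> WW'; apply/fsetP => s; rewrite /maxsimps WW'. Qed.

Lemma exists_maxsimps (W : scomplex V) s : s \in simps W ->
  exists2 u, u \in maxsimps W & s `<=` u.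
Proof.
move=> sW.
have [[u uW] /= su umax] : exists2 u : simps W, s `<=` val u &
    forall t : simps W, s `<=` val t -> (#|` val t| <= #|` val u|)%N.
  case: (@arg_maxnP _ [` sW] (fun t => s `<=` val t) (fun t => #|` val t|)) => //=.
  by move=> u; exists u.
exists u => //; apply/maxsimpsP; split=> // t tW ut.
apply/eqP; rewrite eq_sym eqEfcard ut /=; apply: (umax [` tW]).
exact: fsubset_trans ut.
Qed.

Definition csize (t : T) : nat := #|` simps (F t)|.

Lemma csize_mono t t' : (t <= t')%O -> (csize t <= csize t')%N.
Proof. by move=> tt'; apply/fsubset_leq_card/fcplx_mono. Qed.

Lemma csize_simps t t' : csize t = csize t' -> simps (F t) = simps (F t').
Proof.
wlog tt' : t t' / (t <= t')%O.
  by move=> h; case: (leP t t') => [|/ltW] /h // h' /esym /h' /esym.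
by move=> c; apply/eqP; rewrite eqEfcard fcplx_mono //= -/(csize t) -/(csize t') c.
Qed.

Lemma csize_le t t' : (csize t <= csize t')%N -> simps (F t) `<=` simps (F t').
Proof.
have [tt' _|/ltW t't] := leP t t'; first exact: fcplx_mono.
move=> h; suff -> : simps (F t) = simps (F t') by [].
by apply: csize_simps; apply/eqP; rewrite eqn_leq h csize_mono.
Qed.

(** A maximal simplex has no other coface. *)
Lemma lexmin_coface_max t s u : s \in maxsimps (F t) ->
  lexmin_coface F lev t s u <-> u = s.
Proof.
move=> sm; split=> [[um su _]|->].
  exact: maxsimps_max sm (maxsimps_simps um) su.
split=> // w wm sw; rewrite (maxsimps_max sm (maxsimps_simps wm) sw).
exact: lexle_refl.
Qed.

Lemma simps_colim t s : s \in simps (F t) -> {subset s <= mem (colim_vertices F)}.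
Proof.
move=> sF v vs; apply/mem_set; exists t; apply: simps_closed sF _ _.
  by rewrite fsub1set.
by apply/fset0Pn; exists v; rewrite inE.
Qed.

Lemma exists_lexmin_coface t s : s \in simps (F t) ->
  exists u, lexmin_coface F lev t s u.
Proof.
move=> sF; have [u um su] := exists_maxsimps sF.
have [||w] := @exists_lexmin _ _ _ lev_wo [fset w in maxsimps (F t) | s `<=` w] u.
- by move=> w; rewrite inE => /andP[/maxsimps_simps /simps_colim].
- by rewrite inE; apply/andP.
rewrite inE /= => /andP[wm sw] wmin; exists w; split=> // x xm sx.
by apply: wmin; rewrite inE; apply/andP.
Qed.

Lemma lexmin_coface_unique t s u u' : lexmin_coface F lev t s u ->
  lexmin_coface F lev t s u' -> u = u'.
Proof.
move=> [um su umin] [um' su' umin'].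
have sortC w : w \in maxsimps (F t) -> all [in mem (colim_vertices F)] (sort lev w).
  move=> /maxsimps_simps wF; rewrite all_sort; apply/allP => v.
  exact: simps_colim wF v.
have E : sort lev u = sort lev u'.
  by apply: (lexle_anti lev_wo); [exact: sortC|exact: sortC|exact: umin|exact: umin'].
by apply/fsetP => v; rewrite -(mem_sort lev u) E mem_sort.
Qed.

(** The complexes of a filtration of a total order are determined by their
    cardinals. Passing from size [m - 1] to size [m] is trivial unless some
    complex of the filtration has exactly [m] simplices, and then the
    lexicographic rule is applied with respect to that complex. *)
Definition lex_step (m : nat) (s : {fset V}) : {fset V} :=
  xget s [set u | exists2 r, csize r = m & lexmin_coface F lev r s u]%classic.

Definition lex_steps (a b : nat) (s : {fset V}) : {fset V} :=
  foldl (fun s m => lex_step m s) s (iota a.+1 (b - a)).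

Lemma lex_step_out m s : (forall r, csize r <> m) -> lex_step m s = s.
Proof. by move=> h; rewrite /lex_step xgetPN // => u [r /h]. Qed.

Lemma lex_step_in t s u : lexmin_coface F lev t s u -> lex_step (csize t) s = u.
Proof.
move=> su; rewrite /lex_step; case: xgetP => [w -> [r rt sw]|/(_ u)]; last first.
  by case; exists t.
apply: (lexmin_coface_unique _ su); move: sw.
by rewrite /lexmin_coface (eq_maxsimps (csize_simps rt)).
Qed.

Lemma lex_steps_cat a b c s : (a <= b)%N -> (b <= c)%N ->
  lex_steps b c (lex_steps a b s) = lex_steps a c s.
Proof.
move=> ab bc; rewrite /lex_steps -foldl_cat.
have -> : (b.+1 = a.+1 + (b - a))%N by rewrite addSn subnKC.
by rewrite -iotaD addnC addnBA // subnK.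
Qed.

Lemma lex_steps_out a b s : (forall r, (a < csize r <= b)%N -> False) ->
  lex_steps a b s = s.
Proof.
move=> h; rewrite /lex_steps.
have: all (fun m => (a < m <= b)%N) (iota a.+1 (b - a)).
  apply/allP => m; rewrite mem_iota => /andP[am]; rewrite am /=.
  case: (leqP a b) => ab; first by rewrite addSn subnKC.
  have -> : (b - a = 0)%N by apply/eqP; rewrite subn_eq0 ltnW.
  by rewrite addn0 ltnS leqNgt am.
elim: (iota _ _) => //= m l IH /andP[mab /IH h'].
by rewrite lex_step_out // => r rm; apply: (h r); rewrite rm.
Qed.

(** Between the sizes of [F t] and [F t'] no complex of the filtration has an
    intermediate size, so that only the last step acts. *)
Lemma cover_step_lex t t' s u : s \in maxsimps (F t) ->
  cover_step F lev (t, s) (t', u) ->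
  u = lex_steps (csize t) (csize t') s /\ u \in maxsimps (F t').
Proof.
move=> sm [[/= tt' hr] su]; split; last by case: su.
have := csize_mono tt'; rewrite leq_eqVlt => /orP[/eqP c|c].
  rewrite c /lex_steps subnn /=; apply/(lexmin_coface_max (t := t')) => //.
  by rewrite -(eq_maxsimps (csize_simps c)).
have cE : (csize t <= (csize t').-1)%N by rewrite -ltnS prednK // (leq_trans _ c).
rewrite -(lex_steps_cat s cE (leq_pred _)) (@lex_steps_out (csize t)); last first.
  move=> r /andP[rt rt'].
  have rlt : (csize r < csize t')%N.
    by apply: leq_ltn_trans rt' _; rewrite prednK // (leq_trans _ c).
  have [|/(congr1 (fun A => #|` A|))|/(congr1 (fun A => #|` A|))] := hr r.
  - apply/andP; split; rewrite leNgt; apply/negP => /ltW /csize_mono.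
      by rewrite leqNgt rt.
    by rewrite leqNgt rlt.
  - by rewrite -/(csize r) -/(csize t) => E; rewrite E ltnn in rt.
  - by rewrite -/(csize r) -/(csize t') => E; rewrite E ltnn in rlt.
rewrite /lex_steps prednK ?(leq_trans _ c) //.
have -> : (csize t' - (csize t').-1 = 1)%N.
  by case: (csize t') c => // n _; rewrite subSnn.
by rewrite /= (lex_step_in su).
Qed.

(** The steps compose to the same map whatever the path, which makes the cover
    map well defined and functorial. *)
Lemma cover_path_lex x y : x.2 \in maxsimps (F x.1) ->
  clos_refl_trans _ (cover_step F lev) x y ->
  [/\ (x.1 <= y.1)%O, y.2 = lex_steps (csize x.1) (csize y.1) x.2 &
      y.2 \in maxsimps (F y.1)].
Proof.
move=> + xy; elim: xy => {x y} [[t s] [t' u] xy sm|x xm|x y z _ h1 _ h2 xm].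
- have [uE um] := cover_step_lex sm xy; split=> //.
  by case: xy => -[].
- by split=> //; rewrite /lex_steps subnn.
- have [xy yE ym] := h1 xm; have [yz zE zm] := h2 ym; split=> //.
    exact: le_trans yz.
  by rewrite zE yE lex_steps_cat // csize_mono.
Qed.

(** An index whose complex differs from those at both ends splits the interval
    into two with fewer new simplices each. *)
Lemma exists_cover_path t t' s : (t <= t')%O -> s \in maxsimps (F t) ->
  exists u, clos_refl_trans _ (cover_step F lev) (t, s) (t', u).
Proof.
move=> tt'; move: {2}(csize t' - csize t)%N (leqnn (csize t' - csize t)) => n.
elim: n t t' tt' s => [|n IH] t t' tt' s.
  move=> c sm; have E : simps (F t) = simps (F t').
    by apply: csize_simps; apply/eqP; rewrite eqn_leq csize_mono //= -subn_eq0 -leqn0.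
  exists s; apply: rt_step; split=> /=; last first.
    by apply/lexmin_coface_max => //; rewrite -(eq_maxsimps E).
  split=> // r /andP[tr rt']; left; apply: csize_simps; apply/eqP.
  rewrite eqn_leq [(csize t <= _)%N]csize_mono // andbT.
  apply: leq_trans (csize_mono rt') _.
  by rewrite -subn_eq0 -leqn0.
have [|/existsNP[r]] := pselect (forall r, (t <= r <= t')%O ->
    simps (F r) = simps (F t) \/ simps (F r) = simps (F t')).
  move=> h c sm; have sF' : s \in simps (F t').
    exact: fsubsetP (fcplx_mono F tt') _ (maxsimps_simps sm).
  by have [u su] := exists_lexmin_coface sF'; exists u; apply: rt_step.
move=> /not_implyP[/andP[tr rt'] /not_orP[rt1 rt2]] c sm.
have c1 : (csize t < csize r)%N.
  rewrite ltn_neqAle csize_mono // andbT; apply/eqP => E; apply: rt1.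
  exact/csize_simps.
have c2 : (csize r < csize t')%N.
  rewrite ltn_neqAle csize_mono // andbT; apply/eqP => E; apply: rt2.
  exact/csize_simps.
have d1 : (csize r - csize t <= n)%N.
  by rewrite -ltnS; apply: leq_trans c; rewrite ltn_sub2r // (ltn_trans c1).
have d2 : (csize t' - csize r <= n)%N.
  by rewrite -ltnS; apply: leq_trans c; rewrite ltn_sub2l // (ltn_trans c1).
have [u su] := IH _ _ tr _ d1 sm.
have [_ _ /= um] := cover_path_lex (x := (t, s)) sm su.
have [w uw] := IH _ _ rt' _ d2 um.
by exists w; apply: rt_trans uw.
Qed.

Lemma cover_map_lex t t' s : (t <= t')%O -> s \in maxsimps (F t) ->
  cover_map F lev t t' s = lex_steps (csize t) (csize t') s /\
  cover_map F lev t t' s \in maxsimps (F t').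
Proof.
move=> tt' sm; have [u su] := exists_cover_path tt' sm.
rewrite /cover_map; case: xgetP => [w -> /= sw|/(_ u)/(_ su)//].
by have [] := cover_path_lex (x := (t, s)) sm sw.
Qed.

Lemma cover_map_maxsimps t t' s : (t <= t')%O -> s \in maxsimps (F t) ->
  cover_map F lev t t' s \in maxsimps (F t').
Proof. by move=> tt' /(cover_map_lex tt')[]. Qed.

Lemma cover_map_comp t t' t'' s : (t <= t')%O -> (t' <= t'')%O ->
  s \in maxsimps (F t) ->
  cover_map F lev t t'' s = cover_map F lev t' t'' (cover_map F lev t t' s).
Proof.
move=> h h' sm.
have [-> _] := cover_map_lex (le_trans h h') sm.
have [E um] := cover_map_lex h sm.
have [-> _] := cover_map_lex h' um.
by rewrite E lex_steps_cat // csize_mono.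
Qed.

Lemma sub_cover_path x y : clos_refl_trans _ (cover_step F lev) x y ->
  x.2 `<=` y.2.
Proof.
elim=> {x y} [x y [_ []]//|//|x y z _ xy _ yz]; exact: fsubset_trans yz.
Qed.

Lemma sub_cover_map t t' s : s `<=` cover_map F lev t t' s.
Proof. by rewrite /cover_map; case: xgetP => // u _ /sub_cover_path. Qed.

Lemma cover_map_id t t' s : (t <= t')%O -> s \in maxsimps (F t) ->
  s \in maxsimps (F t') -> cover_map F lev t t' s = s.
Proof.
move=> tt' sm sm'.
exact: maxsimps_max sm' (maxsimps_simps (cover_map_maxsimps tt' sm)) (sub_cover_map _ _ _).
Qed.

(** A flag that lies in all the subdivisions starts with a common face of the
    simplices in [S], and conversely a common face with [x.1] vertices is
    itself a flag with one member. *)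
Lemma nerve_simpsP (x : posnat^d *p T) (S : {fset {fset V}}) : reflect
  [/\ S `<=` maxsimps (F x.2), S != fset0 &
      exists2 u : {fset V}, ((x.1 : posnat) <= #|` u|)%N &
        forall s, s \in S -> u `<=` s]
  (S \in nerve_simps F x).
Proof.
case: x => -[k k0] t /=; rewrite !inE /= fpowersetE.
apply: (iffP and3P) => [[St S0 /asboolP[c Sc]]|[St S0 [u uk uS]]]; split=> //.
  have [s0 s0S] : exists s0, s0 \in S by apply/fset0Pn.
  have := Sc _ s0S; rewrite !inE => /andP[_ /andP[_ /hasP[u uc /andP[_ dimu]]]].
  exists u => [|s sS].
    have [|u1] := posnP #|` u|; last by move: dimu; rewrite /sdim -ltnS !prednK.
    have := Sc _ s0S; rewrite !inE fpowersetE => /andP[/fsubsetP/(_ _ uc) + _].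
    by rewrite !inE -cardfs_gt0 => /andP[_] + u0; rewrite u0.
  have := Sc _ sS; rewrite !inE fpowersetE => /andP[/fsubsetP/(_ _ uc) + _].
  by rewrite !inE fpowersetE => /andP[].
have u0 : u != fset0 by rewrite -cardfs_gt0 (leq_trans _ uk).
apply/asboolP; exists [fset u] => s sS.
rewrite !inE fpowersetE fsub1set !inE fpowersetE uS // u0 /=.
rewrite /is_flag -cardfs_gt0 cardfs1 /=; apply/andP; split.
  by apply/allP => a /fset1P ->; apply/allP => b /fset1P ->; rewrite fsubset_refl.
apply/hasP; exists u; first exact: fset11.
rewrite /sdim -!subn1 leq_sub2r // andbT.
by apply/allP => a /fset1P ->; exact: fsubset_refl.
Qed.

Lemma nerve_vertexP (x : posnat^d *p T) s : vertex (nerve_cplx F x) s ->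
  s \in maxsimps (F x.2).
Proof. by case/nerve_simpsP; rewrite fsub1set. Qed.

Lemma nerve_is_sfunctor : is_sfunctor (nerve_diagram F lev).
Proof.
split=> /= [p q /andP[h1 h2] S|p h s /nerve_vertexP sm|p q r /andP[_ h] /andP[_ h']].
- case/nerve_simpsP => Sm S0 [u uk uS]; apply/nerve_simpsP; split.
  + apply/fsubsetP => _ /imfsetP[s /= sS ->]; apply: cover_map_maxsimps => //.
    exact: fsubsetP Sm _ sS.
  + case/fset0Pn: S0 => s sS; apply/fset0Pn.
    by exists (cover_map F lev p.2 q.2 s); rewrite in_imfset.
  + exists u; first by apply: leq_trans uk; move: h1; rewrite leEdual.
    move=> _ /imfsetP[s /= sS ->].
    exact: fsubset_trans (uS _ sS) (sub_cover_map _ _ _).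
- exact: cover_map_id.
- move=> /andP[_ h''] s /nerve_vertexP sm; exact: cover_map_comp.
Qed.

End CoverMap.

(** * Critical grades of a finitely presented filtration *)

Section ChainCoefficients.
Local Open Scope fset_scope.
Local Open Scope ring_scope.
Context (K : fieldType) (V : choiceType) (W : scomplex V) (j : nat).

(** Chains as functions on all finite sets of vertices, zero off the
    [j]-simplices; this makes coefficients comparable along a filtration. *)
Definition ccoef (c : chains K W j) (s : {fset V}) : K :=
  if insub s is Some u then c u else 0.

Lemma ccoef_val (c : chains K W j) (u : dim_simps W j) : ccoef c (val u) = c u.
Proof. by rewrite /ccoef valK. Qed.

Lemma ccoef_neq0 c s : ccoef c s != 0 -> s \in dim_simps W j.
Proof. by rewrite /ccoef; case: insubP => //; rewrite eqxx. Qed.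

Lemma ccoef_linear a (c e : chains K W j) s :
  ccoef (a *: c + e) s = a * ccoef c s + ccoef e s.
Proof.
rewrite /ccoef; case: insubP => [u _ _|]; last by rewrite mulr0 addr0.
by rewrite !ffunE.
Qed.

Lemma ccoef0 s : ccoef 0 s = 0.
Proof. by rewrite /ccoef; case: insubP => // u _ _; rewrite ffunE. Qed.

Lemma ccoefZ a (c : chains K W j) s : ccoef (a *: c) s = a * ccoef c s.
Proof. by rewrite -[a *: c]addr0 ccoef_linear ccoef0 addr0. Qed.

Lemma ccoef_sum (J : Type) (r : seq J) (Q : pred J) (c : J -> chains K W j) s :
  ccoef (\sum_(i <- r | Q i) c i) s = \sum_(i <- r | Q i) ccoef (c i) s.
Proof.
elim/big_rec2: _ => [|i x y _ <-]; first exact: ccoef0.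
by rewrite -[c i in LHS]scale1r ccoef_linear mul1r.
Qed.

Lemma ccoef_ext (c e : chains K W j) :
  (forall s, s \in dim_simps W j -> ccoef c s = ccoef e s) -> c = e.
Proof.
by move=> ce; apply/ffunP => u; rewrite -!ccoef_val ce //; exact: valP.
Qed.

Definition cdelta (s : {fset V}) : chains K W j := [ffun u => (val u == s)%:R].

Lemma ccoef_delta s t : t \in dim_simps W j -> ccoef (cdelta s) t = (t == s)%:R.
Proof. by move=> tW; rewrite -[t]/(val [` tW]) ccoef_val ffunE. Qed.

Lemma dim_simpsE s : (s \in dim_simps W j) = (s \in simps W) && (#|` s| == j.+1).
Proof. by rewrite !inE. Qed.

End ChainCoefficients.

Section ChainMapCoefficients.
Local Open Scope fset_scope.
Local Open Scope ring_scope.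
Context (K : fieldType) (V V' : choiceType) (W : scomplex V) (W' : scomplex V').
Variable j : nat.

Lemma ccoef_chain_map (f : V -> V')
    (c : chains K W j) t : t \in dim_simps W' j ->
  ccoef (chain_map W' f c : chains K W' j) t =
  \sum_(u : dim_simps W j) c u * incidence K f j (val u) t.
Proof. by move=> tW; rewrite -[t]/(val [` tW]) ccoef_val ffunE. Qed.

Lemma ccoef_chain_map_delta (f : V -> V') s t :
  s \in dim_simps W j -> t \in dim_simps W' j ->
  ccoef (chain_map W' f (cdelta K W j s) : chains K W' j) t = incidence K f j s t.
Proof.
move=> sW tW; rewrite ccoef_chain_map // (bigD1 [` sW]) //= big1 => [|u us].
  by rewrite addr0 ffunE eqxx mul1r.
rewrite ffunE; case: eqP => [su|]; last by rewrite mul0r.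
by case/eqP: us; apply: val_inj.
Qed.

End ChainMapCoefficients.

Section CriticalGrades.
Local Open Scope fset_scope.
Local Open Scope ring_scope.
Context (K : fieldType) d (T : orderType d) (V : choiceType) (F : filtration T V).
Hypothesis Ffp : finitely_presented K (filtration_sfunctor F).

(** Inclusions carry a coefficient at [s] only from complexes that contain
    [s], so that each [s] occurs in a generator of the chain module whose
    grade is a critical grade. *)
Lemma critical_grades_dim j : exists A : {fset T}, forall q s,
  s \in simps (F q) -> #|` s| = j.+1 ->
  exists2 a, a \in A & (a <= q)%O /\ s \in simps (F a).
Proof.
have [F0 [_ [_ [e [[_ [S Sfin Sgen]] _ _ epi]]]]] := Ffp j.
pose A := fset_set ((fun z : {p : T & F0 p} => projT1 z) @` S)%classic.
have AE a : (a \in A) = (a \in (fun z : {p : T & F0 p} => projT1 z) @` S)%classic.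
  by rewrite in_fset_set //; exact: finite_image.
exists A => q s sF sj.
pose M := chain_module K (filtration_sfunctor F) j.
pose N p : set (F0 p) := [set y | forall s, ccoef (e p y : chains K (F p) j) s != 0 ->
  exists2 a, a \in A & (a <= p)%O /\ s \in simps (F a)]%classic.
have sFj : s \in dim_simps (F q) j by rewrite dim_simpsE sF sj eqxx.
have [y yE] := epi q (cdelta K (F q) j s).
suff /(_ s) : N q y.
  by apply; rewrite yE ccoef_delta // eqxx oner_eq0.
apply: Sgen => [|p x Spx u].
  split=> [p|p p' h x Nx u].
    split=> [u|a x x' Nx Nx' u]; first by rewrite linear0 ccoef0 eqxx.
    rewrite linearP ccoef_linear => h.
    have [xu|/Nx//] := eqVneq (ccoef (e p x : chains K (F p) j) u) 0.
    by apply: Nx'; apply: contra h => /eqP ->; rewrite xu mulr0 addr0.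
  move=> h0; have uF := ccoef_neq0 h0; move: h0.
  rewrite (pfun_natural e) ccoef_chain_map // => h0.
  have {h0} [v] : exists v : dim_simps (F p) j,
      (e p x : chains K (F p) j) v * incidence K id j (val v) u != 0.
    apply: contrapT => /forallNP h'; case/negP: h0; apply/eqP/big1 => v _.
    by have /negP/negPn/eqP := h' v.
  have [vF vj] := dim_simpsP v; move: uF; rewrite dim_simpsE => /andP[uF /eqP uj].
  rewrite incidence_id //; have [<-|_] := eqVneq (val v) u; last by rewrite mulr0 eqxx.
  rewrite mulr1 -ccoef_val => /Nx[a aA [ap va]]; exists a => //; split=> //.
  exact: le_trans h.
move=> /ccoef_neq0; rewrite dim_simpsE => /andP[uF _]; exists p => //.
by rewrite AE; apply/mem_set; exists (existT _ p x).
Qed.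

(** Only finitely many vertices occur, so that the dimensions are bounded and
    the critical grades of all dimensions can be collected in one finite set. *)
Lemma critical_grades : exists A : {fset T}, forall q s,
  s \in simps (F q) -> exists2 a, a \in A & (a <= q)%O /\ s \in simps (F a).
Proof.
have [A AP] := choice critical_grades_dim.
pose U := \bigcup_(a <- A 0%N) \bigcup_(s <- simps (F a)) s.
exists (\bigcup_(j <- iota 0 #|` U|) A j) => q s sF.
have s0 : (0 < #|` s|)%N by rewrite cardfs_gt0 (simps_neq0 sF).
have sU : s `<=` U.
  apply/fsubsetP => v vs; have vF : [fset v] \in simps (F q).
    by apply: simps_closed sF _ _; rewrite ?fsub1set // -cardfs_gt0 cardfs1.
  have [|a aA [aq va]] := AP 0%N q _ vF; first by rewrite cardfs1.
  apply/bigfcupP; exists a; rewrite ?aA //.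
  by apply/bigfcupP; exists [fset v]; rewrite ?va ?fset11.
have [|a aA [aq sa]] := AP (#|` s|.-1) q s sF; first by rewrite prednK.
exists a => //; apply/bigfcupP; exists (#|` s|.-1) => //.
by rewrite mem_iota /= add0n andbT prednK // fsubset_leq_card.
Qed.

End CriticalGrades.

Section Birth.
Local Open Scope fset_scope.
Context d (T : orderType d) (V : choiceType) (F : filtration T V).
Variable A : {fset T}.
Hypothesis critA : forall q s, s \in simps (F q) ->
  exists2 a, a \in A & (a <= q)%O /\ s \in simps (F a).

Lemma finite_colim : finite_set (colim F).
Proof.
apply: (@sub_finite_set _ _ [set` \bigcup_(a <- A) simps (F a)]) => //.
move=> s [q /critA[a aA [_ sa]]]; apply/bigfcupP; exists a => //.
by rewrite aA.
Qed.

(** The largest critical grade below [q] has this property, since every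
    simplex of [F q] is present at some critical grade below [q]. *)
Lemma critical_value q : simps (F q) != fset0 ->
  exists2 a, a \in A & (a <= q)%O /\ simps (F a) = simps (F q).
Proof.
case/fset0Pn => s0 /critA[a0 a0A [a0q _]].
have [[a aA] /= aq amax] : exists2 a : A, (val a <= q)%O &
    forall b : A, (val b <= q)%O -> (val b <= val a)%O.
  case: (@arg_maxP _ _ A [` a0A] (fun a => val a <= q)%O (fun a => val a) a0q).
  by move=> a aq amax; exists a.
exists a => //; split=> //; apply/eqP; rewrite eqEfsubset fcplx_mono //=.
apply/fsubsetP => s /critA[b bA [bq sb]].
exact: fsubsetP (fcplx_mono F (amax [` bA] bq)) _ sb.
Qed.

(** The property only depends on the complex, and thus holds first at [p] or
    at a critical grade. *)
Lemma exists_first_from (Q : T -> Prop) (p q : T) :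
  (forall t t', simps (F t) = simps (F t') -> Q t -> Q t') ->
  (forall t, Q t -> simps (F t) != fset0) ->
  (p <= q)%O -> Q q -> exists r, [/\ (p <= r)%O, Q r &
    forall t, (p <= t)%O -> Q t -> (r <= t)%O].
Proof.
move=> QF Q0 pq Qq.
have crit t : (p <= t)%O -> Q t ->
    exists2 a, a \in p |` A & [/\ (p <= a)%O, (a <= t)%O & Q a].
  move=> pt Qt; have [a aA [at' aE]] := critical_value (Q0 t Qt).
  have [pa|/ltW ap] := leP p a.
    by exists a; rewrite ?in_fset1U ?aA ?orbT //; split=> //; apply: QF Qt.
  exists p; rewrite ?fset1U1 //; split=> //; apply: QF Qt; apply/eqP.
  by rewrite eqEfsubset (fcplx_mono _ pt) andbT -aE fcplx_mono.
have [a0 a0A [pa0 _ Qa0]] := crit q pq Qq.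
pose R (a : p |` A) := `[< (p <= val a)%O /\ Q (val a) >].
have Ra0 : R [` a0A] by apply/asboolP.
case: (@arg_minP _ _ (p |` A) [` a0A] R (fun a => val a) Ra0) => a /asboolP[pa Qa] amin.
exists (val a); split=> // t pt Qt.
have [b bA [pb bt Qb]] := crit t pt Qt.
by apply: le_trans bt; apply: (amin [` bA]); apply/asboolP.
Qed.

(** All indices with a nonempty complex lie above the least critical grade. *)
Lemma exists_first (Q : T -> Prop) (q : T) :
  (forall t t', simps (F t) = simps (F t') -> Q t -> Q t') ->
  (forall t, Q t -> simps (F t) != fset0) ->
  Q q -> exists2 r, Q r & forall t, Q t -> (r <= t)%O.
Proof.
move=> QF Q0 Qq; have [a0 a0A [a0q _]] := critical_value (Q0 q Qq).
case: (@arg_minP _ _ A [` a0A] predT (fun a => val a) isT) => a _ amin.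
have low t : Q t -> (val a <= t)%O.
  move=> Qt; have [b bA [bt _]] := critical_value (Q0 t Qt).
  exact: le_trans (amin [` bA] isT) bt.
have [r [_ Qr rmin]] := exists_first_from QF Q0 (low q Qq) Qq.
by exists r => // t Qt; apply: rmin => //; exact: low.
Qed.

End Birth.

(** * Chain modules of the skeleta of the nerve *)

Lemma skel_simpsE (V : choiceType) k (W : scomplex V) (s : {fset V}) :
  (s \in skel_simps k W) = (s \in simps W) && (sdim s <= k)%N.
Proof. by rewrite !inE. Qed.

Section NerveSize.
Local Open Scope fset_scope.
Local Open Scope ring_scope.
Context (K : fieldType) d (T : orderType d) (V : choiceType) (F : filtration T V).
Variables (lev : rel V) (A : {fset T}).
Hypothesis lev_wo : wo_chain lev (mem (colim_vertices F)).
Hypothesis critA : forall q s, s \in simps (F q) ->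
  exists2 a, a \in A & (a <= q)%O /\ s \in simps (F a).
Variable k : nat.

(** The intersection of the members of [S], cut out of their union because
    there is no finite set of all vertices; it is empty for the empty [S]. *)
Definition common_face (S : {fset {fset V}}) : {fset V} :=
  [fset v in \bigcup_(s <- S) s | all (fun s : {fset V} => v \in s) S].

Lemma sub_common_face (S : {fset {fset V}}) u : S != fset0 ->
  (u `<=` common_face S) = all (fun s => u `<=` s) S.
Proof.
move=> /fset0Pn[s0 s0S]; apply/fsubsetP/allP => [uS s sS|uS v vu].
  by apply/fsubsetP => v /uS; rewrite !inE => /andP[_ /allP]; apply.
rewrite !inE; apply/andP; split.
  by apply/bigfcupP; exists s0; rewrite ?s0S //; exact: fsubsetP (uS _ s0S) _ vu.
by apply/allP => s /uS /fsubsetP; exact.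
Qed.

Lemma nerve_simps_common_face (x : posnat^d *p T) (S : {fset {fset V}}) :
  (S \in nerve_simps F x) =
  [&& S `<=` maxsimps (F x.2), S != fset0 & ((x.1 : posnat) <= #|` common_face S|)%N].
Proof.
apply/nerve_simpsP/and3P => [[Sm S0 [u uk uS]]|[Sm S0 Sk]]; split=> //.
  apply: leq_trans uk (fsubset_leq_card _); rewrite sub_common_face //.
  exact/allP.
exists (common_face S) => // s sS.
by have := fsubset_refl (common_face S); rewrite sub_common_face // => /allP; apply.
Qed.

Lemma finite_comaximal_sets : finite_set (comaximal_sets F k).
Proof.
apply: (@sub_finite_set _ _ [set` fpowerset (fset_set (colim F))]) => //.
move=> S [_ _ Sc _] /=; rewrite fpowersetE; apply/fsubsetP => s sS.
rewrite in_fset_set; last exact: finite_colim critA.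
by apply/mem_set/Sc.
Qed.

Definition comaximal_dim (j : nat) : {fset {fset {fset V}}} :=
  [fset S in fset_set (comaximal_sets F k) |
    (#|` S| == j.+1) && (0 < #|` common_face S|)%N].

Lemma comaximal_dimP j (S : {fset {fset V}}) : reflect
  [/\ #|` S| = j.+1, (j <= k)%N, (0 < #|` common_face S|)%N &
      exists t, S `<=` maxsimps (F t)] (S \in comaximal_dim j).
Proof.
rewrite /comaximal_dim !inE in_fset_set; last exact: finite_comaximal_sets.
apply: (iffP and3P) => [[/set_mem[_ Sk _ Sm] /eqP Sj Sc]|[Sj jk Sc [t Sm]]].
  by split=> //; rewrite -ltnS -Sj.
split; [|by apply/eqP|by []]; apply/mem_set; split.
- by rewrite -cardfs_gt0 Sj.
- by rewrite Sj ltnS.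
- by move=> s sS; exists t; apply: maxsimps_simps; exact: fsubsetP Sm _ sS.
- by exists t.
Qed.

Section Dimension.
Variable j : nat.
Local Notation X := (comaximal_dim j).
Implicit Types x y : X.

Let Xcard x : #|` val x| = j.+1.
Proof. by have /comaximal_dimP[] := valP x. Qed.

Let X0 x : val x != fset0.
Proof. by rewrite -cardfs_gt0 Xcard. Qed.

Lemma exists_comax_birth x : exists2 r, val x `<=` maxsimps (F r) &
  forall t, val x `<=` maxsimps (F t) -> (r <= t)%O.
Proof.
have /comaximal_dimP[_ _ _ [t tm]] := valP x.
apply: (exists_first critA (Q := fun t => val x `<=` maxsimps (F t))) tm.
  by move=> t1 t2 /eq_maxsimps ->.
move=> t1 /fsubsetP xt1; have /fset0Pn[s /xt1/maxsimps_simps st] := X0 x.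
by apply/fset0Pn; exists s.
Qed.

Definition comax_birth x : T := projT1 (cid2 (exists_comax_birth x)).

Lemma comax_birth_max x : val x `<=` maxsimps (F (comax_birth x)).
Proof. by rewrite /comax_birth; case: cid2. Qed.

Lemma comax_birth_min x t : val x `<=` maxsimps (F t) -> (comax_birth x <= t)%O.
Proof. by rewrite /comax_birth; case: cid2 => b /= _; apply. Qed.

Definition comax_dies x : bool :=
  `[< exists2 t, (comax_birth x <= t)%O & ~~ (val x `<=` maxsimps (F t)) >].

Lemma exists_comax_death x : exists r, comax_dies x ->
  [/\ (comax_birth x <= r)%O, ~~ (val x `<=` maxsimps (F r)) &
    forall t, (comax_birth x <= t)%O -> ~~ (val x `<=` maxsimps (F t)) -> (r <= t)%O].
Proof.
have [/asboolP[q xq qm]|_] := boolP (comax_dies x); last by exists (comax_birth x).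
have ne t : (comax_birth x <= t)%O -> simps (F t) != fset0.
  move=> xt; have /fset0Pn[s sx] := X0 x.
  have sF := maxsimps_simps (fsubsetP (comax_birth_max x) _ sx).
  by apply/fset0Pn; exists s; exact: fsubsetP (fcplx_mono F xt) _ sF.
have [||||r [br [_ rm] rmin]] := @exists_first_from _ _ _ _ _ critA
    (fun t => simps (F t) != fset0 /\ ~~ (val x `<=` maxsimps (F t))) (comax_birth x) q.
- by move=> t1 t2 E [h1 h2]; rewrite -E -(eq_maxsimps E).
- by move=> t [].
- exact: xq.
- by split=> //; exact: ne.
by exists r => _; split=> // t xt tm; apply: rmin => //; split=> //; exact: ne.
Qed.

Definition comax_death x : T := projT1 (cid (exists_comax_death x)).

Lemma comax_deathP x : comax_dies x ->
  [/\ (comax_birth x <= comax_death x)%O, ~~ (val x `<=` maxsimps (F (comax_death x))) &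
    forall t, (comax_birth x <= t)%O -> ~~ (val x `<=` maxsimps (F t)) ->
      (comax_death x <= t)%O].
Proof. by rewrite /comax_death; case: cid. Qed.

(** Once a simplex is properly contained in another one it is never maximal
    again, so that a set of maximal simplices does not come back. *)
Lemma comax_alive x t : (val x `<=` maxsimps (F t)) =
  (comax_birth x <= t)%O && ~~ (comax_dies x && (comax_death x <= t)%O).
Proof.
apply/idP/andP => [xt|[bt]]; last first.
  apply: contraNT => xt; have dx : comax_dies x by apply/asboolP; exists t.
  by rewrite dx; have [_ _] := comax_deathP dx; apply.
split; first exact: comax_birth_min.
apply/negP => /andP[/comax_deathP[bd xd _] dt]; case/negP: xd.
apply/fsubsetP => s sx; apply/maxsimpsP.
have sb := maxsimps_simps (fsubsetP (comax_birth_max x) _ sx).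
split=> [|u ud su]; first exact: fsubsetP (fcplx_mono F bd) _ sb.
apply: maxsimps_max (fsubsetP xt _ sx) _ su.
exact: fsubsetP (fcplx_mono F dt) _ ud.
Qed.

Fact common_face_pos x : (0 < #|` common_face (val x)|)%N.
Proof. by have /comaximal_dimP[] := valP x. Qed.

Definition birth_grade x : posnat^d *p T := (PosNat (common_face_pos x), comax_birth x).
Definition death_grade x : posnat^d *p T := (PosNat (common_face_pos x), comax_death x).

Lemma le_grade (p q : posnat^d *p T) :
  (p <= q)%O = ((q.1 : posnat) <= (p.1 : posnat))%N && (p.2 <= q.2)%O.
Proof. by []. Qed.

Local Notation G := (skeleton k (SFunctor (nerve_is_sfunctor lev_wo))).
Local Notation M := (chain_module K G j).

Let alive (p : posnat^d *p T) x := (birth_grade x <= p)%O &&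
  ~~ ((x \in [set x | comax_dies x]) && (death_grade x <= p)%O).

Lemma aliveE p x : alive p x = (val x \in dim_simps (scplx G p) j).
Proof.
rewrite /alive inE !le_grade /= dim_simpsE Xcard eqxx andbT.
rewrite skel_simpsE /sdim Xcard /=; have /comaximal_dimP[_ -> _ _] := valP x.
rewrite andbT nerve_simps_common_face X0 comax_alive /=.
by case: (_ <= _)%N; rewrite /= ?andbT ?andbF.
Qed.

Lemma dim_simps_alive p t : t \in dim_simps (scplx G p) j ->
  exists2 x, alive p x & val x = t.
Proof.
move=> tG; have tX : t \in X.
  move: tG; rewrite dim_simpsE skel_simpsE => /andP[/andP[+ +] /eqP tj].
  rewrite /sdim tj => + jk; rewrite -[simps _]/(nerve_simps F p).
  rewrite nerve_simps_common_face => /and3P[tm _ tc].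
  apply/comaximal_dimP; split=> //; last by exists p.2.
  by apply: leq_trans tc; exact: valP.
by exists [` tX]; rewrite ?aliveE.
Qed.

Definition comax_gen x : M (birth_grade x) := cdelta K (scplx G (birth_grade x)) j (val x).

Lemma birth_alive x : alive (birth_grade x) x.
Proof.
rewrite /alive lexx inE le_grade leqnn /=.
by have := comax_birth_max x; rewrite comax_alive => /andP[].
Qed.

Lemma pact_comax_gen p x : alive p x ->
  pact p (comax_gen x) = cdelta K (scplx G p) j (val x).
Proof.
move=> px; have /andP[h _] := px; rewrite (pactE h).
move: (px) (birth_alive x); rewrite !aliveE => xp xb.
apply: ccoef_ext => t tG; rewrite ccoef_delta // ccoef_chain_map_delta // eq_sym.
rewrite incidence_id ?Xcard //; first by move: tG; rewrite dim_simpsE => /andP[_ /eqP].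
move=> s sx; apply: cover_map_id => //; first by case/andP: h.
  exact: fsubsetP (comax_birth_max x) _ sx.
move: xp; rewrite dim_simpsE => /andP[xp _].
move: xp; rewrite skel_simpsE -[simps _]/(nerve_simps F p) => /andP[].
by rewrite nerve_simps_common_face => /and3P[/fsubsetP xm _ _] _; exact: xm.
Qed.

Lemma ccoef_comax_sum p (c : X -> K) y : alive p y ->
  ccoef (\sum_(x | alive p x) c x *: pact p (comax_gen x) : chains K (scplx G p) j) (val y)
  = c y.
Proof.
move=> py; rewrite ccoef_sum (bigD1 y) //= big1 => [|x /andP[px xy]].
  by rewrite addr0 ccoefZ pact_comax_gen // ccoef_delta -?aliveE // eqxx mulr1.
rewrite ccoefZ pact_comax_gen // ccoef_delta -?aliveE //.
by rewrite (inj_eq val_inj) eq_sym (negbTE xy) mulr0.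
Qed.

Definition comax_incidence x y : K :=
  incidence K (cover_map F lev (comax_birth x) (comax_death x)) j (val x) (val y).

(** At the death of [x] some member [s] of it is replaced by a larger simplex.
    That simplex was absent as long as [s] was maximal, so that the image [y]
    of [x] is born later than [x]. *)
Lemma comax_incidence_neq0 x y : comax_dies x -> comax_incidence x y != 0 ->
  alive (death_grade x) y /\ (csize F (comax_birth x) < csize F (comax_birth y))%N.
Proof.
move=> dx h; have [bd xd _] := comax_deathP dx.
set f := cover_map F lev (comax_birth x) (comax_death x).
have yE : f @` val x = val y.
  apply/eqP; apply: contraNT h => yE.
  by rewrite /comax_incidence -/f incidence0 ?Xcard.
have fm s : s \in val x -> f s \in maxsimps (F (comax_death x)).
  by move=> sx; apply: cover_map_maxsimps => //; exact: fsubsetP (comax_birth_max x) _ sx.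
have ym : val y `<=` maxsimps (F (comax_death x)).
  by rewrite -yE; apply/fsubsetP => _ /imfsetP[s /= sx ->]; exact: fm.
split.
  rewrite aliveE dim_simpsE Xcard eqxx andbT skel_simpsE /sdim Xcard /=.
  have /comaximal_dimP[_ -> _ _] := valP y; rewrite andbT.
  rewrite nerve_simps_common_face X0 ym /=; apply: fsubset_leq_card.
  rewrite (sub_common_face _ (X0 y)) -yE; apply/allP => _ /imfsetP[s /= sx ->].
  apply: fsubset_trans (sub_cover_map _ _ _ _ _).
  have := fsubset_refl (common_face (val x)).
  by rewrite sub_common_face // => /allP; apply.
have /fsubsetPn[s sx sd] := xd; rewrite ltnNge; apply/negP => /csize_le /fsubsetP bb.
have fsy : f s \in val y by rewrite -yE in_imfset.
have fsF := bb _ (maxsimps_simps (fsubsetP (comax_birth_max y) _ fsy)).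
have fss := maxsimps_max (fsubsetP (comax_birth_max x) _ sx) fsF (sub_cover_map _ _ _ _ _).
by have := fm _ sx; rewrite fss (negbTE sd).
Qed.

(** The chain module in degree [j] is generated by the [j]-simplices of the
    nerve at the grade where they first occur. Such a simplex dies when one of
    its vertices stops being a maximal simplex, and then it equals its image
    under the cover map, up to sign, or zero if the image is degenerate. *)
Lemma comax_presentation :
  is_presentation [set: X]%SET [set x | comax_dies x]%SET death_grade
    (fun x y => (y == x)%:R - comax_incidence x y) comax_gen.
Proof.
apply: (basis_presentation (r := fun x => csize F (comax_birth x))).
- by move=> x; rewrite inE => /comax_deathP[bd _ _]; rewrite le_grade leqnn.
- move=> x y; rewrite inE => dx /(comax_incidence_neq0 dx)[ay cxy].
  by split=> //; case/andP: ay.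
- move=> x; rewrite inE => dx; have [bd _ _] := comax_deathP dx.
  have h : (birth_grade x <= death_grade x)%O by rewrite le_grade leqnn.
  rewrite (pactE h); apply: ccoef_ext => t tG.
  rewrite ccoef_chain_map_delta //; last by have := birth_alive x; rewrite aliveE.
  have [y ay yt] := dim_simps_alive tG; rewrite -yt.
  rewrite -[LHS]/(comax_incidence x y) -(ccoef_comax_sum (comax_incidence x) ay).
  congr (ccoef _ _).
  rewrite big_mkcond; apply: eq_bigr => z _.
  have [->|/(comax_incidence_neq0 dx)[-> _] //] := eqVneq (comax_incidence x z) 0.
  by rewrite scale0r; case: ifP.
- move=> p c; exists (fun y => ccoef (c : chains K (scplx G p) j) (val y)).
  apply: ccoef_ext => t tG; have [y ay <-] := dim_simps_alive tG.
  by rewrite ccoef_comax_sum.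
- move=> p c c0 y ay; rewrite -(ccoef_comax_sum c ay) c0; exact: ccoef0.
Qed.

End Dimension.

(** A set of simplices has only one cardinality, and so is counted for at most
    one [j]. *)
Lemma sum_comaximal_dim n : (\sum_(j < n) #|` comaximal_dim j| <= m_num F k)%N.
Proof.
rewrite /m_num; set C := fset_set _.
have Cj j : (#|` comaximal_dim j| <= \sum_(S <- C) (#|` S| == j.+1))%N.
  rewrite -big_mkcond /= sum1_count -size_filter; apply: uniq_leq_size => [|S].
    exact: fset_uniq.
  rewrite mem_filter -/C !inE => /and3P[-> -> _] //.
apply: (@leq_trans (\sum_(j < n) \sum_(S <- C) (#|` S| == j.+1))%N).
  by apply: leq_sum => j _; exact: Cj.
rewrite exchange_big /= -[leqRHS]sum1_size; apply: leq_sum => S _.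
elim: n => [|n IH]; first by rewrite big_ord0.
rewrite big_ord_recr /=; case: eqP => [E|_]; last by rewrite addn0.
rewrite big1 ?add0n // => i _; rewrite E eqSS eq_sym ltn_eqF //.
Qed.

(** Each generator corresponds to a comaximal set, and each relation between
    vertices to a single maximal simplex; both numbers are at most [m_num F
    k]. *)
Theorem nerve_skeleton_size :
  exists n, has_size K (skeleton k (SFunctor (nerve_is_sfunctor lev_wo))) n /\
    (n <= 2 * m_num F k)%N.
Proof.
have pr j := @comax_presentation j.
have bj j : exists b, (b <= #|` comaximal_dim j|)%N /\
    betti (chain_module K (skeleton k (SFunctor (nerve_is_sfunctor lev_wo))) j) 0 b.
  have [b [_ [hb _ bb _]]] := pres_betti (pr j).
  by exists b; split=> //; apply: leq_trans hb _; rewrite cardsT cardfE.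
have [b bP] := choice bj.
have [_ [b1 [_ hb1 _ bb1]]] := pres_betti (pr 0%N).
have b1le : (b1 <= #|` comaximal_dim 0|)%N.
  apply: leq_trans hb1 _; rewrite cardfE; exact: max_card.
exists (b1 + \sum_(j < k.+1) b j)%N; split.
  split=> [j|]; first exact: pres_finitely_presented (pr j).
  exists b1, b, k.+1; split=> //; first by move=> j; case: (bP j).
  move=> j kj; apply/eqP; rewrite -leqn0; have [hb _] := bP j; apply: leq_trans hb _.
  rewrite leqn0 cardfs_eq0; apply/eqP/fsetP => S; rewrite in_fset0.
  by apply/comaximal_dimP => -[_ jk]; rewrite leqNgt kj in jk.
rewrite mul2n -addnn leq_add //.
  apply: leq_trans b1le _; apply: leq_trans (sum_comaximal_dim 1).
  by rewrite big_ord1.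
by apply: leq_trans (sum_comaximal_dim k.+1); apply: leq_sum => j _; case: (bP j).
Qed.

End NerveSize.

(** * Continuity, points of realizations and clopen sets *)

Section RealContinuity.
Local Open Scope ring_scope.
Context (R : realType) (X : topologicalType).
Implicit Types f g : X -> R.

Lemma cont_cst (c : R) : continuous (fun _ : X => c).
Proof. by move=> x; exact: cvg_cst. Qed.

Lemma cont_add f g : continuous f -> continuous g -> continuous (fun x => f x + g x).
Proof. by move=> cf cg x; apply: (@continuousD R R^o X f g x (cf x) (cg x)). Qed.

Lemma cont_mul f g : continuous f -> continuous g -> continuous (fun x => f x * g x).
Proof. by move=> cf cg x; apply: (@continuousM R X f g x (cf x) (cg x)). Qed.

Lemma cont_sub f g : continuous f -> continuous g -> continuous (fun x => f x - g x).
Proof. by move=> cf cg x; apply: (@continuousB R R^o X f g x (cf x) (cg x)). Qed.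

Lemma cont_max f g : continuous f -> continuous g ->
  continuous (fun x => Num.max (f x) (g x)).
Proof. by move=> cf cg x; apply: (@continuous_max R X f g x (cf x) (cg x)). Qed.

Lemma cont_min f g : continuous f -> continuous g ->
  continuous (fun x => Num.min (f x) (g x)).
Proof. by move=> cf cg x; apply: (@continuous_min R X f g x (cf x) (cg x)). Qed.

Lemma cont_inv f : (forall x, f x != 0) -> continuous f -> continuous (fun x => (f x)^-1).
Proof. by move=> f0 cf x; apply: (@continuousV R X f x (f0 x) (cf x)). Qed.

Lemma cont_sum (I : Type) (r : seq I) (Q : pred I) (f : I -> X -> R) :
  (forall i, Q i -> continuous (f i)) -> continuous (fun x => \sum_(i <- r | Q i) f i x).
Proof.
move=> cf; elim: r => [|i r IH].
  under eq_fun do rewrite big_nil; exact: cont_cst.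
under eq_fun do rewrite big_cons.
by case: (boolP (Q i)) => // Qi; apply: cont_add => //; exact: cf.
Qed.

Lemma cont_prod (I : Type) (r : seq I) (Q : pred I) (f : I -> X -> R) :
  (forall i, Q i -> continuous (f i)) -> continuous (fun x => \prod_(i <- r | Q i) f i x).
Proof.
move=> cf; elim: r => [|i r IH].
  under eq_fun do rewrite big_nil; exact: cont_cst.
under eq_fun do rewrite big_cons.
by case: (boolP (Q i)) => // Qi; apply: cont_mul => //; exact: cf.
Qed.

End RealContinuity.

Lemma cont_pair (X Y Z : topologicalType) (f : X -> Y) (g : X -> Z) :
  continuous f -> continuous g -> continuous (fun x => (f x, g x)).
Proof.
move=> cf cg x.
exact: (@cvg_pair X Y Z (nbhs x) (nbhs (f x)) (nbhs (g x)) _ _ _ f g (cf x) (cg x)).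
Qed.

Section Clamp.
Local Open Scope ring_scope.
Context (R : realType).

(** Homotopies are given by formulas in the clamped parameter, which makes
    them continuous on the whole line. *)
Definition clamp (t : R) : R := Num.min 1 (Num.max 0 t).

Lemma clamp_ge0 t : 0 <= clamp t.
Proof. by rewrite /clamp le_min ler01 le_max lexx. Qed.

Lemma clamp_le1 t : clamp t <= 1.
Proof. by rewrite /clamp ge_min lexx. Qed.

Lemma clamp_below t : t <= 0 -> clamp t = 0.
Proof. by move=> t0; rewrite /clamp (max_idPl t0) (min_idPr ler01). Qed.

Lemma clamp_above t : 1 <= t -> clamp t = 1.
Proof.
by move=> t1; rewrite /clamp (max_idPr (le_trans ler01 t1)) (min_idPl t1).
Qed.

Lemma cont_clamp (X : topologicalType) (f : X -> R) :
  continuous f -> continuous (fun x => clamp (f x)).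
Proof.
move=> cf; apply: cont_min; first exact: cont_cst.
by apply: cont_max => //; exact: cont_cst.
Qed.

End Clamp.

Section RealizationPoints.
Local Open Scope fset_scope.
Local Open Scope ring_scope.
Context (R : realType) (V : choiceType) (W : scomplex V).

Definition coord (x : realization R W) (v : V) : R := (set_val x : V -> R) v.

Lemma coordP (x : realization R W) : bary_coords W (coord x).
Proof. exact: set_valP. Qed.

Lemma coord_ge0 (x : realization R W) v : 0 <= coord x v.
Proof. by have [s _ [h _ _]] := coordP x. Qed.

Lemma coord_inj (x y : realization R W) : (forall v, coord x v = coord y v) -> x = y.
Proof. exact: realization_ext. Qed.

Definition mk_point (c : V -> R) (h : bary_coords W c) : realization R W :=
  exist _ (c : {ptws V -> R}) (mem_set h).

Lemma coord_mk c (h : bary_coords W c) v : coord (mk_point h) v = c v.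
Proof. by []. Qed.

Lemma cont_coord v : continuous (fun x : realization R W => coord x v).
Proof.
move=> x; apply: (@continuous_comp _ _ _ (set_val : realization R W -> {ptws V -> R})
  (fun y : {ptws V -> R} => y v)).
  exact: initial_continuous.
exact: (@proj_continuous _ (fun _ : V => R : topologicalType) v).
Qed.

(** The realization carries the topology of pointwise convergence of
    coordinates. *)
Lemma continuous_realization (X : topologicalType) (f : X -> realization R W) :
  (forall v, continuous (fun x => coord (f x) v)) -> continuous f.
Proof.
move=> cf; apply: (@continuous_comp_initial _ _ _ set_val f).
move=> x; apply/cvg_sup => w; move: x; apply/(@continuousP _ (initial_topology (@^~ w))).
move=> A [B oB <-]; rewrite -comp_preimage.
by apply: open_comp => // + _; exact: cf.
Qed.

Lemma coord_out (x : realization R W) v : v \notin vertices W -> coord x v = 0.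
Proof. exact: realization_out. Qed.

(** The support of a point is the simplex whose interior contains it. *)
Definition supp (x : realization R W) : {fset V} := [fset v in vertices W | coord x v != 0].

Lemma mem_supp x v : (v \in supp x) = (coord x v != 0).
Proof.
rewrite !inE /=; case: (boolP (v \in vertices W)) => //= /(coord_out x) ->.
by rewrite eqxx.
Qed.

Lemma supp_gt0 x v : (v \in supp x) = (0 < coord x v).
Proof. by rewrite mem_supp lt_neqAle coord_ge0 andbT eq_sym. Qed.

Lemma supp_simps x : supp x \in simps W.
Proof.
have [s sW [x0 xs x1]] := coordP x; apply: (simps_closed sW).
  apply/fsubsetP => v; rewrite mem_supp; apply: contraNT => vs; exact/eqP/xs.
apply/fset0Pn; apply: contrapT => /forallNP h.
have : \sum_(v <- s) coord x v = 0.
  by apply: big1 => v _; apply/eqP/negPn/negP; rewrite -mem_supp; exact: h.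
by move/eqP; rewrite x1 oner_eq0.
Qed.

Lemma supp_neq0 x : supp x != fset0.
Proof. exact: simps_neq0 (supp_simps x). Qed.

Lemma bary_coordsP (c : V -> R) (s : {fset V}) : s \in simps W ->
  (forall v, 0 <= c v) -> (forall v, c v != 0 -> v \in s) ->
  \sum_(v <- s) c v = 1 -> bary_coords W c.
Proof.
by move=> sW c0 cs c1; exists s => //; split=> // v vs; apply/eqP; apply: contraNT vs => /cs.
Qed.

Lemma sum_coord (r : seq V) x : uniq r -> {subset supp x <= r} ->
  \sum_(v <- r) coord x v = 1.
Proof.
move=> ur sr; have [s sW [x0 xs x1]] := coordP x.
have red (q : seq V) : uniq q -> {subset supp x <= q} ->
    \sum_(v <- q) coord x v = \sum_(v <- supp x) coord x v.
  move=> uq sq; rewrite (bigID (fun v => v \in supp x)) /= [X in _ + X]big1 ?addr0.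
    rewrite -big_filter; apply: perm_big; apply: uniq_perm.
    - exact: filter_uniq.
    - exact: fset_uniq.
    by move=> v; rewrite mem_filter; case: (boolP (v \in supp x)) => // /sq ->.
  by move=> v; rewrite mem_supp negbK => /eqP.
rewrite red // -x1 (red (enum_fset s)) ?fset_uniq //.
by move=> v; rewrite mem_supp; apply: contraNT => /xs ->; rewrite eqxx.
Qed.

(** Barycentric coordinates can thus be specified up to a common positive
    factor. *)
Definition normalize (r : seq V) (c : V -> R) (v : V) : R := c v / \sum_(u <- r) c u.

Lemma bary_normalize (s : {fset V}) (r : seq V) (c : V -> R) : s \in simps W ->
  uniq r -> {subset s <= r} -> (forall v, 0 <= c v) ->
  (forall v, c v != 0 -> v \in s) -> 0 < \sum_(u <- r) c u ->
  bary_coords W (normalize r c).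
Proof.
move=> sW ur sr c0 cs cp; apply: (bary_coordsP sW).
- by move=> v; rewrite divr_ge0 // ltW.
- by move=> v; rewrite mulf_eq0 negb_or => /andP[/cs].
rewrite -mulr_suml [X in X / _](_ : _ = \sum_(u <- r) c u) ?divff ?gt_eqF //.
rewrite [RHS](bigID (fun v => v \in s)) /= [X in _ + X]big1 ?addr0.
  rewrite -[RHS]big_filter; apply: perm_big; apply: uniq_perm.
  - exact: fset_uniq.
  - exact: filter_uniq.
  by move=> v; rewrite mem_filter; case: (boolP (v \in s)) => // /sr ->.
by move=> v; apply: contraNeq; exact: cs.
Qed.

Fact bary_mix (s : {fset V}) (x y : realization R W) (t : R) : s \in simps W ->
  supp x `<=` s -> supp y `<=` s -> 0 <= t <= 1 ->
  bary_coords W (fun v => (1 - t) * coord x v + t * coord y v).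
Proof.
move=> sW xs ys /andP[t0 t1]; apply: (bary_coordsP sW).
- by move=> v; rewrite addr_ge0 // mulr_ge0 ?coord_ge0 // subr_ge0.
- move=> v; apply: contraNT => vs.
  have -> : coord x v = 0.
    by apply/eqP/negPn; rewrite -mem_supp; apply: contra vs; exact: fsubsetP.
  have -> : coord y v = 0.
    by apply/eqP/negPn; rewrite -mem_supp; apply: contra vs; exact: fsubsetP.
  by rewrite !mulr0 addr0.
rewrite big_split -!mulr_sumr /= !sum_coord ?fset_uniq //.
- by rewrite !mulr1 subrK.
- exact/fsubsetP.
- exact/fsubsetP.
Qed.

Fact bary_vertex v : vertex W v -> bary_coords W (fun u => (u == v)%:R : R).
Proof.
move=> vW; apply: (bary_coordsP vW) => [u|u|]; first by rewrite ler0n.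
  by case: (eqVneq u v) => [->|]; rewrite ?fset11 ?eqxx.
by rewrite big_seq_fset1 eqxx.
Qed.

Definition vertex_point v (vW : vertex W v) : realization R W := mk_point (bary_vertex vW).

Lemma coord_vertex v (vW : vertex W v) u : coord (vertex_point vW) u = (u == v)%:R.
Proof. by []. Qed.

Lemma supp_vertex v (vW : vertex W v) : supp (vertex_point vW) = [fset v].
Proof.
apply/fsetP => u; rewrite mem_supp coord_vertex in_fset1.
by have [_|_] := eqVneq u v; rewrite ?eqxx ?oner_eq0.
Qed.

End RealizationPoints.

Section Clopen.
Local Open Scope ring_scope.
Local Open Scope classical_set_scope.
Context (R : realType).

(** The track of [x] under the homotopy is connected. *)
Lemma homotopic_clopen (X Y : topologicalType) (f g : X -> Y) (U : set Y) x :
  homotopic R f g -> clopen U -> U (f x) <-> U (g x).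
Proof.
move=> [H [cH H0 H1]] [oU cU].
pose I : set R := `[0, 1].
have conn : connected I by apply/connected_intervalP; exact: interval_is_interval.
pose B := [set t | I t /\ U (H (x, t))].
have pairc : continuous (fun t : R => (x, t)).
  by apply: cont_pair => t; [exact: cvg_cst|exact: cvg_id].
have BE (O : set (X * R)) : O `&` ([set: X] `*` I) = H @^-1` U `&` ([set: X] `*` I) ->
    forall t, I t -> O (x, t) <-> U (H (x, t)).
  move=> OE t It.
  have e : (O `&` ([set: X] `*` I)) (x, t) <-> (H @^-1` U `&` ([set: X] `*` I)) (x, t).
    by rewrite OE.
  by split=> h; [have [] := e.1 (conj h (conj Logic.I It))|have [] := e.2 (conj h (conj Logic.I It))].
have oB : exists2 C, open C & B = I `&` C.
  have /continuousP/(_ U oU)/open_subspaceP[O oO OE] := cH.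
  exists ((fun t : R => (x, t)) @^-1` O); first by apply: open_comp => // t _; exact: pairc.
  by apply/seteqP; split=> t /= [It Ut]; split=> //; apply/(BE O OE t It).
have cB : exists2 C, closed C & B = I `&` C.
  have /continuous_closedP/(_ U cU)/closed_subspaceP[O oO OE] := cH.
  exists ((fun t : R => (x, t)) @^-1` O).
    by apply: preimage_closed => // t _; exact: pairc.
  by apply/seteqP; split=> t /= [It Ut]; split=> //; apply/(BE O OE t It).
have I0 : I 0 by rewrite /I /= in_itv /= lexx ler01.
have I1 : I 1 by rewrite /I /= in_itv /= lexx ler01.
rewrite -H0 -H1; split=> h.
  have BI : B = I by apply: conn => //; exists 0.
  by have [] : B 1 by rewrite BI.
have BI : B = I by apply: conn => //; exists 1.
by have [] : B 0 by rewrite BI.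
Qed.

Lemma homotopic_of (X Y : topologicalType) (f g : X -> Y) (H : X * R -> Y) :
  continuous H -> (forall x, H (x, 0) = f x) -> (forall x, H (x, 1) = g x) ->
  homotopic R f g.
Proof. by move=> cH H0 H1; exists H; split=> //; exact: continuous_subspaceT. Qed.

(** A point is joined to any vertex of its support by a segment. *)
Lemma clopen_vertex (V : choiceType) (W : scomplex V) (U : set (realization R W)) x :
  clopen U -> U x -> exists v (vW : vertex W v), U (vertex_point R vW).
Proof.
move=> cU Ux; have /fset0Pn[v vx] := supp_neq0 x.
have vW : vertex W v.
  by apply: simps_closed (supp_simps x) _ _; rewrite ?fsub1set // -cardfs_gt0 cardfs1.
exists v, vW.
have cl01 (t : R) : 0 <= clamp t <= 1 by rewrite clamp_ge0 clamp_le1.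
have vs : (supp (vertex_point R vW) `<=` supp x)%fset by rewrite supp_vertex fsub1set.
pose H (z : realization R W * R) : realization R W :=
  mk_point (bary_mix (supp_simps x) (fsubset_refl _) vs (cl01 z.2)).
have hom : homotopic R (fun _ : realization R W => x) (fun _ => vertex_point R vW).
  apply: (homotopic_of (H := H)).
  - apply: continuous_realization => u; apply: cont_add; apply: cont_mul.
    + apply: cont_sub; first exact: cont_cst.
      by apply: cont_clamp => z; exact: cvg_snd.
    + exact: cont_cst.
    + by apply: cont_clamp => z; exact: cvg_snd.
    + exact: cont_cst.
  - move=> z; apply: coord_inj => u.
    by rewrite coord_mk /= clamp_below // subr0 mul1r mul0r addr0.
  - move=> z; apply: coord_inj => u.
    by rewrite coord_mk /= clamp_above // subrr mul1r mul0r add0r.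
exact: (homotopic_clopen x hom cU).1 Ux.
Qed.

End Clopen.

(** * The lower bound *)

Section Separated.
Local Open Scope ring_scope.
Local Open Scope classical_set_scope.
Context (R : realType) d (P : porderType d).

(** Independent generators of the persistent [pi_0] in the grades [g i]: for
    each [i] clopen pieces that are nonempty in grade [g i] and that no point
    of a strictly smaller grade reaches. Unlike components, clopen sets can be pulled back
    along any continuous map. *)
Definition separates (G : tfunctor P) (I : Type) (g : I -> P)
    (U : forall p, I -> set (G p)) : Prop :=
  [/\ forall p i, clopen (U p i),
      forall p i i' x, U p i x -> U p i' x -> i = i',
      forall i, U (g i) i !=set0 &
      forall p q (h : (p <= q)%O) i x, p != q -> ~ U q i (tmap h x)].

Definition separated (G : tfunctor P) (I : Type) (g : I -> P) : Prop :=
  exists U, separates (G := G) g U.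

(** Pieces are pulled back along [f], or along homotopy inverses of its
    components. The latter are natural only up to homotopy, which clopen sets
    do not distinguish. *)
Lemma separated_ohe (G G' : tfunctor P) (I : Type) (g : I -> P) :
  objectwise_homotopy_equivalence R G G' -> separated G g <-> separated G' g.
Proof.
move=> [f [fnat fhe]]; split=> [|[U [cU dU nU oU]]]; last first.
  exists (fun p i => f p @^-1` U p i); split.
  - by move=> p i; apply: preimage_clopen => //; case: (fhe p).
  - by move=> p i i' x; exact: dU.
  - move=> i; have [x Ux] := nU i; have [_ [k [_ _ fk]]] := fhe (g i).
    by exists (k x); exact: (homotopic_clopen x fk (cU _ _)).2 Ux.
  - by move=> p q h i x pq; rewrite /= fnat; exact: oU.
move=> [U [cU dU nU oU]].
pose k p := projT1 (cid (fhe p).2).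
have kP p : [/\ continuous (k p), homotopic R (k p \o f p) id & homotopic R (f p \o k p) id].
  by rewrite /k; case: cid.
exists (fun p i => k p @^-1` U p i); split.
- by move=> p i; apply: preimage_clopen => //; case: (kP p).
- by move=> p i i' x; exact: dU.
- move=> i; have [x Ux] := nU i; have [_ kf _] := kP (g i).
  by exists (f _ x); exact: (homotopic_clopen x kf (cU _ _)).2 Ux.
move=> p q h i x pq Ux.
have [ck kf _] := kP q; have [_ _ fk] := kP p.
have cV : clopen ((tmap h) @^-1` (k q @^-1` U q i)).
  apply: preimage_clopen; last exact: tmap_continuous.
  exact: preimage_clopen.
have /= := (homotopic_clopen x fk cV).2 Ux.
rewrite -fnat => /(homotopic_clopen (tmap h (k p x)) kf (cU _ _)).1.
exact: oU.
Qed.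

Lemma separated_weakly_equivalent (G G' : tfunctor P) (I : Type) (g : I -> P) :
  weakly_equivalent R G G' -> separated G g <-> separated G' g.
Proof.
elim=> {G G'} [G G'|G|G G' _ IH|G1 G2 G3 _ IH1 _ IH2] //.
- exact: separated_ohe.
- by rewrite IH.
- by rewrite IH1.
Qed.

End Separated.

Section LowerBound.
Local Open Scope fset_scope.
Local Open Scope ring_scope.
Context (R : realType) (K : fieldType) d (P : porderType d) (G : sfunctor P).
Variables (I : finType) (g : I -> P) (U : forall p, I -> set (realization_functor R G p)).
Hypothesis sepU : separates (G := realization_functor R G) g U.
Local Notation M := (chain_module K (skeleton 0 G) 0).
Local Notation W p := (scplx (skeleton 0 G) p).

Definition in_piece p i (s : {fset svert G p}) : bool :=
  `[< exists v (vW : vertex (scplx G p) v), s = [fset v] /\ U i (vertex_point R vW) >].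

(** A functional that vanishes on all chains from smaller grades, and
    therefore detects generators of grade [g i]. *)
Definition piece_sum p (c : M p) (i : I) : K :=
  if g i == p then \sum_(u : dim_simps (W p) 0) (c : chains K (W p) 0) u * (in_piece i (val u))%:R
  else 0.

Lemma piece_sum_linear p a (c e : M p) i :
  piece_sum (a *: c + e) i = a * piece_sum c i + piece_sum e i.
Proof.
rewrite /piece_sum; case: ifP => _; last by rewrite mulr0 addr0.
rewrite mulr_sumr -big_split; apply: eq_bigr => u _ /=.
by rewrite !ffunE mulrDl /GRing.scale /= mulrA.
Qed.

Lemma piece_sum0 p i : piece_sum (0 : M p) i = 0.
Proof. by have := piece_sum_linear (-1) (0 : M p) 0 i; rewrite scaler0 addr0 mulN1r addNr. Qed.

Lemma dim0_vertex p s : s \in dim_simps (W p) 0 -> exists2 v, vertex (scplx G p) v & s = [fset v].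
Proof.
rewrite dim_simpsE skel_simpsE => /andP[/andP[sG _] /cardfs1P[v sv]].
by exists v; rewrite // /vertex -sv.
Qed.

Lemma piece_sum_map p q (h : (p <= q)%O) (c : M p) i : p != q ->
  piece_sum (pmod_map M h c) i = 0.
Proof.
move=> pq; rewrite /piece_sum; case: eqP => // _; apply: big1 => u _.
have [_ _ _ oU] := sepU.
case: (boolP (in_piece i (val u))) => [/asboolP[w [wW [uw Uw]]]|]; last by rewrite mulr0.
rewrite mulr1 /= ffunE; apply: big1 => t _; apply/eqP; rewrite mulf_eq0; apply/orP; right.
have [tG t1] := dim_simpsP t; have [uG u1] := dim_simpsP u.
apply: contraT => h0.
have tu : smap h @` val t = val u.
  by apply/eqP; apply: contraNT h0 => ne; rewrite incidence0.
have [v vG tv] := dim0_vertex (valP t).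
exfalso; apply: (oU _ _ h i (vertex_point R vG) pq).
suff -> : tmap (t := realization_functor R G) h (vertex_point R vG) = vertex_point R wW by [].
apply: coord_inj => z; rewrite coord_vertex.
rewrite [LHS](realization_mapE h (vertex_point R vG)).
have vV : v \in vertices (scplx G p).
  by apply: (@vertexE _ _ [fset v]); rewrite ?fset11.
have wE : smap h v = w.
  by apply/fset1P; rewrite -uw -tu tv in_imfset //= fset11.
rewrite big_mkcond (bigD1_seq v) //= ?fset_uniq // big1 => [|y yv].
  by rewrite addr0 -[set_val _ _]/(coord (vertex_point R vG) v) coord_vertex eqxx wE eq_sym; case: eqP.
rewrite -[set_val _ _]/(coord (vertex_point R vG) y) coord_vertex (negbTE yv).
by case: ifP.
Qed.

(** If fewer than [#|I|] elements generated, some linear combination of the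
    piece sums would vanish on all generators, hence identically; but each
    piece contains a vertex. *)
Lemma generators_lower_bound (F0 : pmodule K P) (e : pmorphism F0 M)
    (S : set {p : P & F0 p}) n :
  pepi e -> generates S -> (S #= `I_n)%card -> (#|I| <= n)%N.
Proof.
move=> epi gen Sn.
have [z zP] : exists z : 'I_n -> {p : P & F0 p}, forall y, S y -> exists i, z i = y.
  have /card_eqP[f] : (`I_n #= S)%card by rewrite card_eq_sym.
  pose idx (i : 'I_n) : set_type `I_n%classic :=
    exist _ (i : nat) (@mem_set _ `I_n%classic (i : nat) (ltn_ord i)).
  exists (fun i => set_val (f (idx i))) => y Sy.
  have [w _ fw] := @surj _ _ _ _ f (exist _ y (mem_set Sy)) Logic.I.
  exists (Ordinal (set_valP w)).
  by rewrite (_ : idx _ = w) ?fw //; apply: val_inj.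
pose L : 'M[K]_(n, #|I|) :=
  \matrix_(a, b) piece_sum (e (projT1 (z a)) (projT2 (z a))) (enum_val b).
rewrite -[#|I|](_ : \rank L = _); first exact: rank_leq_row.
apply/eqP; rewrite -[_ == _]/(row_full L) -cokermx_eq0.
apply/eqP/matrixP => b0 a; rewrite [RHS]mxE.
(* A column of the cokernel of [L] is a linear relation between the piece sums
   that holds on all generators. *)
pose w b := cokermx L b a.
have Nall : forall p (x : F0 p), \sum_b piece_sum (e p x) (enum_val b) * w b = 0.
  apply: (gen (fun p => [set x | \sum_b piece_sum (e p x) (enum_val b) * w b = 0]%classic)).
    split=> [p|p q h x /= x0].
      split=> [/=|k x1 x2 /= h1 h2].
        by rewrite linear0; apply: big1 => b _; rewrite piece_sum0 mul0r.
      rewrite linearP; under eq_bigr do rewrite piece_sum_linear mulrDl -mulrA.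
      by rewrite big_split -mulr_sumr /= h1 h2 mulr0 addr0.
    have [pq|pq] := eqVneq p q.
      subst q; by rewrite pmod_map_id.
    by apply: big1 => b _; rewrite pfun_natural piece_sum_map ?mul0r.
  move=> p x /zP[i zi] /=.
  have /matrixP/(_ i a) := mulmx_coker L; rewrite !mxE => L0; rewrite -[RHS]L0.
  by apply: eq_bigr => b _; rewrite mxE /w zi.
have [cU dU nU _] := sepU.
pose i0 := enum_val b0; have [x0 Ux0] := nU i0.
have [v [vG Uv]] := clopen_vertex (cU _ _) Ux0.
have vW : [fset v] \in dim_simps (W (g i0)) 0.
  by rewrite dim_simpsE skel_simpsE cardfs1 eqxx andbT /sdim cardfs1 andbT.
have [y yE] := epi (g i0) (cdelta K (W (g i0)) 0 [fset v]).
have := Nall _ y; rewrite yE (bigD1 b0) //= big1 => [|b bb0].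
  rewrite addr0 /piece_sum eqxx (bigD1 [` vW]) //= big1 => [|u uv].
    rewrite addr0 ffunE eqxx mul1r.
    have -> : in_piece i0 [fset v] by apply/asboolP; exists v, vG.
    by rewrite mul1r.
  by rewrite ffunE; case: eqP => [E|]; rewrite ?mul0r //; case/eqP: uv; apply: val_inj.
rewrite /piece_sum; case: eqP => [E|]; last by rewrite mul0r.
rewrite big1 ?mul0r // => u _; rewrite ffunE; case: eqP => [->|]; last by rewrite mul0r.
rewrite mul1r; case: (boolP (in_piece _ _)) => // /asboolP[v' [vG' [vv Uv']]].
case/eqP: bb0.
apply: enum_val_inj; have vE := fset1_inj vv; subst v'.
by rewrite (bool_irrelevance vG' vG) in Uv'; exact: dU Uv' Uv.
Qed.

End LowerBound.

Section Subdivision.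
Local Open Scope fset_scope.
Context (V : choiceType) (W : scomplex V).

(** The smallest member of a flag bounds the sizes of all its members from
    below. *)
Lemma subdiv_simpsP (k : nat) (c : {fset {fset V}}) : (0 < k)%N -> reflect
  [/\ c != fset0, forall u, u \in c -> u \in simps W /\ (k <= #|` u|)%N &
      forall u v, u \in c -> v \in c -> (u `<=` v) || (v `<=` u)]
  (c \in subdiv_simps W k).
Proof.
move=> k0; rewrite !inE fpowersetE; apply: (iffP and3P) => [[cW flagc minc]|[c0 cW cc]].
  have /andP[c0 /allP cmp] := flagc.
  split=> // [u uc|u v uc vc]; last by have /allP := cmp _ uc; apply.
  have uW := fsubsetP cW _ uc; split=> //.
  have /hasP[m mc /andP[/allP mmin mk]] := minc.
  have m0 : (0 < #|` m|)%N by rewrite cardfs_gt0 (simps_neq0 (fsubsetP cW _ mc)).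
  apply: leq_trans (fsubset_leq_card (mmin _ uc)).
  by move: mk; rewrite /sdim -ltnS !prednK.
have flagc : is_flag c.
  by rewrite /is_flag c0; apply/allP => u uc; apply/allP => v vc; exact: cc.
split=> //; first by apply/fsubsetP => u /cW[].
have [m mc mmin] := flag_min flagc; apply/hasP; exists m => //; rewrite mmin /=.
by have [_ mk] := cW _ mc; rewrite /sdim -!subn1 leq_sub2r.
Qed.

Lemma subdiv_vertexE (k : nat) u : (0 < k)%N ->
  vertex (subdiv W k) u = (u \in simps W) && (k <= #|` u|)%N.
Proof.
move=> k0; apply/(subdiv_simpsP _ k0)/andP => [[_ h _]|[uW uk]].
  by have [] := h u (fset11 _).
split=> [|v /fset1P ->|v w /fset1P -> /fset1P ->] //; last by rewrite fsubset_refl.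
by rewrite -cardfs_gt0 cardfs1.
Qed.

End Subdivision.

Lemma posnat_gt0 (k : posnat) : (0 < k)%N.
Proof. exact: valP k. Qed.

Section SubdivisionSeparated.
Local Open Scope fset_scope.
Local Open Scope ring_scope.
Context (R : realType) d (T : orderType d) (V : choiceType) (F : filtration T V).
Variables (A : {fset T}).
Hypothesis critA : forall q s, s \in simps (F q) ->
  exists2 a, a \in A & (a <= q)%O /\ s \in simps (F a).
Local Notation X := (comaximal_dim F 0 0).
Implicit Types x : X.

Lemma comax0E x : val x = [fset common_face (val x)].
Proof.
have /(comaximal_dimP critA)[/eqP/cardfs1P[s ->] _ _ _] := valP x.
congr [fset _]; apply/eqP; rewrite eqEfsubset; apply/andP; split.
  rewrite sub_common_face; last by rewrite -cardfs_gt0 cardfs1.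
  by apply/allP => u /fset1P ->; rewrite fsubset_refl.
have := fsubset_refl (common_face [fset s]).
rewrite sub_common_face; last by rewrite -cardfs_gt0 cardfs1.
by move=> /allP; apply; rewrite fset11.
Qed.

Lemma comax0_max x t : (val x `<=` maxsimps (F t)) = (common_face (val x) \in maxsimps (F t)).
Proof. by rewrite [X in X `<=` _]comax0E fsub1set. Qed.

Definition birth_piece (p : posnat^d *p T) x : set (realization_functor R (filtration_sfunctor (SF F)) p) :=
  [set y | p = birth_grade critA x /\ 0 < coord y (common_face (val x))]%classic.

(** A member of a flag through a maximal simplex lies below it, and no proper
    face of it has enough vertices at this level. *)
Lemma birth_piece_isolated x p (y : realization R (SF F p)) :
  p.1 = (birth_grade critA x).1 -> common_face (val x) \in maxsimps (F p.2) ->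
  0 < coord y (common_face (val x)) -> supp y = [fset common_face (val x)].
Proof.
move=> p1 sm; rewrite -supp_gt0 => sy.
have /(subdiv_simpsP _ _ (posnat_gt0 _))[_ yW ycmp] := supp_simps y.
apply/fsetP => u; rewrite in_fset1; apply/idP/eqP => [uy|-> //].
have [uF uk] := yW _ uy; have /orP[us|su] := ycmp _ _ uy sy; last first.
  exact: maxsimps_max sm uF su.
by apply/eqP; rewrite eqEfcard us; move: uk; rewrite p1.
Qed.

(** If the vertex of [s] is present at an index below the grade of birth of
    [s], the level there cannot exceed the size of [s], and [s] is maximal
    there because it is still maximal later, so that the index is the birth
    itself. *)
Lemma subdivision_separated :
  separated (realization_functor R (filtration_sfunctor (SF F))) (birth_grade critA (k := 0) (j := 0)).
Proof.
have smax x : common_face (val x) \in maxsimps (F (birth_grade critA x).2).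
  by rewrite -comax0_max; exact: comax_birth_max.
exists birth_piece; split.
- move=> p x; have [pE|pE] := pselect (p = birth_grade critA x); last first.
    rewrite (_ : birth_piece x = set0); first by split; [exact: open0|exact: closed0].
    by apply/seteqP; split=> // y [].
  split.
    rewrite (_ : birth_piece x = (fun y => coord y (common_face (val x))) @^-1` [set r | 0 < r])%classic.
      apply: open_comp; last exact: open_gt.
      by move=> y _; exact: cont_coord.
    by apply/seteqP; split=> y /= => [[]|].
  (* The piece is a single vertex, so that the condition [0 < _] defining it can
     be replaced by a closed one. *)
  rewrite (_ : birth_piece x = (fun y => coord y (common_face (val x))) @^-1` [set r | 1 <= r])%classic.
    apply: preimage_closed; last exact: closed_ge.
    by move=> y _; exact: cont_coord.
  apply/seteqP; split=> y /=; last by move=> y1; split=> //; exact: lt_le_trans y1.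
  move=> [_ y0]; subst p; have sE := birth_piece_isolated erefl (smax x) y0.
  have := sum_coord (x := y) (fset_uniq (supp y)) (fun _ => id).
  by rewrite sE big_seq_fset1 => ->.
- move=> p x x' y [pE y0] [_ y0']; apply: val_inj; rewrite comax0E [RHS]comax0E.
  subst p; have sE := birth_piece_isolated erefl (smax x) y0.
  congr [fset _]; apply/eqP; rewrite eq_sym -in_fset1 -sE supp_gt0 //.
- move=> x.
  have vx : vertex (SF F (birth_grade critA x)) (common_face (val x)).
    rewrite subdiv_vertexE; last exact: posnat_gt0.
    by rewrite (maxsimps_simps (smax x)) /=.
  exists (vertex_point R vx); split=> //.
  by rewrite coord_vertex eqxx ltr01.
move=> p q h x y pq [qE]; subst q.
have -> : coord (tmap h y) (common_face (val x)) = coord y (common_face (val x)).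
  rewrite [LHS](realization_mapE h y) /=.
  have [sV|sV] := boolP (common_face (val x) \in vertices (SF F p)).
    by rewrite -big_filter filter_pred1_uniq ?fset_uniq // big_seq1.
  rewrite coord_out // big_seq_cond big1 // => v /andP[vW /eqP vE].
  by rewrite -vE vW in sV.
move=> y0.
have sy : common_face (val x) \in supp y by rewrite supp_gt0.
have /(subdiv_simpsP _ _ (posnat_gt0 _))[_ yW ycmp] := supp_simps y.
have [sF sk] := yW _ sy.
have /andP[h1 h2] := h.
case/eqP: pq; case: p h y y0 sy yW ycmp sF sk h1 h2 => p1 p2 /= h y y0 sy yW ycmp sF sk h1 h2.
congr pair.
  by apply: val_inj; apply/eqP; rewrite eqn_leq sk.
apply/eqP; rewrite eq_le h2 /=; apply: (comax_birth_min critA).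
rewrite comax0_max; apply/maxsimpsP; split=> // u uF su.
exact: maxsimps_max (smax x) (fsubsetP (fcplx_mono F h2) _ uF) su.
Qed.

(** The generators of a minimal resolution generate the module of vertices of
    the model. *)
Theorem model_size_lower_bound (K : fieldType) (G : sfunctor (posnat^d *p T)) n :
  simplicial_model R G (realization_functor R (filtration_sfunctor (SF F))) ->
  has_size K (skeleton 0 G) n -> (m_num F 0 <= n)%N.
Proof.
move=> model; have [U sepU] := (@separated_weakly_equivalent _ _ _ _ _ _
  (birth_grade critA (k := 0) (j := 0)) model).2 subdivision_separated.
move=> [_ [b1 [b [m [_ bP b0 ->]]]]].
have [C [[[_ _ [e [_ epi]]] _] [S [[gen _] Sn]]]] := bP 0%N.
have := generators_lower_bound sepU epi gen Sn; rewrite -cardfE => Xb.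
have mX : (m_num F 0 <= #|` X|)%N.
  apply: fsubset_leq_card; apply/fsubsetP => S'.
  rewrite in_fset_set; last exact: finite_comaximal_sets critA _.
  move=> /set_mem[S0 S1 Sc [t St]]; apply/(comaximal_dimP critA); split=> //.
  - by apply/eqP; rewrite eqn_leq S1 cardfs_gt0.
  - have /cardfs1P[s sE] : #|` S'| == 1%N by rewrite eqn_leq S1 cardfs_gt0.
    have sF : s \in simps (F t) by apply: maxsimps_simps; apply: (fsubsetP St); rewrite sE fset11.
    apply: leq_trans (_ : 0 < #|` s|)%N (fsubset_leq_card _).
      by rewrite cardfs_gt0 (simps_neq0 sF).
    rewrite sub_common_face // sE; apply/allP => u /fset1P ->; exact: fsubset_refl.
  - by exists t.
apply: leq_trans mX (leq_trans Xb _); apply: leq_trans (leq_addl _ _).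
have [m0|m0] := posnP m; last by case: m m0 b0 => // m _ _; rewrite big_ord_recl leq_addr.
by rewrite b0 // m0.
Qed.

End SubdivisionSeparated.

(** * Barycentric comparison of the subdivision with the nerve *)

Lemma in_fset_pred (U : choiceType) (A : {fset U}) (Q : pred U) a :
  (a \in [fset b in A | Q b]%fset) = (a \in A) && Q a.
Proof. by rewrite !inE. Qed.

Section Comparison.
Local Open Scope fset_scope.
Local Open Scope ring_scope.
Context (R : realType) d (T : orderType d) (V : choiceType) (F : filtration T V).
Variable p : posnat^d *p T.
Local Notation E := (simps (F p.2)).
Local Notation Sigma := (maxsimps (F p.2)).
Local Notation k := (p.1 : posnat).
Implicit Types (x y z h : {fset V} -> R) (u v w s : {fset V}) (S Y : {fset {fset V}}).

Definition cofaces u : {fset {fset V}} := [fset s in Sigma | u `<=` s].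

Lemma mem_cofaces u s : (s \in cofaces u) = (s \in Sigma) && (u `<=` s).
Proof. by rewrite in_fset_pred. Qed.

(** The closure operator of the Galois connection between faces and sets of
    maximal simplices. *)
Definition hull u : {fset V} := common_face (cofaces u).

Lemma cofaces_neq0 u : u \in E -> cofaces u != fset0.
Proof.
by move=> /exists_maxsimps[s sm us]; apply/fset0Pn; exists s; rewrite mem_cofaces sm.
Qed.

Lemma cofaces_anti u v : u `<=` v -> cofaces v `<=` cofaces u.
Proof.
move=> uv; apply/fsubsetP => s; rewrite !mem_cofaces => /andP[->] /=.
exact: fsubset_trans.
Qed.

Lemma sub_common_face_anti S S' : S != fset0 -> S `<=` S' ->
  common_face S' `<=` common_face S.
Proof.
move=> S0 SS'; have S'0 : S' != fset0.
  by case/fset0Pn: S0 => s /(fsubsetP SS') sS'; apply/fset0Pn; exists s.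
rewrite sub_common_face //; apply/allP => s /(fsubsetP SS').
by have := fsubset_refl (common_face S'); rewrite sub_common_face // => /allP; apply.
Qed.

Lemma common_face_sub S s : s \in S -> common_face S `<=` s.
Proof.
move=> sS; have S0 : S != fset0 by apply/fset0Pn; exists s.
by have := fsubset_refl (common_face S); rewrite sub_common_face // => /allP; apply.
Qed.

Lemma sub_hull u : u \in E -> u `<=` hull u.
Proof.
move=> uE; rewrite sub_common_face ?cofaces_neq0 //; apply/allP => s.
by rewrite mem_cofaces => /andP[].
Qed.

Lemma hull_mono u v : v \in E -> u `<=` v -> hull u `<=` hull v.
Proof. by move=> vE uv; apply: sub_common_face_anti; [exact: cofaces_neq0|exact: cofaces_anti]. Qed.

Lemma common_face_simps S u : S `<=` Sigma -> S != fset0 -> u \in E ->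
  u `<=` common_face S -> common_face S \in E.
Proof.
move=> SS /fset0Pn[s sS] uE uS; apply: simps_closed (maxsimps_simps (fsubsetP SS _ sS)) _ _.
  exact: common_face_sub.
case/fset0Pn: (simps_neq0 uE) => v vu; apply/fset0Pn; exists v.
exact: fsubsetP uS _ vu.
Qed.

Lemma cofaces_sub u : cofaces u `<=` Sigma.
Proof. by apply/fsubsetP => s; rewrite mem_cofaces => /andP[]. Qed.

Lemma hull_simps u : u \in E -> hull u \in E.
Proof.
by move=> uE; exact: common_face_simps (cofaces_sub u) (cofaces_neq0 uE) uE (sub_hull uE).
Qed.

(** Weights on the faces of a simplex of the nerve: [weight y S] is positive
    exactly if the vertices in [S] have positive coordinates, larger than all
    others, so that the sets of positive weight form a chain, as in the
    barycentric subdivision. *)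
Definition weight y S : R :=
  \prod_(s <- S) (y s * \prod_(s' <- Sigma `\` S) Num.max 0 (y s - y s')).

Lemma weight_ge0 y S : (forall s, 0 <= y s) -> 0 <= weight y S.
Proof.
move=> y0; apply: prodr_ge0 => s _; apply: mulr_ge0 => //.
by apply: prodr_ge0 => s' _; rewrite le_max lexx.
Qed.

Lemma weight_neq0P y S : (forall s, 0 <= y s) -> reflect
  (forall s, s \in S -> 0 < y s /\ forall s', s' \in Sigma -> s' \notin S -> y s' < y s)
  (weight y S != 0).
Proof.
move=> y0; rewrite /weight prodf_seq_neq0; apply: (iffP allP) => [h s sS|h s sS /=].
  have := h s sS; rewrite /= mulf_eq0 negb_or => /andP[ys].
  rewrite prodf_seq_neq0 => /allP h'; split=> [|s' s'S s'n].
    by rewrite lt_neqAle eq_sym ys y0.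
  have := h' s'; rewrite in_fsetD s'n s'S => /(_ isT) /=; apply: contraR.
  by rewrite -leNgt => le; apply/eqP/max_idPl; rewrite subr_le0.
have [ys h'] := h s sS; apply: mulf_neq0; first by rewrite gt_eqF.
rewrite prodf_seq_neq0.
apply/allP => s'; rewrite in_fsetD /= => /andP[s'n s'S].
by rewrite gt_eqF // lt_max subr_gt0 h' ?orbT.
Qed.

(** The map from the barycentric subdivision of the nerve to the order complex
    of faces that sends a set of maximal simplices to its common face. *)
Definition nerve_push y u : R :=
  \sum_(S <- fpowerset Sigma | (S != fset0) && (common_face S == u)) weight y S.

Lemma nerve_push_ge0 y u : (forall s, 0 <= y s) -> 0 <= nerve_push y u.
Proof. by move=> y0; apply: sumr_ge0 => S _; exact: weight_ge0. Qed.

Lemma nerve_push_neq0 y u : nerve_push y u != 0 -> exists S,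
  [/\ S `<=` Sigma, S != fset0, u = common_face S & weight y S != 0].
Proof.
move=> h; apply: contrapT => h'; case/negP: h; apply/eqP.
rewrite /nerve_push big_seq_cond; apply: big1 => S /and3P[].
rewrite fpowersetE => SS S0 /eqP Su; apply/eqP; apply: contrapT => /negP wS.
by apply: h'; exists S.
Qed.

Lemma weight_le_push y S : (forall s, 0 <= y s) -> S `<=` Sigma -> S != fset0 ->
  weight y S <= nerve_push y (common_face S).
Proof.
move=> y0 SS S0; rewrite /nerve_push big_mkcond (big_rem S) ?fpowersetE //= S0 eqxx.
rewrite lerDl; apply: sumr_ge0 => S' _; case: ifP => // _; exact: weight_ge0.
Qed.

(** [h] can be normalized to a point of the subdivision, whose support contains
    a common face of all the simplices in [Y]. *)
Definition admissible h Y : Prop := exists c w,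
  [/\ c \in subdiv_simps (F p.2) k, forall u, 0 <= h u, forall u, h u != 0 -> u \in c,
      0 < h w & forall s, s \in Y -> w `<=` s].

Lemma subdiv_sub c : c \in subdiv_simps (F p.2) k -> {subset c <= E}.
Proof. by case/(subdiv_simpsP _ _ (posnat_gt0 _)) => _ h _ u /h[]. Qed.

Lemma admissible_sum_gt0 h Y : admissible h Y -> 0 < \sum_(u <- E) h u.
Proof.
move=> [c [w [cW h0 hc hw _]]].
have wE : w \in E by apply: subdiv_sub cW _ _; apply: hc; rewrite gt_eqF.
rewrite (big_rem w) //=; apply: ltr_pwDl => //; exact: sumr_ge0.
Qed.

Lemma admissible_bary h Y : admissible h Y -> bary_coords (SF F p) (normalize E h).
Proof.
move=> ad; have s0 := admissible_sum_gt0 ad; case: ad => c [w [cW h0 hc hw _]].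
exact: (@bary_normalize R _ (SF F p) c E h cW (fset_uniq _) (subdiv_sub cW) h0 hc s0).
Qed.

(** Sets of positive weight form a chain, and the largest of them is the
    support [Z] of [z], whose common face lies in all simplices in [Y]. *)
Lemma admissible_push z Y : (forall s, 0 <= z s) ->
  (forall s, s \in Y -> s \in Sigma /\ 0 < z s) ->
  (exists u, [/\ u \in E, (k <= #|` u|)%N & forall s, s \in Sigma -> 0 < z s -> u `<=` s]) ->
  (exists2 s, s \in Sigma & 0 < z s) ->
  admissible (nerve_push z) Y.
Proof.
move=> z0 Yz [u0 [u0E u0k u0z]] [s0 s0S s0z].
pose Z := [fset s in Sigma | 0 < z s].
have ZE s : (s \in Z) = (s \in Sigma) && (0 < z s) by rewrite in_fset_pred.
have ZS : Z `<=` Sigma by apply/fsubsetP => s; rewrite ZE => /andP[].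
have Z0 : Z != fset0 by apply/fset0Pn; exists s0; rewrite ZE s0S.
have wZ : weight z Z != 0.
  apply/weight_neq0P => // s; rewrite ZE => /andP[sS sz]; split=> // s' s'S.
  by rewrite ZE s'S /= -leNgt => /le_lt_trans; apply.
pose c := [fset common_face S | S in fpowerset Sigma & (S != fset0) && (weight z S != 0)].
have cP w : w \in c -> exists S, [/\ S `<=` Sigma, S != fset0, w = common_face S & weight z S != 0].
  case/imfsetP => S /=; rewrite inE fpowersetE => /and3P[SS S0 Sz] ->.
  by exists S.
have cI S : S `<=` Sigma -> S != fset0 -> weight z S != 0 -> common_face S \in c.
  by move=> SS S0 Sz; apply/imfsetP; exists S => //=; rewrite inE fpowersetE SS S0.
exists c, (common_face Z); split.
- apply/(subdiv_simpsP _ _ (posnat_gt0 _)); split.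
  + by apply/fset0Pn; exists (common_face Z); exact: cI.
  + move=> w /cP[S [SS S0 -> Sz]].
    have u0S : u0 `<=` common_face S.
      rewrite sub_common_face //; apply/allP => s sS; apply: u0z; first exact: fsubsetP SS _ sS.
      by have [] := weight_neq0P S z0 Sz s sS.
    split; first exact: common_face_simps u0S.
    exact: leq_trans u0k (fsubset_leq_card u0S).
  + move=> _ _ /cP[S [SS S0 -> Sz]] /cP[S' [SS' S'0 -> S'z]].
    have [SS''|/fsubsetPn[s sS sS']] := boolP (S `<=` S').
      by rewrite orbC sub_common_face_anti.
    rewrite sub_common_face_anti //; apply/fsubsetP => s' s'S'.
    have [_ /(_ s' (fsubsetP SS' _ s'S')) h1] := weight_neq0P S z0 Sz s sS.
    have [_ /(_ s (fsubsetP SS _ sS) sS') h2] := weight_neq0P S' z0 S'z s' s'S'.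
    by apply: contraT => /h1 /(lt_trans h2); rewrite ltxx.
- by move=> u; exact: nerve_push_ge0.
- by move=> u /nerve_push_neq0[S [SS S0 -> Sz]]; exact: cI.
- apply: lt_le_trans (weight_le_push z0 ZS Z0).
  by rewrite lt_neqAle eq_sym wZ weight_ge0.
- by move=> s /Yz[sS sz]; apply: common_face_sub; rewrite ZE sS.
Qed.

Section Point.
Variable x : realization R (SF F p).
Local Notation X := (coord x).

Lemma flag_simps u : u \in supp x -> u \in E /\ (k <= #|` u|)%N.
Proof. by have /(subdiv_simpsP _ _ (posnat_gt0 _))[_ h _] := supp_simps x; exact: h. Qed.

Lemma flag_chain u v : u \in supp x -> v \in supp x -> (u `<=` v) || (v `<=` u).
Proof. by have /(subdiv_simpsP _ _ (posnat_gt0 _))[_ _ h] := supp_simps x; exact: h. Qed.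

Lemma sum_flag : \sum_(u <- E) X u = 1.
Proof. by apply: sum_coord => [|u /flag_simps[]]; first exact: fset_uniq. Qed.

Lemma exists_flag_min : exists2 u, u \in supp x & forall v, v \in supp x -> u `<=` v.
Proof.
have flagx : is_flag (supp x).
  rewrite /is_flag supp_neq0; apply/allP => u ux; apply/allP => v vx; exact: flag_chain.
by have [u ux /allP] := flag_min flagx; exists u.
Qed.

(** Each face gives its mass to every one of its maximal cofaces, which leaves
    coordinates to be normalized. *)
Definition coface_sum s : R := if s \in Sigma then \sum_(u <- E | u `<=` s) X u else 0.

Lemma coface_sum_ge0 s : 0 <= coface_sum s.
Proof. by rewrite /coface_sum; case: ifP => // _; apply: sumr_ge0 => u _; exact: coord_ge0. Qed.

Lemma le_coface_sum s u : u \in supp x -> s \in Sigma -> u `<=` s -> X u <= coface_sum s.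
Proof.
move=> ux sS us; rewrite /coface_sum sS big_mkcond (big_rem u) /=; last by case: (flag_simps ux).
by rewrite us lerDl; apply: sumr_ge0 => v _; case: ifP => // _; exact: coord_ge0.
Qed.

Lemma coface_sum_neq0 s : coface_sum s != 0 -> s \in Sigma /\ exists2 u, u \in supp x & u `<=` s.
Proof.
rewrite /coface_sum; case: ifP => [sS h|]; last by rewrite eqxx.
split=> //; apply: contrapT => h'; case/negP: h; apply/eqP.
apply: big1 => u us; apply/eqP; apply: contrapT => /negP; rewrite -mem_supp => ux.
by apply: h'; exists u.
Qed.

(** The coordinates of [coface_sum] grow with the number of members of the flag
    contained in a maximal simplex. *)
Lemma coface_sum_weight S : S != fset0 -> S `<=` Sigma -> weight coface_sum S != 0 ->
  exists2 u, u \in supp x & S = cofaces u.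
Proof.
move=> S0 SS /(weight_neq0P _ coface_sum_ge0) h.
(* [s0] has the least coordinate in [S], and [u] is the largest member of the
   flag that it contains. *)
have [s0 s0S smin] : exists2 s0, s0 \in S & forall s, s \in S -> coface_sum s0 <= coface_sum s.
  case/fset0Pn: S0 => s1 s1S.
  pose i1 : S := [` s1S].
  case: (@arg_minP _ _ _ i1 predT (fun s : S => coface_sum (val s)) isT) => s _ smin.
  by exists (val s) => [|s' s'S]; [exact: valP|exact: (smin [` s'S])].
have [s0z s0lt] := h _ s0S.
have [s0m [u1 u1x u1s]] := coface_sum_neq0 (lt0r_neq0 s0z).
have [u [ux us umax]] : exists u, [/\ u \in supp x, u `<=` s0 &
    forall v, v \in supp x -> v `<=` s0 -> v `<=` u].
  have [v /= vs vmax] := @arg_maxnP _ [` u1x] (fun v : supp x => val v `<=` s0) (fun v : supp x => #|` val v|) u1s.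
  exists (val v); split=> //; first exact: valP.
  move=> w wx ws; have /orP[//|vw] := flag_chain wx (valP v).
  have /eqP -> // : val v == w.
  by rewrite eqEfcard vw; exact: (vmax [` wx]).
exists u => //; apply/eqP; rewrite eqEfsubset; apply/andP; split; apply/fsubsetP => s.
  move=> sS; rewrite mem_cofaces (fsubsetP SS _ sS) /=; apply: contraT => us'.
  have := smin _ sS; rewrite leNgt => /negP[]; rewrite /coface_sum s0m (fsubsetP SS _ sS).
  rewrite [ltRHS]big_mkcond [ltRHS](big_rem u) /=; last by case: (flag_simps ux).
  rewrite us [ltLHS]big_mkcond [ltLHS](big_rem u) /=; last by case: (flag_simps ux).
  rewrite (negbTE us') add0r; apply: ltr_pwDl; first by rewrite -supp_gt0.
  apply: ler_sum => v _; case: (boolP (v `<=` s)) => vs; last first.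
    by case: ifP => // _; exact: coord_ge0.
  case: ifP => // /negbT vs0; have [->//|] := eqVneq (X v) 0.
  rewrite -mem_supp => vx; have /orP[uv|vu] := flag_chain ux vx.
    by rewrite (fsubset_trans uv vs) in us'.
  by rewrite (fsubset_trans vu us) in vs0.
rewrite mem_cofaces => /andP[sm us']; apply: contraT => sS.
have := s0lt s sm sS; rewrite ltNge => /negP[]; rewrite /coface_sum s0m sm.
rewrite [leLHS]big_mkcond [leRHS]big_mkcond; apply: ler_sum => v _.
case: ifP => vs0; last by case: ifP => // _; exact: coord_ge0.
have [->|] := eqVneq (X v) 0; first by case: ifP.
by rewrite -mem_supp => vx; rewrite (fsubset_trans (umax _ vx vs0) us').
Qed.

Definition upper_mass u : R := \sum_(v <- E | u `<` v) X v.

(** The mass of [u] that has moved to the hull of [u] once total mass [a] has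
    moved, the largest members of the flag moving first. *)
Definition moved (a : R) u : R := Num.min (X u) (Num.max 0 (a - upper_mass u)).

Definition hull_flow (a : R) w : R :=
  (X w - moved a w) + \sum_(u <- E | hull u == w) moved a u.

Lemma moved_ge0 a u : 0 <= moved a u.
Proof. by rewrite /moved le_min coord_ge0 le_max lexx. Qed.

Lemma moved_le a u : moved a u <= X u.
Proof. by rewrite /moved ge_min lexx. Qed.

Lemma moved_supp a u : moved a u != 0 -> u \in supp x.
Proof.
rewrite supp_gt0 => mu; apply: lt_le_trans (moved_le a u).
by rewrite lt_neqAle eq_sym mu moved_ge0.
Qed.

Lemma moved0 u : moved 0 u = 0.
Proof.
have um : 0 <= upper_mass u by apply: sumr_ge0 => v _; exact: coord_ge0.
by rewrite /moved sub0r (max_idPl _) ?oppr_le0 // (min_idPr _) ?coord_ge0.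
Qed.

Lemma upper_mass_lt u v : u \in E -> v \in E -> u `<` v ->
  X v + upper_mass v <= upper_mass u.
Proof.
move=> uE vE uv; rewrite /upper_mass [leRHS]big_mkcond [leRHS](big_rem v) //= uv lerD2l.
rewrite [leLHS]big_mkcond [leLHS](big_rem v) //= (negbTE (fproper_irrefl _)) add0r.
apply: ler_sum => w _; case: ifP => vw; last by case: ifP => // _; exact: coord_ge0.
by rewrite (fproper_sub_trans uv (fproper_sub vw)).
Qed.

(** The masses strictly above [u] leave room for that of [u] in the total mass
    one. *)
Lemma moved1 u : u \in E -> moved 1 u = X u.
Proof.
move=> uE; rewrite /moved; have le1 : X u + upper_mass u <= 1.
  rewrite -sum_flag [leRHS](big_rem u) //= lerD2l /upper_mass.
  rewrite [leLHS]big_mkcond [leLHS](big_rem u) //= (negbTE (fproper_irrefl _)) add0r.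
  by apply: ler_sum => w _; case: ifP => // _; exact: coord_ge0.
by rewrite (min_idPl _) // le_max lerBrDr le1 orbT.
Qed.

(** Mass that stays lies below mass that has moved. *)
Lemma moved_above a u v : moved a u != X u -> moved a v != 0 ->
  u \in supp x -> v \in supp x -> u `<=` v.
Proof.
move=> mu mv ux vx; have /orP[//|vu] := flag_chain ux vx.
have [<-|vu'] := eqVneq v u; first exact: fsubset_refl.
have {}vu : v `<` u by rewrite fproperEneq vu'.
case/eqP: mu; rewrite /moved (min_idPl _) // le_max; apply/orP; right.
have [uE _] := flag_simps ux; have [vE _] := flag_simps vx.
rewrite lerBrDr; apply: le_trans (upper_mass_lt vE uE vu) _.
apply/ltW; rewrite -subr_gt0 ltNge; apply: contra mv => h.
by rewrite /moved (max_idPl h) (min_idPr _) ?coord_ge0.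
Qed.

Lemma hull_flow_ge0 a w : 0 <= hull_flow a w.
Proof.
rewrite addr_ge0 ?subr_ge0 ?moved_le //; apply: sumr_ge0 => u _; exact: moved_ge0.
Qed.

Lemma hull_flow_neq0 a w : hull_flow a w != 0 ->
  (w \in supp x /\ moved a w != X w) \/
  exists u, [/\ u \in supp x, moved a u != 0 & w = hull u].
Proof.
have [mw|mw] := eqVneq (moved a w) (X w); last first.
  move=> h; have [xw|] := eqVneq (X w) 0; last by rewrite -mem_supp; left.
  exfalso; case/eqP: mw; apply/eqP; rewrite eq_le moved_le xw moved_ge0 //.
rewrite /hull_flow mw subrr add0r => h; right; apply: contrapT => h'.
case/negP: h; apply/eqP; apply: big1 => u /eqP uw; apply/eqP; apply: contrapT => /negP mu.
by apply: h'; exists u; split=> //; exact: moved_supp mu.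
Qed.

Lemma hull_flow_hull a u : u \in E -> moved a u <= hull_flow a (hull u).
Proof.
move=> uE; rewrite -[leLHS]add0r lerD ?subr_ge0 ?moved_le //.
rewrite big_mkcond (big_rem u) //= eqxx lerDl; apply: sumr_ge0 => v _.
by case: ifP => // _; exact: moved_ge0.
Qed.

Lemma hull_k u : u \in supp x -> hull u \in E /\ (k <= #|` hull u|)%N.
Proof.
move=> /flag_simps[uE uk]; split; first exact: hull_simps.
exact: leq_trans uk (fsubset_leq_card (sub_hull uE)).
Qed.

Lemma hull_chain u v : u \in supp x -> v \in supp x ->
  (hull u `<=` hull v) || (hull v `<=` hull u).
Proof.
move=> ux vx; have [uE _] := flag_simps ux; have [vE _] := flag_simps vx.
by have /orP[uv|vu] := flag_chain ux vx; [rewrite (hull_mono vE uv)|rewrite (hull_mono uE vu) orbT].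
Qed.

Definition linked_face Y u : Prop :=
  [/\ u \in supp x, Y `<=` Sigma & forall s, s \in Y -> u `<=` s].

Lemma linked_hull Y u : linked_face Y u -> forall s, s \in Y -> hull u `<=` s.
Proof.
move=> [ux YS uY] s sY; apply: common_face_sub.
by rewrite mem_cofaces uY // (fsubsetP YS).
Qed.

(** The members of the flag that retain mass lie below those that have lost
    some, and therefore below the hulls of the latter. *)
Lemma admissible_flow a Y u0 : linked_face Y u0 -> admissible (hull_flow a) Y.
Proof.
move=> lk; have [u0x YS u0Y] := lk; have [u0E _] := flag_simps u0x.
pose c := [fset u in supp x | moved a u != X u] `|`
  [fset hull u | u in supp x & moved a u != 0].
have cP w : reflect ((w \in supp x /\ moved a w != X w) \/
    exists u, [/\ u \in supp x, moved a u != 0 & w = hull u]) (w \in c).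
  rewrite in_fsetU (in_fset_pred (supp x)); apply: (iffP orP) => -[].
  - by move=> /andP[]; left.
  - by case/imfsetP => u /=; rewrite inE => /andP[ux mu ->]; right; exists u.
  - by case=> -> ->; left.
  - by case=> u [ux mu ->]; right; apply/imfsetP; exists u => //=; rewrite inE ux.
have flow_pos w : hull_flow a w != 0 -> 0 < hull_flow a w.
  by move=> h; rewrite lt_neqAle eq_sym h hull_flow_ge0.
have [w [hw wY]] : exists w, hull_flow a w != 0 /\ forall s, s \in Y -> w `<=` s.
  have [mu|mu] := eqVneq (moved a u0) (X u0).
    exists (hull u0); split; last exact: linked_hull.
    rewrite gt_eqF //; apply: lt_le_trans (hull_flow_hull a u0E).
    by rewrite mu -supp_gt0.
  exists u0; split=> //; rewrite gt_eqF //; apply: (@lt_le_trans _ _ (X u0 - moved a u0)).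
    by rewrite subr_gt0 lt_neqAle mu moved_le.
  by rewrite lerDl; apply: sumr_ge0 => u _; exact: moved_ge0.
exists c, w; split=> //.
- apply/(subdiv_simpsP _ _ (posnat_gt0 _)); split.
  + by apply/fset0Pn; exists w; apply/cP; exact: hull_flow_neq0.
  + by move=> v /cP[[vx _]|[u [ux _ ->]]]; [exact: flag_simps|exact: hull_k].
  + move=> v v' /cP[[vx mv]|[u [ux mu ->]]] /cP[[v'x mv']|[u' [u'x mu' ->]]].
    * exact: flag_chain.
    * by rewrite (fsubset_trans (moved_above mv mu' vx u'x)) // sub_hull //; case: (flag_simps u'x).
    * by rewrite orbC (fsubset_trans (moved_above mv' mu v'x ux)) // sub_hull //; case: (flag_simps ux).
    * exact: hull_chain.
- by move=> u; exact: hull_flow_ge0.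
- by move=> u /hull_flow_neq0 h; apply/cP.
- exact: flow_pos.
Qed.

Lemma hull_flow1_neq0 w : hull_flow 1 w != 0 -> exists2 u, u \in supp x & w = hull u.
Proof.
move=> /hull_flow_neq0[[wx]|[u [ux _ ->]]]; last by exists u.
by rewrite moved1 ?eqxx //; case: (flag_simps wx).
Qed.

Lemma push_coface_neq0 w : nerve_push coface_sum w != 0 -> exists2 u, u \in supp x & w = hull u.
Proof.
move=> /nerve_push_neq0[S [SS S0 -> /(coface_sum_weight S0 SS)[u ux ->]]].
by exists u.
Qed.

(** By [coface_sum_weight] both ends of the segment are supported on the chain
    of hulls. *)
Lemma admissible_mid b Y u0 : linked_face Y u0 -> 0 <= b < 1 ->
  admissible (fun w => (1 - b) * hull_flow 1 w + b * nerve_push coface_sum w) Y.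
Proof.
move=> lk /andP[b0 b1]; have [u0x YS u0Y] := lk; have [u0E _] := flag_simps u0x.
have b1' : 0 < 1 - b by rewrite subr_gt0.
pose c := [fset hull u | u in supp x].
have push0 w := nerve_push_ge0 w coface_sum_ge0.
exists c, (hull u0); split.
- apply/(subdiv_simpsP _ _ (posnat_gt0 _)); split.
  + by apply/fset0Pn; exists (hull u0); rewrite in_imfset.
  + by move=> _ /imfsetP[u /= ux ->]; exact: hull_k.
  + by move=> _ _ /imfsetP[u /= ux ->] /imfsetP[v /= vx ->]; exact: hull_chain.
- by move=> u; rewrite addr_ge0 // mulr_ge0 ?hull_flow_ge0 // ltW.
- move=> w h; have [hw|/hull_flow1_neq0[u ux ->]] := eqVneq (hull_flow 1 w) 0; last first.
    by rewrite in_imfset.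
  move: h; rewrite hw mulr0 add0r mulf_eq0 negb_or => /andP[_ /push_coface_neq0[u ux ->]].
  by rewrite in_imfset.
- apply: ltr_pwDl; last by rewrite mulr_ge0.
  rewrite mulr_gt0 //; apply: lt_le_trans (hull_flow_hull 1 u0E).
  by rewrite moved1 // -supp_gt0.
- exact: linked_hull.
Qed.

End Point.

Section Points.
Variables (x : realization R (SF F p)) (y : realization R (nerve_cplx F p)).
Local Notation Y := (coord y).

Lemma supp_nerve : supp y `<=` Sigma.
Proof. by have /nerve_simpsP[] := supp_simps y. Qed.

Lemma supp_nerve_face : exists u, [/\ u \in E, (k <= #|` u|)%N & forall s, s \in supp y -> u `<=` s].
Proof.
have /nerve_simpsP[yS y0 [u uk uy]] := supp_simps y; exists u; split=> //.
case/fset0Pn: y0 => s sy; apply: simps_closed (uy _ sy) _.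
  exact: maxsimps_simps (fsubsetP yS _ sy).
by rewrite -cardfs_gt0 (leq_trans _ uk) // posnat_gt0.
Qed.

Definition linked : Prop := exists2 u, u \in supp x & forall s, s \in supp y -> u `<=` s.

Lemma linked_min u : linked -> (forall v, v \in supp x -> u `<=` v) ->
  forall s, s \in supp y -> u `<=` s.
Proof. by move=> [v vx vy] umin s /vy; apply: fsubset_trans; exact: umin. Qed.

Lemma admissible_nerve_push : admissible (nerve_push Y) (supp y).
Proof.
have [u [uE uk uy]] := supp_nerve_face.
apply: admissible_push.
- by move=> s; exact: coord_ge0.
- by move=> s sy; rewrite -supp_gt0 sy (fsubsetP supp_nerve).
- by exists u; split=> // s _; rewrite -supp_gt0; exact: uy.
- have /fset0Pn[s sy] := supp_neq0 y; exists s; last by rewrite -supp_gt0.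
  exact: fsubsetP supp_nerve _ sy.
Qed.

(** The least member of the flag is a common face of all simplices in the
    support of the segment point, which contains the support of [y]. *)
Lemma admissible_end c : linked -> 0 <= c <= 1 ->
  admissible (nerve_push (fun s => (1 - c) * coface_sum x s + c * Y s)) (supp y).
Proof.
move=> lk /andP[c0 c1]; have c1' : 0 <= 1 - c by rewrite subr_ge0.
have [u ux umin] := exists_flag_min x; have uy := linked_min lk umin.
have [uE uk] := flag_simps ux.
have zpos s : s \in supp y -> s \in Sigma /\ 0 < (1 - c) * coface_sum x s + c * Y s.
  move=> sy; have sS := fsubsetP supp_nerve _ sy; split=> //.
  have cs : 0 < coface_sum x s.
    by apply: lt_le_trans (le_coface_sum ux sS (uy s sy)); rewrite -supp_gt0.
  have [->|cn] := eqVneq c 0; first by rewrite subr0 mul1r mul0r addr0.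
  apply: ltr_wpDl; first by rewrite mulr_ge0 // ltW.
  by rewrite mulr_gt0 -?supp_gt0 // lt_neqAle eq_sym cn.
apply: admissible_push => //.
- by move=> s; rewrite addr_ge0 // mulr_ge0 ?coface_sum_ge0 ?coord_ge0.
- exists u; split=> // s sS zs; have [cs|/coface_sum_neq0[_ [v vx vs]]] := eqVneq (coface_sum x s) 0; last first.
    exact: fsubset_trans (umin _ vx) vs.
  apply: uy; rewrite mem_supp; apply: contraTneq zs => ->.
  by rewrite cs !mulr0 addr0 ltxx.
- by have /fset0Pn[s /zpos[sS sz]] := supp_neq0 y; exists s.
Qed.

End Points.
End Comparison.

(** * The functorial nerve theorem *)

Section PushSupport.
Local Open Scope fset_scope.
Local Open Scope ring_scope.
Context (R : realType) (V V' : choiceType) (W : scomplex V) (W' : scomplex V').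
Variables (f : V -> V') (hf : forall s, s \in simps W -> f @` s \in simps W').

Lemma coord_push (x : realization R W) w :
  coord (push hf x) w = \sum_(v <- vertices W | f v == w) coord x v.
Proof. by []. Qed.

Lemma mem_supp_push (x : realization R W) w :
  w \in supp (push hf x) <-> exists2 v, v \in supp x & f v = w.
Proof.
rewrite mem_supp coord_push; split=> [h|[v vx <-]].
  apply: contrapT => h'; case/negP: h; apply/eqP; apply: big1 => v /eqP fv.
  by apply/eqP; apply: contrapT => /negP; rewrite -mem_supp => vx; apply: h'; exists v.
have vW : v \in vertices W by exact: vertexE (supp_simps x) vx.
rewrite gt_eqF // big_mkcond (big_rem v) //= eqxx; apply: ltr_pwDl; first by rewrite -supp_gt0.
by apply: sumr_ge0 => u _; case: ifP => // _; exact: coord_ge0.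
Qed.

End PushSupport.

Section ParameterContinuity.
Local Open Scope fset_scope.
Local Open Scope ring_scope.
Context (R : realType) d (T : orderType d) (V : choiceType) (F : filtration T V).
Variables (p : posnat^d *p T) (Q : topologicalType).

Lemma cont_weight (z : Q -> {fset V} -> R) S :
  (forall s, continuous (fun q => z q s)) -> continuous (fun q => weight F p (z q) S).
Proof.
move=> cz; apply: cont_prod => s _; apply: cont_mul; first exact: cz.
by apply: cont_prod => s' _; apply: cont_max; [exact: cont_cst|exact: cont_sub].
Qed.

Lemma cont_nerve_push (z : Q -> {fset V} -> R) u :
  (forall s, continuous (fun q => z q s)) -> continuous (fun q => nerve_push F p (z q) u).
Proof. by move=> cz; apply: cont_sum => S _; exact: cont_weight. Qed.

Variable x : Q -> realization R (SF F p).
Hypothesis cx : continuous x.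

Lemma cont_point u : continuous (fun q => coord (x q) u).
Proof.
move=> q; apply: (@continuous_comp _ _ _ x (fun y => coord y u)); first exact: cx.
exact: cont_coord.
Qed.

Lemma cont_coface_sum s : continuous (fun q => coface_sum (x q) s).
Proof.
rewrite /coface_sum; case: (s \in _); last exact: cont_cst.
by apply: cont_sum => u _; exact: cont_point.
Qed.

Lemma cont_moved (a : Q -> R) u : continuous a -> continuous (fun q => moved (x q) (a q) u).
Proof.
move=> ca; apply: cont_min; first exact: cont_point.
apply: cont_max; first exact: cont_cst.
by apply: cont_sub => //; apply: cont_sum => v _; exact: cont_point.
Qed.

Lemma cont_hull_flow (a : Q -> R) w : continuous a ->
  continuous (fun q => hull_flow (x q) (a q) w).
Proof.
move=> ca; apply: cont_add; first by apply: cont_sub; [exact: cont_point|exact: cont_moved].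
by apply: cont_sum => u _; exact: cont_moved.
Qed.

End ParameterContinuity.

Section NerveTheorem.
Local Open Scope fset_scope.
Local Open Scope ring_scope.
Context (R : realType) d (T : orderType d) (V : choiceType) (F : filtration T V).
Variable lev : rel V.
Hypothesis lev_wo : wo_chain lev (mem (colim_vertices F)).
Local Notation NF := (realization_functor R (SFunctor (nerve_is_sfunctor lev_wo))).
Local Notation SSF := (realization_functor R (filtration_sfunctor (SF F))).
Local Notation P := (posnat^d *p T)%type.

Section Space.
Variable p : P.

(** The correspondence between subdivision and nerve. The smaller members of a
    flag lie in more maximal simplices, so that it suffices to require the
    incidence for one member; this makes the condition stable under the
    retractions used below. *)
Definition link_set : set (realization R (SF F p) * realization R (nerve_cplx F p)) :=
  [set z | linked z.1 z.2]%classic.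

Definition link_space : topologicalType := set_type link_set.

Definition link_fst (z : link_space) : realization R (SF F p) := (set_val z).1.
Definition link_snd (z : link_space) : realization R (nerve_cplx F p) := (set_val z).2.

Definition mk_link x y (h : linked x y) : link_space :=
  exist _ (x, y) (@mem_set _ link_set (x, y) h).

Lemma link_linked z : linked (link_fst z) (link_snd z).
Proof. exact: set_valP z. Qed.

Lemma link_ext z z' : link_fst z = link_fst z' -> link_snd z = link_snd z' -> z = z'.
Proof.
move=> h1 h2; apply: val_inj.
by rewrite [LHS]surjective_pairing [RHS]surjective_pairing; congr pair.
Qed.

Lemma cont_set_val : continuous (set_val : link_space -> _).
Proof. exact: initial_continuous. Qed.

Lemma cont_link_fst : continuous link_fst.
Proof. by move=> z; apply: (@continuous_comp _ _ _ set_val fst); [exact: cont_set_val|exact: cvg_fst]. Qed.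

Lemma cont_link_snd : continuous link_snd.
Proof. by move=> z; apply: (@continuous_comp _ _ _ set_val snd); [exact: cont_set_val|exact: cvg_snd]. Qed.

Lemma continuous_link (X : topologicalType) (f : X -> link_space) :
  continuous (fun x => link_fst (f x)) -> continuous (fun x => link_snd (f x)) -> continuous f.
Proof.
move=> c1 c2; apply: (@continuous_comp_initial _ _ _ set_val f).
rewrite (_ : set_val \o f = fun x => (link_fst (f x), link_snd (f x))).
  exact: cont_pair.
by apply/funext => x /=; rewrite /link_fst /link_snd; case: (set_val _).
Qed.

End Space.

Fact link_map_subproof p q (h : (p <= q)%O) (z : link_space p) :
  linked (tmap (t := SSF) h (link_fst z)) (tmap (t := NF) h (link_snd z)).
Proof.
have [u ux uy] := link_linked z; exists u.
  by apply/mem_supp_push; exists u.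
move=> s /mem_supp_push[s' s'y <-].
exact: fsubset_trans (uy _ s'y) (sub_cover_map _ _ _ _ _).
Qed.

Definition link_map p q (h : (p <= q)%O) (z : link_space p) : link_space q :=
  mk_link (link_map_subproof h z).

Fact link_map_continuous p q (h : (p <= q)%O) : continuous (link_map h).
Proof.
apply: continuous_link.
- move=> z; apply: (@continuous_comp _ _ _ (@link_fst p) (tmap (t := SSF) h)).
    exact: cont_link_fst.
  exact: (tmap_continuous (t := SSF)).
- move=> z; apply: (@continuous_comp _ _ _ (@link_snd p) (tmap (t := NF) h)).
    exact: cont_link_snd.
  exact: (tmap_continuous (t := NF)).
Qed.

Fact link_map_id p (h : (p <= p)%O) z : link_map h z = z.
Proof. by apply: link_ext; [exact: (tmap_id (t := SSF))|exact: (tmap_id (t := NF))]. Qed.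

Fact link_map_comp p q r (h : (p <= q)%O) (h' : (q <= r)%O) (h'' : (p <= r)%O) z :
  link_map h'' z = link_map h' (link_map h z).
Proof. by apply: link_ext; [exact: (tmap_comp (t := SSF))|exact: (tmap_comp (t := NF))]. Qed.

Definition link_functor : tfunctor P :=
  TFunctor link_map_continuous link_map_id link_map_comp.

Lemma homotopic_eq (X Y : topologicalType) (f g : X -> Y) :
  continuous f -> (forall x, f x = g x) -> homotopic R f g.
Proof.
move=> cf fg; apply: (homotopic_of (H := fun z : X * R => f z.1)) => // z.
by apply: (@continuous_comp _ _ _ fst f); [exact: cvg_fst|exact: cf].
Qed.

Section Equivalences.
Variable p : P.
Local Notation E := (simps (F p.2)).
Local Notation Sigma := (maxsimps (F p.2)).
Local Notation k := (p.1 : posnat).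

Lemma normalize_neq0 (r : seq {fset V}) (c : {fset V} -> R) v : normalize r c v != 0 -> c v != 0.
Proof. by rewrite /normalize mulf_eq0 negb_or => /andP[]. Qed.

Lemma cofaces_nerve u : u \in E -> (k <= #|` u|)%N -> cofaces F p u \in nerve_simps F p.
Proof.
move=> uE uk; apply/nerve_simpsP; split; [exact: cofaces_sub|exact: cofaces_neq0|].
by exists u => // s; rewrite mem_cofaces => /andP[].
Qed.

Fact coface_bary (x : realization R (SF F p)) :
  bary_coords (nerve_cplx F p) (normalize Sigma (coface_sum x)).
Proof.
have [u ux umin] := exists_flag_min x; have [uE uk] := flag_simps ux.
apply: (@bary_normalize R _ (nerve_cplx F p) (cofaces F p u) Sigma (coface_sum x)).
- exact: cofaces_nerve.
- exact: fset_uniq.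
- exact/fsubsetP/cofaces_sub.
- exact: coface_sum_ge0.
- move=> s /coface_sum_neq0[sS [v vx vs]]; rewrite mem_cofaces sS.
  exact: fsubset_trans (umin _ vx) vs.
have [s sm us] := exists_maxsimps uE; rewrite (big_rem s) //=; apply: ltr_pwDl.
  by apply: lt_le_trans (le_coface_sum ux sm us); rewrite -supp_gt0.
by apply: sumr_ge0 => s' _; exact: coface_sum_ge0.
Qed.

Definition coface_point (x : realization R (SF F p)) : realization R (nerve_cplx F p) :=
  mk_point (coface_bary x).

Lemma supp_coface_point x u : u \in supp x -> (forall v, v \in supp x -> u `<=` v) ->
  supp (coface_point x) `<=` cofaces F p u.
Proof.
move=> ux umin; apply/fsubsetP => s; rewrite mem_supp => /normalize_neq0.
move=> /coface_sum_neq0[sS [v vx vs]]; rewrite mem_cofaces sS.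
exact: fsubset_trans (umin _ vx) vs.
Qed.

Lemma coface_linked x : linked x (coface_point x).
Proof.
have [u ux umin] := exists_flag_min x; exists u => // s.
by move=> /(fsubsetP (supp_coface_point ux umin)); rewrite mem_cofaces => /andP[].
Qed.

Lemma cont_normalize (Q : topologicalType) (r : seq {fset V}) (c : Q -> {fset V} -> R) v :
  (forall v, continuous (fun q => c q v)) -> (forall q, 0 < \sum_(u <- r) c q u) ->
  continuous (fun q => normalize r (c q) v).
Proof.
move=> cc c0; apply: cont_mul; first exact: cc.
apply: cont_inv => [q|]; first by rewrite gt_eqF.
by apply: cont_sum => u _; exact: cc.
Qed.

Lemma sum_coface_gt0 (x : realization R (SF F p)) : 0 < \sum_(s <- Sigma) coface_sum x s.
Proof.
have [u ux umin] := exists_flag_min x; have [uE uk] := flag_simps ux.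
have [s sm us] := exists_maxsimps uE; rewrite (big_rem s) //=; apply: ltr_pwDl.
  by apply: lt_le_trans (le_coface_sum ux sm us); rewrite -supp_gt0.
by apply: sumr_ge0 => s' _; exact: coface_sum_ge0.
Qed.

Lemma cont_coface_point : continuous coface_point.
Proof.
apply: continuous_realization => s; apply: cont_normalize; last exact: sum_coface_gt0.
by move=> s'; apply: (@cont_coface_sum _ _ _ _ _ _ _ id) => x; exact: cvg_id.
Qed.

Lemma clamp01 (t : R) : 0 <= clamp t <= 1.
Proof. by rewrite clamp_ge0 clamp_le1. Qed.

Lemma common_cofaces (z : link_space p) : exists S, [/\ S \in nerve_simps F p,
  supp (coface_point (link_fst z)) `<=` S, supp (link_snd z) `<=` S &
  exists2 u, u \in supp (link_fst z) & forall s, s \in S -> u `<=` s].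
Proof.
have [u ux umin] := exists_flag_min (link_fst z); have [uE uk] := flag_simps ux.
exists (cofaces F p u); split.
- exact: cofaces_nerve.
- exact: supp_coface_point.
- apply/fsubsetP => s sy; rewrite mem_cofaces (fsubsetP (supp_nerve (link_snd z)) _ sy).
  exact: (linked_min (link_linked z) umin sy).
- by exists u => // s; rewrite mem_cofaces => /andP[].
Qed.

(** The section spreads each face over its maximal cofaces, and a fiber of the
    projection is the simplex of all maximal cofaces of the least member of
    the flag. *)
Lemma link_fst_equivalence : homotopy_equivalence R (@link_fst p).
Proof.
split; first exact: cont_link_fst.
exists (fun x => mk_link (coface_linked x)); split.
- by apply: continuous_link; [move=> x; exact: cvg_id|exact: cont_coface_point].
- have ex (z : link_space p * R) : exists2 w : link_space p, link_fst w = link_fst z.1 &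
      forall s, coord (link_snd w) s =
        (1 - clamp z.2) * coord (coface_point (link_fst z.1)) s +
        clamp z.2 * coord (link_snd z.1) s.
    have [S [SN xS yS [u ux uS]]] := common_cofaces z.1.
    have b := bary_mix (W := nerve_cplx F p) SN xS yS (clamp01 z.2).
    have l : linked (link_fst z.1) (mk_point b).
      exists u => // s; rewrite mem_supp coord_mk => h; apply: uS; apply: contraT => sS.
      have h1 : coord (coface_point (link_fst z.1)) s = 0.
        by apply/eqP/negPn; rewrite -mem_supp; apply: contra sS; exact: fsubsetP.
      have h2 : coord (link_snd z.1) s = 0.
        by apply/eqP/negPn; rewrite -mem_supp; apply: contra sS; exact: fsubsetP.
      by rewrite h1 h2 !mulr0 addr0 eqxx in h.
    by exists (mk_link l).
  pose H z : link_space p := projT1 (cid2 (ex z)).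
  have H1 z : link_fst (H z) = link_fst z.1 by rewrite /H; case: cid2.
  have H2 z s : coord (link_snd (H z)) s = (1 - clamp z.2) * coord (coface_point (link_fst z.1)) s +
        clamp z.2 * coord (link_snd z.1) s by rewrite /H; case: cid2.
  have cz1 : continuous (fun z : link_space p * R => link_fst z.1).
    by move=> z; apply: (@continuous_comp _ _ _ fst (@link_fst p)); [exact: cvg_fst|exact: cont_link_fst].
  have cz2 : continuous (fun z : link_space p * R => link_snd z.1).
    by move=> z; apply: (@continuous_comp _ _ _ fst (@link_snd p)); [exact: cvg_fst|exact: cont_link_snd].
  have ct : continuous (fun z : link_space p * R => clamp z.2).
    by apply: cont_clamp => z; exact: cvg_snd.
  apply: (homotopic_of (H := H)).
  + apply: continuous_link; first by under eq_fun do rewrite H1; exact: cz1.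
    apply: continuous_realization => s; under eq_fun do rewrite H2.
    apply: cont_add; apply: cont_mul => //.
    * by apply: cont_sub => //; exact: cont_cst.
    * move=> z; apply: (@continuous_comp _ _ _ (fun z : link_space p * R => coface_point (link_fst z.1)) (fun y => coord y s)).
        by apply: (@continuous_comp _ _ _ (fun z : link_space p * R => link_fst z.1) coface_point); [exact: cz1|exact: cont_coface_point].
      exact: cont_coord.
    * move=> z; apply: (@continuous_comp _ _ _ (fun z : link_space p * R => link_snd z.1) (fun y => coord y s)); first exact: cz2.
      exact: cont_coord.
  + move=> z; apply: link_ext; first by rewrite H1.
    by apply: coord_inj => s; rewrite H2 /= clamp_below // subr0 mul1r mul0r addr0.
  + move=> z; apply: link_ext; first by rewrite H1.
    by apply: coord_inj => s; rewrite H2 /= clamp_above // subrr mul1r mul0r add0r.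
- by apply: homotopic_eq => // x; exact: cvg_id.
Qed.

Lemma admissible_linked h (y : realization R (nerve_cplx F p))
    (hb : bary_coords (SF F p) (normalize E h)) :
  admissible F p h (supp y) -> linked (mk_point hb) y.
Proof.
move=> ad; have s0 := admissible_sum_gt0 ad; case: ad => c [w [_ _ _ hw wy]].
by exists w => //; rewrite mem_supp coord_mk mulf_neq0 ?invr_eq0 ?gt_eqF.
Qed.

Definition push_point (y : realization R (nerve_cplx F p)) : realization R (SF F p) :=
  mk_point (admissible_bary (admissible_nerve_push y)).

Lemma cont_push_point : continuous push_point.
Proof.
apply: continuous_realization => u; apply: cont_normalize => [v|y].
  by apply: cont_nerve_push => s; exact: cont_coord.
exact: admissible_sum_gt0 (admissible_nerve_push y).
Qed.

(** The homotopy from the identity to the section over the nerve runs through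
    three stages, one on each third of the interval: the mass of the flag moves
    to the hulls, from there linearly to the image of the coface sums, and
    then along the segment to the given point of the nerve. Each of the three
    parameters is constant outside its stage, which makes one formula
    continuous throughout. *)
Definition stages (z : link_space p) (t : R) (w : {fset V}) : R :=
  (1 - clamp (3 * t - 1)) * hull_flow (link_fst z) (clamp (3 * t)) w +
  clamp (3 * t - 1) * nerve_push F p (fun s =>
    (1 - clamp (3 * t - 2)) * coface_sum (link_fst z) s +
    clamp (3 * t - 2) * coord (link_snd z) s) w.

Lemma admissible_stages z t : admissible F p (stages z t) (supp (link_snd z)).
Proof.
have lk := link_linked z; have [u ux uy] := lk.
have lf : linked_face (link_fst z) (supp (link_snd z)) u.
  by split=> //; exact: supp_nerve.
have [t1|t1] := leP (3 * t - 1) 0.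
  rewrite (_ : stages z t = hull_flow (link_fst z) (clamp (3 * t))).
    exact: admissible_flow lf.
  by apply/funext => w; rewrite /stages clamp_below // subr0 mul1r mul0r addr0.
have [t2|t2] := leP 1 (3 * t - 1).
  rewrite (_ : stages z t = nerve_push F p (fun s =>
    (1 - clamp (3 * t - 2)) * coface_sum (link_fst z) s +
    clamp (3 * t - 2) * coord (link_snd z) s)).
    by apply: admissible_end => //; exact: clamp01.
  by apply/funext => w; rewrite /stages clamp_above // subrr mul1r mul0r add0r.
rewrite (_ : stages z t = fun w => (1 - clamp (3 * t - 1)) * hull_flow (link_fst z) 1 w +
    clamp (3 * t - 1) * nerve_push F p (coface_sum (link_fst z)) w).
  apply: admissible_mid lf _; rewrite clamp_ge0 /=.
  by rewrite /clamp gt_min gt_max ltr01 t2 orbT.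
apply/funext => w; rewrite /stages (clamp_above (t := 3 * t)); last first.
  by rewrite -subr_ge0 ltW.
rewrite (clamp_below (t := 3 * t - 2)); last first.
  by lra.
congr (_ + _ * nerve_push F p _ w); apply/funext => s.
by rewrite subr0 mul1r mul0r addr0.
Qed.

Lemma stages0 z w : stages z 0 w = coord (link_fst z) w.
Proof.
rewrite /stages mulr0 !sub0r [clamp (- 1)]clamp_below ?oppr_le0 // subr0 mul1r mul0r addr0.
rewrite clamp_below // /hull_flow moved0 subr0 big1 ?addr0 // => u _.
exact: moved0.
Qed.

Lemma stages1 z : stages z 1 = nerve_push F p (coord (link_snd z)).
Proof.
have c1 : (1 : R) <= 3 - 1 by lra.
have c2 : (1 : R) <= 3 - 2 by lra.
apply/funext => w; rewrite /stages mulr1 (clamp_above c1) (clamp_above c2).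
rewrite subrr mul0r mul1r add0r; congr (nerve_push F p _ w); apply/funext => s.
by rewrite mul0r mul1r add0r.
Qed.

Definition stages_point z t : link_space p :=
  mk_link (admissible_linked (admissible_bary (admissible_stages z t)) (admissible_stages z t)).

(** The section is [push_point], and the homotopy is [stages] run backwards.
    *)
Lemma link_snd_equivalence : homotopy_equivalence R (@link_snd p).
Proof.
split; first exact: cont_link_snd.
exists (fun y => mk_link (admissible_linked (admissible_bary (admissible_nerve_push y))
  (admissible_nerve_push y))); split.
- by apply: continuous_link; [exact: cont_push_point|move=> x; exact: cvg_id].
- pose H (z : link_space p * R) := stages_point z.1 (1 - z.2).
  have cz1 : continuous (fun z : link_space p * R => link_fst z.1).
    by move=> z; apply: (@continuous_comp _ _ _ fst (@link_fst p)); [exact: cvg_fst|exact: cont_link_fst].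
  have cz2 : continuous (fun z : link_space p * R => link_snd z.1).
    by move=> z; apply: (@continuous_comp _ _ _ fst (@link_snd p)); [exact: cvg_fst|exact: cont_link_snd].
  have ct : continuous (fun z : link_space p * R => 3 * (1 - z.2)).
    apply: cont_mul; first exact: cont_cst.
    by apply: cont_sub; [exact: cont_cst|move=> z; exact: cvg_snd].
  have ctc c : continuous (fun z : link_space p * R => clamp (3 * (1 - z.2) - c)).
    by apply: cont_clamp; apply: cont_sub => //; exact: cont_cst.
  have ctc1 c : continuous (fun z : link_space p * R => 1 - clamp (3 * (1 - z.2) - c)).
    by apply: cont_sub => //; exact: cont_cst.
  have cst u : continuous (fun z : link_space p * R => stages z.1 (1 - z.2) u).
    apply: cont_add; apply: cont_mul => //.
      by apply: (cont_hull_flow (x := fun z => link_fst z.1)) => //; exact: cont_clamp.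
    apply: (cont_nerve_push (z := fun (z : link_space p * R) s =>
      (1 - clamp (3 * (1 - z.2) - 2)) * coface_sum (link_fst z.1) s +
      clamp (3 * (1 - z.2) - 2) * coord (link_snd z.1) s)) => s; apply: cont_add; apply: cont_mul => //.
      exact: (cont_coface_sum (x := fun z : link_space p * R => link_fst z.1)).
    move=> z; apply: (@continuous_comp _ _ _ (fun z : link_space p * R => link_snd z.1) (fun y => coord y s)); first exact: cz2.
    exact: cont_coord.
  apply: (homotopic_of (H := H)).
  + apply: continuous_link; last exact: cz2.
    apply: continuous_realization => u.
    apply: (cont_normalize (c := fun z : link_space p * R => stages z.1 (1 - z.2))) => // z.
    exact: admissible_sum_gt0 (admissible_stages z.1 (1 - z.2)).
  + move=> z; apply: link_ext => //; apply: coord_inj => w.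
    by rewrite !coord_mk /= subr0 stages1.
  + move=> z; apply: link_ext => //; apply: coord_inj => w.
    rewrite coord_mk /= subrr /normalize stages0.
    by under eq_bigr do rewrite stages0; rewrite sum_flag divr1.
- by apply: homotopic_eq => // x; exact: cvg_id.
Qed.

End Equivalences.

(** Both projections of the space of linked pairs are natural. *)
Theorem nerve_model : simplicial_model R (SFunctor (nerve_is_sfunctor lev_wo)) SSF.
Proof.
apply: (@rst_trans _ _ _ link_functor).
  apply/rst_sym/rst_step; exists (fun p => @link_snd p); split=> //.
  exact: link_snd_equivalence.
apply/rst_step; exists (fun p => @link_fst p); split=> //.
exact: link_fst_equivalence.
Qed.

End NerveTheorem.

(** * The theorem *)

Theorem theorem1p4 :
  exists C : nat,
  forall (R : realType) (K : fieldType)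
    (d : Order.disp_t) (T : orderType d) (V : choiceType)
    (F : filtration T V),
  finitely_presented K (filtration_sfunctor F) ->
  (forall lev : rel V, wo_chain lev (mem (colim_vertices F)) ->
    exists NFP : is_sfunctor (nerve_diagram F lev),
      simplicial_model R (SFunctor NFP)
        (realization_functor R (filtration_sfunctor (SF F))) /\
      forall k : nat, exists n : nat,
        has_size K (skeleton k (SFunctor NFP)) n /\ (n <= C * m_num F k)%N) /\
  (forall G : sfunctor (posnat^d *p T),
    simplicial_model R G (realization_functor R (filtration_sfunctor (SF F))) ->
    forall n : nat, has_size K (skeleton 0 G) n -> (m_num F 0 <= n)%N).
Proof.
(* One for the generators in all degrees, one for the relations in degree 0. *)
exists 2 => R K d T V F Ffp; have [A critA] := critical_grades Ffp.
split=> [lev lev_wo|G model n]; last exact: (model_size_lower_bound critA model).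
exists (nerve_is_sfunctor lev_wo); split; first exact: nerve_model.
exact: nerve_skeleton_size critA.
Qed.
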